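(* Let $M$ be a smooth, connected, compact Riemannian manifold without boundary and let $H:T^*M\times\mathbb{R}\to\mathbb{R}$, $(x,p,u)\mapsto H(x,p,u)$, be of class $C^3$ such that: (i) for every $(x,p,u)\in T^*M\times\mathbb{R}$, $\frac{\partial^2 H}{\partial p^2}(x,p,u)$ is positive definite; (ii) for every $(x,u)\in M\times\mathbb{R}$ and every $A<+\infty$ there is a constant $C(A,x,u)<+\infty$ with $H(x,p,u)\ge A\|p\|-C(A,x,u)$ for all $p\in T_x^*M$; (iii) there is $\lambda>0$ with $\left|\frac{\partial H}{\partial u}(x,p,u)\right|\le\lambda$ for all $(x,p,u)\in T^*M\times\mathbb{R}$. Let $P:T^*M\times\mathbb{R}\to\mathbb{R}$ be a $C^3$ function with compact support and $|P(x,p,u)|\le 1$ for all $(x,p,u)\in T^*M\times\mathbb{R}$. Let $u_-\in C(M,\mathbb{R})$ be a viscosity solution of $$H(x,D_xu(x),u(x))=0,\quad x\in M,$$ and suppose that $u_-$ is (locally) Lyapunov asymptotically stable. Then for every $\delta>0$ there exists $\varepsilon_\delta>0$ such that for all $\varepsilon\in[0,\varepsilon_\delta]$ the equation $$H(x,D_xu(x),u(x))+\varepsilon P(x,D_xu(x),u(x))=0,\quad x\in M,$$ has at least one viscosity solution $u_-^\varepsilon$ satisfying $\|u_-^\varepsilon-u_-\|_\infty\le\delta$.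
   Context: The Lagrangian of $H$ is $L(x,\dot x,u)=\sup_{p\in T_x^*M}\{\langle\dot x,p\rangle-H(x,p,u)\}$ on $TM\times\mathbb{R}$. The backward solution semigroup $\{T_t^-\}_{t\ge0}$ on $C(M,\mathbb{R})$ is defined as follows: for $\varphi\in C(M,\mathbb{R})$, $(x,t)\mapsto T_t^-\varphi(x)$ is the unique continuous function on $M\times[0,+\infty)$ such that $$T_t^-\varphi(x)=\inf_\gamma\Big\{\varphi(\gamma(0))+\int_0^tL(\gamma(\tau),\dot\gamma(\tau),T_\tau^-\varphi(\gamma(\tau)))\,d\tau\Big\},$$ the infimum being over absolutely continuous curves $\gamma:[0,t]\to M$ with $\gamma(t)=x$. Equivalently, $T_t^-\varphi(x)$ is the unique viscosity solution of $\partial_tu+H(x,D_xu,u)=0$ on $(0,+\infty)\times M$ with $u(0,\cdot)=\varphi$. A viscosity solution $u$ of $H(x,D_xu,u)=0$ is Lyapunov stable if for every $\eta>0$ there is $\rho>0$ such that $\|\varphi-u\|_\infty<\rho$, $\varphi\in C(M,\mathbb{R})$, implies $\|T_t^-\varphi-u\|_\infty<\eta$ for all $t>0$. It is (locally) Lyapunov asymptotically stable if it is Lyapunov stable and there is $\rho>0$ such that $\lim_{t\to+\infty}\|T_t^-\varphi-u\|_\infty=0$ for every $\varphi\in C(M,\mathbb{R})$ with $\|\varphi-u\|_\infty<\rho$. *)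

(* Defs.v *)
From HB Require Import structures.
From mathcomp Require Import all_boot all_order all_algebra.
From mathcomp Require Import all_classical all_reals all_analysis.

Set Implicit Arguments.
Unset Strict Implicit.
Unset Printing Implicit Defensive.

Import Order.TTheory GRing.Theory Num.Theory.
Import numFieldNormedType.Exports.

Local Open Scope classical_set_scope.
Local Open Scope ring_scope.

Fixpoint Ck_on (R : realType) (V W : normedModType R) (k : nat) (U : set V)
    (f : V -> W) : Prop :=
  if k is k'.+1 then
    (forall x, U x -> differentiable f x) /\
    (forall v : V, Ck_on k' U (fun x => 'D_v f x))
  else forall x, U x -> {for x, continuous f}.

Definition gradient (R : realType) (n : nat) (f : 'rV[R]_n -> R) (y : 'rV[R]_n)
    : 'rV[R]_n :=
  \row_j 'D_('e_j) f y.

Definition hessian (R : realType) (n : nat) (f : 'rV[R]_n -> R) (y : 'rV[R]_n)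
    : 'M[R]_n :=
  \matrix_(i, j) 'D_('e_i) (fun z => 'D_('e_j) f z) y.

Definition posdef (R : realType) (n : nat) (S : 'M[R]_n) : Prop :=
  forall v : 'rV[R]_n, v != 0 -> 0 < (v *m S *m v^T) 0 0.

(* A smooth [n]-dimensional atlas on [M] that has one chart around each point.
   Any smooth atlas can be cut down to (or reindexed as) one of this form
   without changing the smooth structure.  [chart c] and [cinv c] are total
   functions, of which only the restrictions to [dom c] and to its image are
   meaningful. *)
Record atlas (R : realType) (n : nat) (M : topologicalType) := Atlas {
  dom : M -> set M ;
  chart : M -> M -> 'rV[R]_n ;
  cinv : M -> 'rV[R]_n -> M ;
  dom_center : forall c, dom c c ;
  dom_open : forall c, open (dom c) ;
  img_open : forall c, open (chart c @` dom c) ;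
  chartK : forall c x, dom c x -> cinv c (chart c x) = x ;
  chart_continuous : forall c x, dom c x -> {for x, continuous (chart c)} ;
  cinv_continuous : forall c y, (chart c @` dom c) y ->
    {for y, continuous (cinv c)} ;
  chart_smooth : forall c d k,
    Ck_on k (chart c @` (dom c `&` dom d)) (chart d \o cinv c)
}.

(* The total space of the cotangent bundle.  A cotangent vector at [x] is
   represented by the row of its coordinates in the chart [chart A x] around
   [x]; the atlas [A] appears in the topology of [cotangent A]. *)
Definition cotangent (R : realType) (n : nat) (M : topologicalType)
  (A : atlas R n M) : Type := (M * 'rV[R]_n)%type.

Section Manifold.
Context {R : realType} {n : nat} {M : topologicalType} (A : atlas R n M).

HB.instance Definition _ := Choice.copy (cotangent A) (M * 'rV[R]_n)%type.

Definition img (c : M) : set 'rV[R]_n := chart A c @` dom A c.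

Definition Ck (k : nat) (f : M -> R) : Prop :=
  forall c, Ck_on k (img c) (f \o cinv A c : _ -> R^o).

(* Tangent vectors at [x] are likewise given in the chart [chart A x]; the
   coordinates of [v] in another chart [c] are
   [v *m 'J (chart A c \o cinv A x) (chart A x x)], and cotangent vectors
   transform so as to preserve the pairing. *)
Definition pairing (v p : 'rV[R]_n) : R := (v *m p^T) 0 0.

(* The inverse of the bundle chart of T*M induced by [chart A c]: the covector
   at [cinv A c z.1] whose coordinates in [chart A c] are [z.2]. *)
Definition cotangent_of_chart (c : M) (z : 'rV[R]_n * 'rV[R]_n) : cotangent A :=
  let x := cinv A c z.1 in
  (x, z.2 *m ('J (chart A c \o cinv A x) (chart A x x))^T).

(* The topology of T*M as a vector bundle, which is NOT the product topology
   of [M * 'rV[R]_n]: the coordinates of a covector depend on the choice of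
   the chart at its base point, which varies arbitrarily. *)
Definition cotangent_open (O : set (cotangent A)) : Prop :=
  forall c, open [set z | img c z.1 /\ O (cotangent_of_chart c z)].

Lemma cotangent_openT : cotangent_open setT.
Proof.
move=> c; rewrite (_ : [set _ | _] = fst @^-1` img c).
  by apply: open_comp => [? _|]; [exact: cvg_fst | exact: img_open].
by apply/seteqP; split => z //= [].
Qed.

Lemma cotangent_openI : setI_closed cotangent_open.
Proof.
move=> O P oO oP c; rewrite (_ : [set _ | _] =
  [set z | img c z.1 /\ O (cotangent_of_chart c z)] `&`
  [set z | img c z.1 /\ P (cotangent_of_chart c z)]); first exact: openI.
by apply/seteqP; split => z /= [] => [? [? ?]|[? ?] [? ?]].
Qed.

Lemma cotangent_open_bigU (I : Type) (O : I -> set (cotangent A)) :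
  (forall i, cotangent_open (O i)) -> cotangent_open (\bigcup_i O i).
Proof.
move=> oO c; rewrite (_ : [set _ | _] =
  \bigcup_i [set z | img c z.1 /\ O i (cotangent_of_chart c z)]).
  by apply: bigcup_open => i _; exact: oO.
by apply/seteqP; split => z /= => [[? [i ? ?]]|[i ? [? ?]]];
  [exists i | split=> //; exists i].
Qed.

HB.instance Definition _ := @isOpenTopological.Build (cotangent A)
  cotangent_open cotangent_openT cotangent_openI cotangent_open_bigU.

Definition Ck_cotangent (k : nat) (H : cotangent A * R -> R) : Prop :=
  forall c, Ck_on k [set z : 'rV[R]_n * 'rV[R]_n * R^o | img c z.1.1]
    (fun z => H (cotangent_of_chart c z.1, z.2) : R^o).

Definition compactly_supported (P : cotangent A * R -> R) : Prop :=
  compact (closure [set z | P z != 0]).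

Definition differential (f : M -> R) (x : M) : 'rV[R]_n :=
  gradient (f \o cinv A x) (chart A x x).

Definition velocity (gamma : R -> M) (s : R) : 'rV[R]_n :=
  derive1 (chart A (gamma s) \o gamma) s.

(* [metric x] is the Gram matrix of the metric at [x] in the chart around
   [x]; the last field says that its Gram matrix in the coordinates of any
   chart [c] is a smooth function. *)
Record riemannian_metric := RiemannianMetric {
  metric : M -> 'M[R]_n ;
  metric_sym : forall x, (metric x)^T = metric x ;
  metric_posdef : forall x, posdef (metric x) ;
  metric_smooth : forall c i j k, Ck_on k (img c) (fun y : 'rV[R]_n =>
    let x := cinv A c y in
    let K := 'J (chart A x \o cinv A c) y in
    (K *m metric x *m K^T) i j : R^o)
}.

Definition conorm (g : riemannian_metric) (x : M) (p : 'rV[R]_n) : R :=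
  Num.sqrt ((p *m invmx (metric g x) *m p^T) 0 0).

Definition supnorm (f : M -> R) : R := sup [set `|f x| | x in [set: M]].

Definition viscosity_subsolution (H : cotangent A * R -> R) (u : M -> R) :=
  forall (f : M -> R) (x : M), Ck 1 f ->
    (\forall y \near x, u y - f y <= u x - f x) ->
    H (x, differential f x, u x) <= 0.

Definition viscosity_supersolution (H : cotangent A * R -> R) (u : M -> R) :=
  forall (f : M -> R) (x : M), Ck 1 f ->
    (\forall y \near x, u x - f x <= u y - f y) ->
    0 <= H (x, differential f x, u x).

Definition viscosity_solution (H : cotangent A * R -> R) (u : M -> R) : Prop :=
  [/\ continuous u, viscosity_subsolution H u & viscosity_supersolution H u].

Definition abs_continuous (a b : R) (f : R -> 'rV[R]_n) : Prop :=
  forall e : R, 0 < e -> exists2 d : R, 0 < d &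
    forall (m : nat) (s t : 'I_m -> R),
      (forall i, [/\ a <= s i, s i <= t i & t i <= b]) ->
      (forall i j, i != j -> t i <= s j \/ t j <= s i) ->
      \sum_i (t i - s i) < d -> \sum_i `|f (t i) - f (s i)| < e.

Definition ac_curve (a b : R) (gamma : R -> M) : Prop :=
  {within `[a, b], continuous gamma} /\
  forall (c : M) (a' b' : R), a <= a' -> b' <= b ->
    (forall s, a' <= s <= b' -> dom A c (gamma s)) ->
    abs_continuous a' b' (chart A c \o gamma).

Definition lagrangian (H : cotangent A * R -> R) (x : M) (v : 'rV[R]_n) (u : R)
    : \bar R :=
  ereal_sup [set (pairing v p - H (x, p, u))%:E | p in [set: 'rV[R]_n]].

Definition action (H : cotangent A * R -> R) (w : R -> M -> R) (phi : M -> R)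
    (t : R) (gamma : R -> M) : \bar R :=
  ((phi (gamma 0))%:E + \int[lebesgue_measure]_(s in `[0%R, t])
    lagrangian H (gamma s) (velocity gamma s) (w s (gamma s)))%E.

(* [w t x] plays the role of T_t^- phi(x); it is only constrained for t >= 0. *)
Definition is_backward_solution (H : cotangent A * R -> R) (phi : M -> R)
    (w : R -> M -> R) : Prop :=
  {within [set z : M * R | 0 <= z.2], continuous (fun z => w z.2 z.1)} /\
  forall (t : R) (x : M), 0 <= t ->
    (w t x)%:E = ereal_inf [set action H w phi t gamma |
      gamma in [set gamma | ac_curve 0 t gamma /\ gamma t = x]].

(* T_t^- phi is [Tminus H phi t]; the default value 0 of [xget] is used only
   when no backward solution exists. *)
Definition Tminus (H : cotangent A * R -> R) (phi : M -> R) : R -> M -> R :=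
  xget (fun _ _ => 0) [set w | is_backward_solution H phi w].

Definition lyapunov_stable (H : cotangent A * R -> R) (u : M -> R) : Prop :=
  forall eta : R, 0 < eta -> exists2 rho : R, 0 < rho &
    forall phi : M -> R, continuous phi -> supnorm (phi \- u) < rho ->
      forall t : R, 0 < t -> supnorm (Tminus H phi t \- u) < eta.

Definition lyapunov_asymptotically_stable (H : cotangent A * R -> R)
    (u : M -> R) : Prop :=
  lyapunov_stable H u /\
  exists2 rho : R, 0 < rho &
    forall phi : M -> R, continuous phi -> supnorm (phi \- u) < rho ->
      supnorm (Tminus H phi t \- u) @[t --> +oo] --> 0.

End Manifold.

(* Main.v *)
(** The solution semigroup itself provides strict sub- and supersolutions
   around [um].  Attractivity makes [um] a fixed point of the semigroup, and the
   solutions [wm], [wp] started at [um - rho], [um + rho] lie within [rho / 2]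
   of [um] at some time [T].  Put [E t = expR (2 * lambda * t)].  For small
   [k > 0], the maximum over [0 <= t <= T] of [wm t - k * E t] is never attained
   at [t = 0], so its test functions see the equation
   [d_t w + H (x, d_x w, w) = 0] with a strictly positive time derivative
   [2 * lambda * k * E t], of which the [lambda]-Lipschitz dependence of [H] on
   [u] eats only half: the maximum is a subsolution of [H <= - lambda * k], and
   it is below [um] by comparison.  Symmetrically the minimum of [wp t + k * E t]
   is a supersolution of [H >= lambda * k] above [um].  Both absorb a
   perturbation of size [lambda * k], and Perron's method gives a solution of
   the perturbed equation in between.

   The semigroup is the junk value [0] where no backward solution exists, so
   solutions have to be constructed for these initial data: [um] is Lipschitz
   because [H] is coercive, and the value function is then a contraction for the
   weight [E] on a class of functions that are Lipschitz in time.  The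
   sub- and supersolution properties are read off along straight segments and
   near-optimal curves respectively. *)

(* Three obstacles shape the proof. Action integrals are extended-real, and their integrand is junk
   where a curve has no velocity; arguments therefore run on [has_action], a certificate of finite
   action, and [action_dichotomy] disposes of all other curves. Minimizing curves are never
   constructed: near-optimal ones suffice for the inequalities collected in [sol], so no compactness
   of spaces of curves enters. Coordinates of covectors jump with the base point, so estimates are
   made in one fixed chart and spread by compactness of [M] or by real induction along a curve. The
   rate [2 * lambda] makes the constants close up: a discrepancy [D * weight s] in the [u] argument
   changes an action by at most [D / 2 * (weight b - weight a)]. This half is the contraction factor
   of the value map and drives the iteration behind [comparison]. Lipschitz regularity of the
   initial datum matters through domination: the datum increases along a curve by at most the action
   plus a multiple of the elapsed time. A near-optimal curve may then drop its first stretch, which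
   bounds the values in the backward time direction. *)
From HB Require Import structures.
Require Import Defs.
From mathcomp Require Import all_boot all_order all_algebra.
From mathcomp Require Import all_classical all_reals all_analysis.
From mathcomp Require Import measurable_realfun ring lra.
Import Order.TTheory GRing.Theory Num.Theory.
Import numFieldNormedType.Exports.
Set Implicit Arguments.
Unset Strict Implicit.
Unset Printing Implicit Defensive.
Local Open Scope classical_set_scope.
Local Open Scope ring_scope.

(** * Absolutely continuous functions *)

Section AbsoluteContinuity.
Context {R : realType}.
Implicit Types (f : R -> R) (l : seq (R * R)) (a b s t : R).

(** Ordered lists replace the indexed families of [abs_continuous]: they can be cut and concatenated
    by induction from the left, and fewer families have to be tested when absolute continuity is
    inherited from a curve. *)
Definition nonoverlapping a b l :=
  pairwise (fun p q : R * R => p.2 <= q.1) l &&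
  all (fun p => [&& a <= p.1, p.1 <= p.2 & p.2 <= b]) l.

Definition total_length l : R := \sum_(p <- l) (p.2 - p.1).

Definition total_change f l : R := \sum_(p <- l) `|f p.2 - f p.1|.

Definition ac_fun a b f := forall e : R, 0 < e -> exists2 d : R, 0 < d &
  forall l, nonoverlapping a b l -> total_length l < d -> total_change f l < e.

Lemma nonoverlapping_cons a b p l : nonoverlapping a b (p :: l) =
  [&& a <= p.1, p.1 <= p.2, p.2 <= b & nonoverlapping p.2 b l].
Proof.
rewrite /nonoverlapping/=; apply/idP/idP.
  move=> /andP[/andP[pl ->]] /andP[/and3P[-> p12 ->] al] /=.
  rewrite p12/=; apply/allP => q ql; move/allP : al => /(_ q ql) /and3P[_ -> ->].
  by rewrite !andbT; exact: (allP pl).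
move=> /and4P[ap p12 pb /andP[-> al]]; rewrite ap p12 pb /= andbT.
apply/andP; split; apply/allP => q ql; move/allP : al => /(_ q ql) /and3P[pq qq qb] //.
by rewrite qq qb !andbT (le_trans ap)// (le_trans p12).
Qed.

Lemma nonoverlapping_wid a b a' b' l : a' <= a -> b <= b' ->
  nonoverlapping a b l -> nonoverlapping a' b' l.
Proof.
move=> aa bb /andP[pl al]; rewrite /nonoverlapping pl/=.
apply/allP => q ql; move/allP : al => /(_ q ql) /and3P[aq -> qb].
by rewrite (le_trans aa aq) (le_trans qb bb).
Qed.

Lemma nonoverlapping_cat a b c l1 l2 : nonoverlapping a b l1 -> nonoverlapping b c l2 ->
  a <= b -> b <= c -> nonoverlapping a c (l1 ++ l2).
Proof.
elim: l1 a => [|p l IH] a /=.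
  by move=> _ h ab bc; exact: nonoverlapping_wid h.
rewrite !nonoverlapping_cons => /and4P[-> -> pb h1] h2 ab bc /=.
by rewrite (le_trans pb bc)/= IH.
Qed.

Lemma total_length_cat l1 l2 : total_length (l1 ++ l2) = total_length l1 + total_length l2.
Proof. exact: big_cat. Qed.

Lemma total_change_cat f l1 l2 : total_change f (l1 ++ l2) = total_change f l1 + total_change f l2.
Proof. exact: big_cat. Qed.

Lemma total_length_le a b l : a <= b -> nonoverlapping a b l -> total_length l <= b - a.
Proof.
elim: l a => [|p l IH] a ab; rewrite /total_length ?big_nil ?big_cons ?subr_ge0//.
rewrite nonoverlapping_cons => /and4P[ap p12 pb /(IH _ pb)]; rewrite /total_length => h.
by lra.
Qed.

(** An interval on the far side of [c] collapses to a point and contributes nothing, so a list is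
    cut at [c] without filtering it. *)
Definition clamp_left c l := [seq (Num.min p.1 c, Num.min p.2 c) | p <- l].
Definition clamp_right c l := [seq (Num.max p.1 c, Num.max p.2 c) | p <- l].

Lemma nonoverlapping_clamp_left a b c l : a <= c -> nonoverlapping a b l ->
  nonoverlapping a c (clamp_left c l).
Proof.
elim: l a => [//|p l IH] a ac.
rewrite /= !nonoverlapping_cons/= => /and4P[ap p12 pb h].
have mc : Num.min p.2 c <= c by rewrite ge_min lexx orbT.
apply/and4P; split => //; first by rewrite le_min ap ac.
  by rewrite le_min2.
by apply: IH => //; apply: nonoverlapping_wid h => //; rewrite ge_min lexx.
Qed.

Lemma nonoverlapping_clamp_right a b c l : c <= b -> nonoverlapping a b l ->
  nonoverlapping c b (clamp_right c l).
Proof.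
have H l' : forall a c b, c <= b -> c <= a -> nonoverlapping a b l' -> nonoverlapping c b (clamp_right c l').
  elim: l' => [//|p l' IH] a' c' b' cb ca; rewrite /= !nonoverlapping_cons/= => /and4P[ap p12 pb h].
  have c1 : c' <= p.1 by exact: le_trans ap.
  have c2 : c' <= p.2 by exact: le_trans p12.
  rewrite !max_l// c1 p12 pb/=.
  suff -> : clamp_right c' l' = clamp_right p.2 l' by apply: IH h.
  apply/eq_in_map => q ql; move: h => /andP[_ /allP/(_ _ ql)/and3P[pq q12 _]].
  have e1 := le_trans pq q12.
  by rewrite (max_l pq) (max_l e1) (max_l (le_trans c2 pq)) (max_l (le_trans c2 e1)).
elim: l a => [//|p l IH] a cb /= h; have := h; rewrite !nonoverlapping_cons/= => /and4P[ap p12 pb hl].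
have cm : c <= Num.max p.1 c by rewrite le_max lexx orbT.
apply/and4P; split => //; [by rewrite le_max2|by rewrite ge_max pb cb|].
have [pc|cp] := leP p.2 c; first exact: IH hl.
suff -> : clamp_right c l = clamp_right p.2 l by apply: H hl.
apply/eq_in_map => q ql; move: hl => /andP[_ /allP/(_ _ ql)/and3P[pq q12 _]].
have e1 := le_trans pq q12.
by rewrite (max_l pq) (max_l e1) (max_l (le_trans (ltW cp) pq)) (max_l (le_trans (ltW cp) e1)).
Qed.

Lemma total_change_clamp f c l :
  (forall p, p \in l -> p.1 <= p.2) ->
  total_change f l <= total_change f (clamp_left c l) + total_change f (clamp_right c l).
Proof.
move=> h; rewrite /total_change !big_map/= -big_split/= big_seq [leRHS]big_seq.
apply: ler_sum => p /h p12.
have [pc|cp] := leP p.2 c.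
  by rewrite !min_l ?(le_trans p12)// lerDl.
have [pc'|cp'] := leP p.1 c; last by rewrite subrr normr0 add0r.
by rewrite addrC (le_trans _ (ler_normD _ _))// addrA subrK.
Qed.

(** Finite variation: a stretch shorter than [d] contributes at most 1, and cutting off [d / 2] at a
    time reaches [a] after finitely many steps. *)
Lemma total_change_bound a b f d : a <= b -> 0 < d ->
  (forall l, nonoverlapping a b l -> total_length l < d -> total_change f l < 1) ->
  exists C, forall l, nonoverlapping a b l -> total_change f l <= C.
Proof.
move=> ab d0 hd.
have H n : forall b', a <= b' -> b' <= b -> b' - a <= n%:R * (d / 2) ->
    forall l, nonoverlapping a b' l -> total_change f l <= n.+1%:R.
  elim: n => [|n IH] b' ab' bb' h l hl.
    apply/ltW/hd; first exact: nonoverlapping_wid hl.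
    by rewrite (le_lt_trans (total_length_le ab' hl))// (le_lt_trans h)// mul0r.
  have [c [ac cb hc ca]] : exists c, [/\ a <= c, c <= b', b' - c < d & c - a <= n%:R * (d / 2)].
    have [h2|h2] := leP a (b' - d / 2).
      exists (b' - d / 2); split => //; [lra|lra|].
      by move: h; rewrite -natr1 mulrDl mul1r; lra.
    by exists a; split => //; [lra|rewrite subrr mulr_ge0// ltW// divr_gt0].
  have hle p : p \in l -> p.1 <= p.2.
    by move=> pl; case/andP : hl => _ /allP/(_ p pl)/and3P[].
  rewrite (le_trans (total_change_clamp f c hle))// -natr1 lerD//.
    apply: (IH c) => //; first exact: le_trans bb'.
    exact: nonoverlapping_clamp_left hl.
  apply/ltW/hd.
    by apply: nonoverlapping_wid (nonoverlapping_clamp_right cb hl).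
  rewrite (le_lt_trans _ hc)//; apply: total_length_le => //.
  exact: nonoverlapping_clamp_right hl.
exists (Num.trunc ((b - a) / (d / 2))).+2%:R; apply: H => //.
rewrite -ler_pdivrMr ?divr_gt0//; apply: ltW; exact: truncnS_gt.
Qed.

Definition changes a t f := [set total_change f l | l in [set l | nonoverlapping a t l]].

Definition variation_fun a f t := sup (changes a t f).

Section Variation.
Variables (a b : R) (f : R -> R).
Hypotheses (ab : a <= b) (acf : ac_fun a b f).

Let has_sup_changes s t : a <= s -> s <= t -> t <= b -> has_sup (changes s t f).
Proof.
move=> as_ st tb; split; first by exists 0, [::] => //; rewrite /total_change big_nil.
have [d d0 hd] := acf ltr01; have [C hC] := total_change_bound ab d0 hd.
by exists C => _ [l hl <-]; apply: hC; exact: nonoverlapping_wid hl.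
Qed.

Let changes_le s t l : a <= s -> s <= t -> t <= b -> nonoverlapping s t l ->
  total_change f l <= sup (changes s t f).
Proof. by move=> as_ st tb hl; apply: ub_le_sup; [case: (has_sup_changes as_ st tb)|exists l]. Qed.

Lemma variation_fun_ge s t : a <= s -> s <= t -> t <= b ->
  `|f t - f s| <= variation_fun a f t - variation_fun a f s.
Proof.
move=> as_ st tb; rewrite lerBrDl /variation_fun.
have hs := has_sup_changes (lexx a) as_ (le_trans st tb).
rewrite -lerBrDr; apply: ge_sup; first exact: hs.1.
move=> _ [l hl <-]; rewrite lerBrDr.
have -> : total_change f l + `|f t - f s| = total_change f (l ++ [:: (s, t)]).
  by rewrite total_change_cat /total_change big_seq1.
apply: changes_le => //; first exact: le_trans st.
apply: nonoverlapping_cat hl _ _ _ => //.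
by rewrite nonoverlapping_cons/= lexx st lexx.
Qed.

Let variation_sub s t : a <= s -> s <= t -> t <= b ->
  variation_fun a f t - variation_fun a f s <= sup (changes s t f).
Proof.
move=> as_ st tb; rewrite lerBlDl /variation_fun.
have ht := has_sup_changes (lexx a) (le_trans as_ st) tb.
apply: ge_sup; first exact: ht.1.
move=> _ [l hl <-].
have hle p : p \in l -> p.1 <= p.2 by move=> pl; case/andP : hl => _ /allP/(_ p pl)/and3P[].
rewrite (le_trans (total_change_clamp f s hle))// lerD//; apply: changes_le => //.
- exact: le_trans tb.
- exact: nonoverlapping_clamp_left hl.
- exact: nonoverlapping_clamp_right hl.
Qed.

(** Replace every interval of [l] by subintervals on which [f] nearly realizes its variation: the
    total length does not grow, so the modulus of [f] for [e / 2] serves for the variation. The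
    errors [eta] add up to at most another [e / 2]. *)
Lemma ac_variation_fun : ac_fun a b (variation_fun a f).
Proof.
move=> e e0; have [d d0 hd] := acf (divr_gt0 e0 (@ltr0n R 2)).
exists d => // l hl ld.
suff H : forall eta : R, 0 < eta -> forall l a', a <= a' -> nonoverlapping a' b l -> exists l',
    [/\ nonoverlapping a' b l', total_length l' <= total_length l &
    total_change (variation_fun a f) l <= total_change f l' + eta *+ size l].
  have e4 : 0 < e / 2 / (size l).+1%:R by rewrite !divr_gt0.
  have [l' [nl' tl' cl']] := H _ e4 _ _ (lexx a) hl.
  rewrite (le_lt_trans cl')//.
  have h1 := hd _ nl' (le_lt_trans tl' ld).
  have h2 : e / 2 / (size l).+1%:R *+ size l <= e / 2.
    rewrite -mulr_natr -mulrA ler_piMr//; first by lra.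
    by rewrite mulrC ler_pdivrMr// mul1r ler_nat.
  by rewrite [ltRHS](splitr e) ltr_leD.
move=> eta eta0; elim=> [|p l0 IH] a' aa'.
  by exists [::]; split => //; rewrite /total_change !big_nil addr0.
rewrite nonoverlapping_cons => /and4P[ap p12 pb hl0].
have ap1 : a <= p.1 by exact: le_trans ap.
have [l1 [nl1 tl1 cl1]] := IH p.2 (le_trans ap1 p12) hl0.
have [_ [l2 hl2 <-]] := sup_adherent eta0 (has_sup_changes ap1 p12 pb).
move=> h2; exists (l2 ++ l1); split.
- apply: nonoverlapping_cat nl1 _ pb; last exact: le_trans p12.
  exact: nonoverlapping_wid hl2.
- rewrite total_length_cat [leRHS]/total_length big_cons -/(total_length _) lerD//.
  exact: total_length_le hl2.
- rewrite total_change_cat [leLHS]/total_change big_cons -/(total_change _ _) /=.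
  rewrite mulrS addrACA; apply: lerD => //.
  have h3 := variation_sub ap1 p12 pb.
  have h4 := le_trans (normr_ge0 _) (variation_fun_ge ap1 p12 pb).
  by rewrite (ger0_norm h4) (le_trans h3)// -lerBlDr ltW.
Qed.

End Variation.

Lemma ac_funD a b f g : ac_fun a b f -> ac_fun a b g -> ac_fun a b (f \+ g).
Proof.
move=> hf hg e e0; have e2 : 0 < e / 2 by rewrite divr_gt0.
have [d1 d10 h1] := hf _ e2; have [d2 d20 h2] := hg _ e2.
exists (Num.min d1 d2); first by rewrite lt_min d10.
move=> l nl; rewrite lt_min => /andP[l1 l2].
rewrite (splitr e) (le_lt_trans _ (ltrD (h1 _ nl l1) (h2 _ nl l2)))//.
rewrite /total_change -big_split/=; apply: ler_sum => p _.
by rewrite opprD addrACA ler_normD.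
Qed.

Lemma ac_funN a b f : ac_fun a b f -> ac_fun a b (\- f).
Proof.
move=> hf e e0; have [d d0 h] := hf _ e0; exists d => // l nl ld.
rewrite (le_lt_trans _ (h _ nl ld))//; apply: ler_sum => p _.
by rewrite -opprD normrN.
Qed.

Lemma ac_fun_continuous a b f : a <= b -> ac_fun a b f ->
  continuous (fun x => f (Num.max a (Num.min x b))).
Proof.
move=> ab acf x; apply/cvgrPdist_lt => e e0.
have [d d0 hd] := acf _ e0.
near=> y.
pose c z := Num.max a (Num.min z b).
have ac z : a <= c z by rewrite /c le_max lexx.
have cb z : c z <= b by rewrite /c ge_max ab ge_min lexx orbT.
have H u v : u <= v -> v - u < d -> `|f (c v) - f (c u)| < e.
  move=> uv uvd; have cuv : c u <= c v by rewrite /c le_max2// le_min2.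
  have := hd [:: (c u, c v)]; rewrite /total_length /total_change !big_seq1/=; apply.
    by rewrite nonoverlapping_cons/= ac cuv cb.
  rewrite (le_lt_trans _ uvd)// /c.
  by rewrite /Num.max /Num.min; do ![case: ifPn]; rewrite -?leNgt; lra.
rewrite -/(c x) -/(c y).
have xy : `|x - y| < d by near: y; exact: cvgr_dist_lt.
have [h|h] := leP y x; first by apply: H => //; rewrite (le_lt_trans (ler_norm _) xy).
by rewrite distrC; apply: H; rewrite ?(ltW h)// (le_lt_trans (ler_norm _))// distrC.
Unshelve. all: by end_near. Qed.

(** * Nondecreasing absolutely continuous functions as integrals of a density *)

Section Density.
Variables (a b : R) (F : R -> R).
Hypotheses (ab : a < b) (acF : ac_fun a b F)
  (ndF : {in `[a, b] &, nondecreasing_fun F}).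

Let mu : {measure set (measurableTypeR R) -> \bar R} := @lebesgue_measure R.
(** The Stieltjes measure requires a monotone right-continuous function on the whole line, hence the
    constant continuation on both sides. *)
Let G x := F (Num.max a (Num.min x b)).

Let G_nd : nondecreasing G.
Proof.
move=> x y xy; apply: ndF; rewrite ?in_itv/=.
- by rewrite le_max lexx/= ge_max (ltW ab) ge_min lexx orbT.
- by rewrite le_max lexx/= ge_max (ltW ab) ge_min lexx orbT.
- by rewrite le_max2// le_min2.
Qed.

Let G_rc : right_continuous G.
Proof. by apply: right_continuousW; exact: ac_fun_continuous (ltW ab) acF. Qed.

Let Gc : cumulative R R := HB.pack G (isCumulative.Build R _ R G G_nd G_rc).

Let nu : {measure set (measurableTypeR R) -> \bar R} := lebesgue_stieltjes_measure Gc.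

Let GE x : a <= x -> x <= b -> G x = F x.
Proof. by move=> ax xb; rewrite /G (min_l xb) (max_r ax). Qed.

Let nu_itv s t : a <= s -> s <= t -> t <= b -> nu `]s, t]%classic = (F t - F s)%:E.
Proof.
move=> as_ st tb; rewrite /nu /= /lebesgue_stieltjes_measure /measure_extension.
rewrite measurable_mu_extE/=; last exact: is_ocitv.
by rewrite wlength_itv_bnd//= !GE ?EFinB// (le_trans st, le_trans as_).
Qed.

Definition itvs_union (l : seq (R * R)) := \big[setU/set0]_(p <- l) `]p.1, p.2]%classic.

Lemma measurable_itvs_union l : measurable (itvs_union l).
Proof. by apply: bigsetU_measurable => p _; exact: measurable_itv. Qed.

Lemma itvs_union_cons p l : itvs_union (p :: l) = `]p.1, p.2]%classic `|` itvs_union l.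
Proof. by rewrite /itvs_union big_cons. Qed.

Lemma itvs_union_mem l x : itvs_union l x <-> exists2 p, p \in l & p.1 < x <= p.2.
Proof.
rewrite /itvs_union; elim: l => [|p l IH].
  by rewrite big_nil; split => // -[].
rewrite big_cons; split.
  move=> [|/IH[q ql qx]]; first by rewrite /= in_itv/= => h; exists p; rewrite ?mem_head.
  by exists q => //; rewrite inE ql orbT.
move=> [q]; rewrite inE => /orP[/eqP->|ql] h; first by left; rewrite /= in_itv.
by right; apply/IH; exists q.
Qed.

Let nu_itvs l : nonoverlapping a b l -> (nu (itvs_union l) <= (total_change F l)%:E)%E.
Proof.
suff H a' : a <= a' -> nonoverlapping a' b l -> (nu (itvs_union l) <= (total_change F l)%:E)%E.
  exact: H.
elim: l a' => [|p l IH] a' aa'.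
  by rewrite /itvs_union /total_change !big_nil measure0.
rewrite nonoverlapping_cons => /and4P[ap p12 pb /IH h].
have ap1 := le_trans aa' ap.
rewrite itvs_union_cons (le_trans (measureU2 _ _ _))//=.
  exact: measurable_itvs_union.
rewrite /total_change big_cons EFinD leeD//; last exact: h (le_trans ap1 p12).
by rewrite nu_itv// lee_fin ler_norm.
Qed.

Let mu_itvs l : nonoverlapping a b l -> mu (itvs_union l) = (total_length l)%:E.
Proof.
elim: l {1}a => [|p l IH] a'; first by rewrite /itvs_union /total_length !big_nil measure0.
rewrite nonoverlapping_cons => /and4P[ap p12 pb hl].
rewrite itvs_union_cons measureU//=.
- rewrite /total_length big_cons EFinD -/(total_length l) -(IH _ hl); congr (_ + _)%E.
  rewrite /mu lebesgue_measure_itv/= lte_fin EFinB; case: ltP => // p21.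
  by rewrite -EFinB (@le_anti _ _ p.1 p.2) ?p12// subrr.
- exact: measurable_itvs_union.
- rewrite -subset0 => x []/=; rewrite in_itv/= => /andP[_ xp] /itvs_union_mem[q ql /andP[qx _]].
  move: hl => /andP[_ /allP/(_ q ql)/and3P[pq _ _]].
  by move: (lt_le_trans qx xp); rewrite ltNge pq.
Qed.

Let grid n : seq (R * R) :=
  [seq (a + (b - a) * (i%:R / n.+1%:R), a + (b - a) * (i.+1%:R / n.+1%:R)) | i <- iota 0 n.+1].

Let nonoverlapping_grid n : nonoverlapping a b (grid n).
Proof.
rewrite /nonoverlapping /grid; apply/andP; split.
  rewrite pairwise_map; have: pairwise ltn (iota 0 n.+1).
    by rewrite -sorted_pairwise ?iota_ltn_sorted//; exact: ltn_trans.
  apply: sub_pairwise => i j /= ij.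
  by rewrite lerD2l ler_pM2l ?subr_gt0// ler_pM2r// ler_nat.
apply/allP => _ /mapP[i + ->] /=; rewrite mem_iota add0n /= => iN.
have h k : (k <= n.+1)%N -> a <= a + (b - a) * (k%:R / n.+1%:R) <= b.
  move=> kn; rewrite lerDl mulr_ge0 ?subr_ge0 ?(ltW ab)//=.
  rewrite -lerBrDl ler_piMr ?subr_ge0 ?(ltW ab)// ler_pdivrMr// mul1r ler_nat //.
have /andP[-> _] := h i (ltnW iN); have /andP[_ ->] := h i.+1 iN.
by rewrite andbT/= lerD2l ler_pM2l ?subr_gt0// ler_pM2r// ler_nat.
Qed.

Let sub_nonoverlapping s t (P : pred (R * R)) l :
  nonoverlapping s t l -> nonoverlapping s t [seq p <- l | P p].
Proof.
move=> /andP[pl al]; rewrite /nonoverlapping pairwise_filter//=.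
by apply/allP => p; rewrite mem_filter => /andP[_ /(allP al)].
Qed.

(** Approximation of an open set from inside by finitely many cells, so that absolute continuity of
    [F] applies to it. *)
Let inner (U : set R) n := itvs_union [seq p <- grid n | `[< `]p.1, p.2]%classic `<=` U >]].

Let inner_sub U n : inner U n `<=` U.
Proof.
move=> x /itvs_union_mem[p]; rewrite mem_filter => /andP[/asboolP pU _] h.
by apply: pU; rewrite /= in_itv.
Qed.

Let inner_cover (U : set R) : open U -> forall x, U x -> a < x <= b ->
  \forall n \near \oo, inner U n x.
Proof.
move=> oU x Ux /andP[ax xb].
have [r r0 hr] : exists2 r : R, 0 < r & ball x r `<=` U.
  by have /nbhs_ballP[r r0 hr] := open_nbhs_nbhs (conj oU Ux); exists r.
have ba0 : 0 < b - a by rewrite subr_gt0.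
have rba : 0 < r / (b - a) by rewrite divr_gt0.
near=> n.
pose z := (x - a) / (b - a) * n.+1%:R.
have z0 : 0 < z by rewrite mulr_gt0// divr_gt0// subr_gt0.
(* Cells are open on the left and closed on the right, so [i] is the ceiling of [z] minus one;
   truncation gives it except when [z] is an integer. *)
have [i zi iz] : exists2 i : nat, i%:R < z & z <= i.+1%:R.
  have h := Num.Theory.truncn_itv (ltW z0).
  have [e|ne] := eqVneq (Num.trunc z)%:R z.
    move: e; case: (Num.trunc z) => [e|k e]; first by move: z0; rewrite -e ltxx.
    by exists k; rewrite -e ?ltr_nat.
  move: h => /andP[h1 h2]; exists (Num.trunc z); last exact: ltW.
  by rewrite lt_neqAle ne.
have xE : x = a + (b - a) * (z / n.+1%:R).
  by rewrite /z mulfK ?pnatr_eq0// mulrC divfK ?gt_eqF// addrC subrK.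
have iN : (i < n.+1)%N.
  rewrite -(ltr_nat R) (lt_le_trans zi)// /z ler_piMl//.
  by rewrite ler_pdivrMr// mul1r lerB.
have lx : a + (b - a) * (i%:R / n.+1%:R) < x.
  by rewrite [ltRHS]xE ltrD2l ltr_pM2l// ltr_pM2r.
have xu : x <= a + (b - a) * (i.+1%:R / n.+1%:R).
  by rewrite [leLHS]xE lerD2l ler_pM2l// ler_pM2r.
apply/itvs_union_mem; exists (a + (b - a) * (i%:R / n.+1%:R), a + (b - a) * (i.+1%:R / n.+1%:R)).
  rewrite mem_filter; apply/andP; split; last by apply/mapP; exists i => //; rewrite mem_iota.
  apply/asboolP => y /=; rewrite in_itv/= => /andP[ly yu]; apply: hr; rewrite /ball/=.
  have hn : (b - a) * (i.+1%:R / n.+1%:R) - (b - a) * (i%:R / n.+1%:R) < r.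
    rewrite -mulrBr -mulrBl -natr1 addrAC subrr add0r mul1r.
    rewrite mulrC -ltr_pdivlMr//.
    by near: n; apply: near_infty_natSinv_lt (PosNum rba).
  move: lx xu ly yu hn; set P := (b - a) * _; set Q := (b - a) * _; clearbody P Q.
  by rewrite ltr_distlC => *; apply/andP; split; lra.
by rewrite /= lx.
Unshelve. all: by end_near. Qed.

(** Grids of different steps are not nested, so [inner U n] need not increase with [n]. The
    intersections [A n] of its tails do, they exhaust [U] within []a, b]], and continuity of measure
    from below passes the bound on. *)
Let nu_small (e : R) : 0 < e -> exists2 d : R, 0 < d & forall U : set R, open U -> (mu U < d%:E)%E ->
  (nu (U `&` `]a, b]%classic) <= e%:E)%E.
Proof.
move=> e0; have [d d0 hd] := acF e0; exists d => // U oU Ud.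
have nuin n : (nu (inner U n) <= e%:E)%E.
  have h := sub_nonoverlapping (fun p => `[< `]p.1, p.2]%classic `<=` U >]) (nonoverlapping_grid n).
  apply: le_trans (nu_itvs h) _; rewrite lee_fin; apply/ltW/hd => //.
  rewrite -lte_fin -(mu_itvs h); apply: le_lt_trans Ud.
  rewrite le_measure ?inE//; [exact: measurable_itvs_union|exact: open_measurable|exact: inner_sub].
pose A n : set (measurableTypeR R) := \bigcap_(m in [set m | (n <= m)%N]) inner U m.
have mA n : measurable (A n : set (measurableTypeR R)).
  by apply: bigcap_measurable; [exists n => /=|move=> m _; exact: measurable_itvs_union].
apply: (@le_trans _ _ (nu (\bigcup_n A n))).
  rewrite le_measure ?inE//.
  - by apply: measurableI; [exact: open_measurable|exact: measurable_itv].
  - exact: bigcup_measurable.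
  - move=> x [Ux]; rewrite /= in_itv/= => xab.
    have [N _ hN] := inner_cover oU Ux xab.
    by exists N => // m /= Nm; exact: hN.
have /cvg_lim <- // : (nu \o A) n @[n --> \oo] --> nu (\bigcup_n A n).
  apply: nondecreasing_cvg_mu => //; first exact: bigcup_measurable.
  move=> n m nm; apply/subsetPset => x hx k /= mk; apply: hx => /=; exact: leq_trans mk.
apply: lime_le; last first.
  apply: nearW => n; apply: le_trans (nuin n).
  by rewrite /= le_measure ?inE//; [exact: measurable_itvs_union|move=> x; apply => /=].
apply: ereal_nondecreasing_is_cvgn => n m nm; rewrite /= le_measure ?inE//.
by move=> x hx k /= mk; apply: hx => /=; exact: leq_trans mk.
Qed.

Let I : set (measurableTypeR R) := `]a, b]%classic.
Let mI : measurable I. Proof. exact: measurable_itv. Qed.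
Let nuI : (nu I < +oo)%E. Proof. by rewrite nu_itv ?ltry// ltW. Qed.
Let nur : {finite_measure set (measurableTypeR R) -> \bar R} := mfrestr mI nuI.

(** Outer regularity encloses a null set in open sets of small Lebesgue measure, where [nu_small]
    applies. This is the hypothesis of the Radon-Nikodym theorem, which yields the density. *)
Let nu_dom : nur `<< mu.
Proof.
move=> N N0 A mA AN; have muA : mu A = 0%E by exact: N0.
rewrite /nur /= /mfrestr /mrestr; apply/eqP; rewrite eq_le measure_ge0 andbT.
apply/lee_addgt0Pr => e e0; rewrite add0e.
have [d d0 hd] := nu_small e0.
have [|U [oU AU Ud]] := lebesgue_regularity_outer mA _ d0; first by rewrite [X in (X < _)%E]muA.
apply: le_trans (hd U oU _).
  by rewrite le_measure ?inE//; [exact: measurableI|apply: measurableI => //; exact: open_measurable|exact: setSI].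
have mUA : measurable (U `\` A : set (measurableTypeR R)).
  by apply: measurableD => //; exact: open_measurable.
apply: (@le_lt_trans _ _ (mu (U `\` A) + mu A)%E); last by rewrite muA adde0.
by rewrite -{1}(setDKU AU) measureU2.
Qed.

Lemma nondecreasing_ac_density : exists2 Y : R -> R,
  lebesgue_measure.-integrable setT (EFin \o Y) &
  forall x, a <= x <= b -> F x = F a + \int[lebesgue_measure]_(t in `]a, x]) Y t.
Proof.
have [f [f0 ffin fint fE]] := radon_nikodym_sigma_finite nu_dom.
exists (fine \o f).
  rewrite (_ : EFin \o _ = f)//; apply/funext => x /=; rewrite fineK//.
move=> x /andP[ax xb]; rewrite /Rintegral.
have -> : (\int[mu]_(t in `]a, x]) ((fine \o f) t)%:E = nur `]a, x]%classic)%E.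
  rewrite fE; last exact: measurable_itv.
  by apply: eq_integral => y _; rewrite /= fineK.
rewrite /nur /= /mfrestr /mrestr/= setIidl.
  by rewrite nu_itv//= addrC subrK.
by apply: subset_itv; rewrite bnd_simp.
Qed.

End Density.

(** With [V] the variation of [h], both [V] and [V - h] are nondecreasing and absolutely continuous,
    so [h] is a difference of two integrals; Lebesgue differentiation then gives the derivative
    almost everywhere. *)
Lemma ac_fun_FTC a b h : a < b -> ac_fun a b h -> exists Y : R -> R,
  [/\ lebesgue_measure.-integrable setT (EFin \o Y),
    (forall x, a <= x <= b -> h x = h a + \int[lebesgue_measure]_(t in `]a, x]) Y t) &
    {ae lebesgue_measure, forall x, a < x < b -> is_derive x 1 h (Y x)}].
Proof.
move=> ab ach; have leab := ltW ab.
pose V := variation_fun a h.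
have acV : ac_fun a b V := ac_variation_fun leab ach.
have Vge := variation_fun_ge leab ach.
have ndV : {in `[a, b] &, nondecreasing_fun V}.
  move=> x y; rewrite !in_itv/= => /andP[ax xb] /andP[ay yb] xy.
  by rewrite -subr_ge0; apply: le_trans (Vge _ _ ax xy yb).
have ndW : {in `[a, b] &, nondecreasing_fun (V \+ \- h)}.
  move=> x y; rewrite !in_itv/= => /andP[ax xb] /andP[ay yb] xy.
  have := le_trans (ler_norm _) (Vge _ _ ax xy yb); rewrite -/V; lra.
have [Y1 iY1 Y1E] := nondecreasing_ac_density ab acV ndV.
have [Y2 iY2 Y2E] := nondecreasing_ac_density ab (ac_funD acV (ac_funN ach)) ndW.
pose Y := Y1 \- Y2.
have iY : lebesgue_measure.-integrable setT (EFin \o Y).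
  rewrite (_ : EFin \o Y = (EFin \o Y1) \- (EFin \o Y2))%E; last first.
    by apply/funext => x /=; rewrite EFinB.
  exact: integrableB.
have hE x : a <= x <= b -> h x = h a + \int[lebesgue_measure]_(t in `]a, x]) Y t.
  move=> axb; have -> : \int[lebesgue_measure]_(t in `]a, x]) Y t =
    \int[lebesgue_measure]_(t in `]a, x]) Y1 t - \int[lebesgue_measure]_(t in `]a, x]) Y2 t.
    apply: RintegralB => //; [exact: integrableS iY1|exact: integrableS iY2].
  have := Y1E _ axb; have := Y2E _ axb; rewrite /=; lra.
exists Y; split => //.
have locY : locally_integrable [set: R] Y.
  split; [|exact: openT|].
    by case/integrableP : iY => /measurable_EFinP.
  move=> K _ cK; have /integrableP[_ //] : lebesgue_measure.-integrable K (EFin \o Y).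
  by apply: integrableS iY => //; exact: compact_measurable.
have iYa y : lebesgue_measure.-integrable [set` Interval (BRight a) (BRight y)] (EFin \o Y).
  by apply: integrableS iY => //; exact: measurable_itv.
have := FTC1 iYa locY.
apply: filterS; first exact: (ae_filter_ringOfSetsType (@lebesgue_measure R)).
move=> x /= hx /andP[ax xb].
have [|dx dY] := hx _; first by rewrite lte_fin.
pose Fi y := h a + \int[lebesgue_measure]_(t in `]a, y]) Y t.
have dFi : is_derive x 1 Fi (Y x).
  have := @is_deriveD _ _ _ (cst (h a)) _ x 1 0 (Y x) (is_derive_cst _ _ _) (DeriveDef dx (etrans (esym (derive1E _ _)) dY)).
  by rewrite add0r.
apply: near_eq_is_derive dFi => //.
near=> y; rewrite hE//; apply/andP; split; apply: ltW; near: y.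
  exact: lt_nbhsr.
exact: lt_nbhsl.
Unshelve. all: by end_near. Qed.

End AbsoluteContinuity.

Lemma abs_continuous_ac_fun (R : realType) (n : nat) (a b K : R) (f : R -> 'rV[R]_n) (g : R -> R) :
  abs_continuous a b f -> (forall s t, a <= s <= b -> a <= t <= b -> `|g t - g s| <= K * `|f t - f s|) ->
  ac_fun a b g.
Proof.
move=> acf hg e e0.
have K1 : 0 < `|K| + 1 by rewrite ltr_wpDl.
have [d d0 hd] := acf _ (divr_gt0 e0 K1).
exists d => // l nl ld.
pose p i := nth (0, 0) l i.
have [pl /allP al] := andP nl.
have hp (i : 'I_(size l)) : [/\ a <= (p i).1, (p i).1 <= (p i).2 & (p i).2 <= b].
  by have /al/and3P[] := mem_nth (0, 0) (ltn_ord i).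
have := hd (size l) (fun i => (p i).1) (fun i => (p i).2) hp.
have -> : \sum_(i < size l) ((p i).2 - (p i).1) = total_length l.
  by rewrite /total_length (big_nth (0, 0)) big_mkord.
move=> /(_ _ ld) h.
apply: (@le_lt_trans _ _ ((`|K| + 1) * \sum_(i < size l) `|f (p i).2 - f (p i).1|)).
  rewrite mulr_sumr /total_change (big_nth (0, 0)) big_mkord; apply: ler_sum => i _.
  have [h1 h2 h3] := hp i.
  rewrite (le_trans (hg _ _ _ _))// ?h1 ?(le_trans h2)// ?(le_trans h1)//.
  by rewrite ler_wpM2r// (le_trans (ler_norm _))// lerDl.
rewrite mulrC -ltr_pdivlMr//; apply: h => i j ij.
have H (i' j' : 'I_(size l)) : (i' < j')%N -> (p i').2 <= (p j').1.
  by move=> lij; move/pairwiseP : pl => /(_ (0, 0)); apply; rewrite ?inE ?ltn_ord.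
by case: (ltngtP i j) => [/H|/H|/val_inj eij]; [left|right|rewrite eij eqxx in ij].
Qed.

Lemma lipschitz_abs_continuous (R : realType) (n : nat) (a b K : R) (f : R -> 'rV[R]_n) :
  (forall s t, a <= s -> s <= t -> t <= b -> `|f t - f s| <= K * (t - s)) ->
  abs_continuous a b f.
Proof.
move=> hf e e0; have K1 : 0 < `|K| + 1 by rewrite ltr_wpDl.
exists (e / (`|K| + 1)); first by rewrite divr_gt0.
move=> m s t hst _; rewrite ltr_pdivlMr// => h; apply: le_lt_trans h.
rewrite mulr_suml; apply: ler_sum => i _; have [h1 h2 h3] := hst i.
rewrite (le_trans (hf _ _ h1 h2 h3))// mulrC ler_wpM2l ?subr_ge0//.
by rewrite (le_trans (ler_norm _))// lerDl.
Qed.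

(** * Integrals of almost everywhere defined functions *)

Section NonMeasurable.
Import HBNNSimple.
Context d (T : measurableType d) (R : realType) (mu : {measure set T -> \bar R}).
Local Open Scope ereal_scope.

Let nnint (g : T -> \bar R) := ereal_sup [set sintegral mu h |
  h in [set h : {nnsfun T >-> R} | forall x, (h x)%:E <= g x]].

(** Setting a simple function to zero on the null set [N] keeps its integral and removes the only
    points where it could exceed [g2]. *)
Let nnint_le (g1 g2 : T -> \bar R) (N : set T) : measurable N -> mu N = 0 ->
  (forall x, 0 <= g2 x) -> (forall x, ~ N x -> g1 x <= g2 x) -> nnint g1 <= nnint g2.
Proof.
move=> mN N0 g20 h; apply: ge_ereal_sup => _ [k kg <-].
pose k' := proj_nnsfun k (measurableC mN).
apply: ereal_sup_ubound; exists k' => [x|].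
  rewrite /k' -mrestrict patchE; case: ifPn => [|_]; last exact: g20.
  by rewrite inE => Nx; exact: le_trans (kg x) (h x Nx).
rewrite -!integralT_nnsfun; apply: ae_eq_integral => //.
- by apply/measurable_EFinP; exact: measurable_funPT.
- by apply/measurable_EFinP; exact: measurable_funPT.
- exists N; split => // x /= /not_implyP[_ hx]; apply: contrapT => Nx; apply: hx.
  by rewrite /k' /= /mindic indicE mem_set// mulr1.
Qed.

(* Neither function need be measurable: the integral is then a lower integral. *)
Lemma ae_eq_integral_nonmeasurable (D : set T) (f g : T -> \bar R) :
  {ae mu, forall x, D x -> f x = g x} -> \int[mu]_(x in D) f x = \int[mu]_(x in D) g x.
Proof.
move=> [N [mN N0 hN]].
have fg x : ~ N x -> (f \_ D) x = (g \_ D) x.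
  move=> Nx; rewrite !patchE; case: ifPn => // /set_mem Dx.
  by apply: contrapT => fgx; apply: Nx; apply: hN => /= /(_ Dx).
rewrite /integral; congr (_ - _); apply/eqP; rewrite eq_le; apply/andP; split;
  apply: (nnint_le mN N0) => x => [|Nx]; rewrite ?funepos_ge0 ?funeneg_ge0//;
  by rewrite ?funeposE ?funenegE fg.
Qed.

End NonMeasurable.

Section IntervalIntegral.
Context {R : realType}.
Local Notation mu := (@lebesgue_measure R).
Implicit Types (l : R -> \bar R) (f k K : R -> R) (a b c A : R).

(** [l] may be infinite, or junk where a curve is not differentiable, and need not be measurable. An
    integrable real representative certifies a finite value; sums and comparisons are then made on
    representatives. *)
Definition has_integral l a b A := exists f, [/\ mu.-integrable setT (EFin \o f),
  {ae mu, forall s, a < s < b -> l s = (f s)%:E} & A = \int[mu]_(s in `]a, b]) f s].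

Let aeF := ae_filter_ringOfSetsType (@lebesgue_measure R).

Lemma ae_imp (P Q : R -> Prop) : {ae mu, forall s, P s} -> (forall s, P s -> Q s) ->
  {ae mu, forall s, Q s}.
Proof. by move=> hP h; exact: (@filterS _ _ aeF _ _ h hP). Qed.

Lemma ae_imp2 (P Q S : R -> Prop) : {ae mu, forall s, P s} -> {ae mu, forall s, Q s} ->
  (forall s, P s -> Q s -> S s) -> {ae mu, forall s, S s}.
Proof. by move=> hP hQ h; exact: (@filterS2 _ _ aeF _ _ _ h hP hQ). Qed.

Let ae_neq a : {ae mu, forall s, s <> a}.
Proof.
exists [set a]; split => //; first exact: lebesgue_measure_set1.
by move=> x /= /contrapT.
Qed.

Lemma integrable_itv_restrict (f : R -> R) (i : interval R) :
  mu.-integrable [set` i] (EFin \o f) -> mu.-integrable setT ((EFin \o f) \_ [set` i]).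
Proof. by move=> fi; apply: (iffLR (integrable_mkcond _ _)) => //; exact: measurable_itv. Qed.

Lemma has_integralE l a b A : a <= b -> has_integral l a b A -> (\int[mu]_(s in `[a, b]) l s = A%:E)%E.
Proof.
move=> ab [f [fi fl ->]].
have fin D : measurable D -> mu.-integrable D (EFin \o f).
  by move=> mD; exact: integrableS fi.
rewrite Rintegral_itv_obnd_cbnd; last by apply: fin; exact: measurable_itv.
rewrite /Rintegral fineK; last first.
  by apply: integrable_fin_num; [exact: measurable_itv|apply: fin; exact: measurable_itv].
apply: ae_eq_integral_nonmeasurable.
have h2 := ae_imp2 (ae_neq a) (ae_neq b) (fun s => @conj _ _).
apply: (ae_imp2 h2 fl) => s [/eqP sa /eqP sb] h; rewrite /= in_itv/= => /andP[as_ sb'].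
by apply: h; rewrite !lt_neqAle as_ sb' eq_sym sa sb.
Qed.

Lemma Rintegral_itv_cat f a b c : a <= b -> b <= c -> mu.-integrable setT (EFin \o f) ->
  \int[mu]_(s in `]a, c]) f s = \int[mu]_(s in `]a, b]) f s + \int[mu]_(s in `]b, c]) f s.
Proof.
move=> ab bc fi.
have e : `]a, c]%classic = `]a, b]%classic `|` `]b, c]%classic.
  by rewrite -itv_bndbnd_setU ?bnd_simp.
rewrite e Rintegral_setU//.
- by rewrite -e; apply: integrableS fi => //; exact: measurable_itv.
- apply/disj_setPS => x [] /=; rewrite !in_itv/= => /andP[_ xb] /andP[bx _].
  by move: (lt_le_trans bx xb); rewrite ltxx.
Qed.

Lemma has_integral_split l a b c A : a <= b -> b <= c -> has_integral l a c A ->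
  exists A1 A2, [/\ has_integral l a b A1, has_integral l b c A2 & A = A1 + A2].
Proof.
move=> ab bc [f [fi fl ->]].
exists (\int[mu]_(s in `]a, b]) f s), (\int[mu]_(s in `]b, c]) f s); split.
- exists f; split => //; apply: (ae_imp fl) => s h /andP[s1 s2].
  by apply: h; rewrite s1 (lt_le_trans s2).
- exists f; split => //; apply: (ae_imp fl) => s h /andP[s1 s2].
  by apply: h; rewrite s2 (le_lt_trans ab).
- exact: Rintegral_itv_cat.
Qed.

Lemma has_integral_cat l a b c A1 A2 : a <= b -> b <= c ->
  has_integral l a b A1 -> has_integral l b c A2 -> has_integral l a c (A1 + A2).
Proof.
move=> ab bc [f1 [i1 l1 ->]] [f2 [i2 l2 ->]].
pose f s := if s <= b then f1 s else f2 s.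
have fE : f = (f1 \_ `]-oo, b]) \+ (f2 \_ `]b, +oo[).
  apply/funext => s; rewrite /f /= !patchE; case: leP => sb.
    rewrite mem_set ?memNset ?addr0//=; rewrite in_itv/= ?andbT//.
    by rewrite ltNge sb.
  rewrite memNset ?mem_set ?add0r//=; rewrite in_itv/= ?andbT//.
  by rewrite leNgt sb.
have fi : mu.-integrable setT (EFin \o f).
  have -> : EFin \o f = ((EFin \o f1) \_ `]-oo, b] \+ (EFin \o f2) \_ `]b, +oo[)%E.
    by apply/funext => s; rewrite fE /= EFinD !patchE; do 2![case: ifP].
  by apply: integrableD => //; apply: integrable_itv_restrict;
    [apply: integrableS i1|apply: integrableS i2] => //; exact: measurable_itv.
exists f; split => //.
  have l12 := ae_imp2 l1 l2 (fun s => @conj _ _).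
  apply: (ae_imp2 (ae_neq b) l12) => s /eqP sb [h1 h2] /andP[s1 s2]; rewrite /f.
  case: leP => sb'; first by apply: h1; rewrite s1 lt_neqAle sb sb'.
  by apply: h2; rewrite sb' s2.
rewrite (Rintegral_itv_cat ab bc fi); congr (_ + _).
  by apply: eq_Rintegral => s; rewrite inE/= in_itv/= /f => /andP[_ ->].
by apply: eq_Rintegral => s; rewrite inE/= in_itv/= /f => /andP[+ _]; case: leP.
Qed.

Lemma ae_le_Rintegral (f g : R -> R) a b : mu.-integrable setT (EFin \o f) ->
  mu.-integrable setT (EFin \o g) -> {ae mu, forall s, a < s < b -> f s <= g s} ->
  \int[mu]_(s in `]a, b]) f s <= \int[mu]_(s in `]a, b]) g s.
Proof.
move=> fi gi fg.
have [N [mN N0 hN]] : {ae mu, forall s, s <> b /\ (a < s < b -> f s <= g s)}.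
  exact: (ae_imp2 (ae_neq b) fg).
have sub (h : R -> R) : mu.-integrable setT (EFin \o h) ->
    \int[mu]_(s in `]a, b]) h s = \int[mu]_(s in `]a, b] `\` N) h s.
  move=> hi; rewrite /Rintegral; congr fine; apply: negligible_integral => //.
  by apply: integrableS hi => //; exact: measurable_itv.
rewrite (sub _ fi) (sub _ gi); apply: le_Rintegral.
- by apply: measurableD => //; exact: measurable_itv.
- by apply: integrableS fi => //; apply: measurableD => //; exact: measurable_itv.
- by apply: integrableS gi => //; apply: measurableD => //; exact: measurable_itv.
- move=> s /= [+ Ns]; rewrite in_itv/= => /andP[s1 s2].
  have [sb h] : s <> b /\ (a < s < b -> f s <= g s).
    by apply: contrapT => nh; apply: Ns; exact: hN.
  by apply: h; rewrite s1 lt_neqAle s2 andbT; exact/eqP.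
Qed.

Let integrable_restr f a b : a <= b -> (forall s, {for s, continuous f}) ->
  mu.-integrable setT (EFin \o (f \_ `[a, b])).
Proof.
move=> ab cf.
have -> : EFin \o (f \_ `[a, b]) = (EFin \o f) \_ `[a, b].
  by apply/funext => s /=; rewrite !patchE; case: ifP.
apply: integrable_itv_restrict.
apply: continuous_compact_integrable; first exact: segment_compact.
by apply: continuous_subspaceT => s; exact: cf.
Qed.

Lemma Rintegral_derive K k a b : a <= b -> (forall s : R, is_derive s 1 K (k s)) -> continuous k ->
  \int[mu]_(s in `]a, b]) k s = K b - K a.
Proof.
rewrite le_eqVlt => /predU1P[<- _ _|ab dK ck].
  by rewrite set_itvoc0 Rintegral_set0 subrr.
rewrite Rintegral_itv_obnd_cbnd; last first.
  have h : mu.-integrable `[a, b] (EFin \o k).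
    apply: continuous_compact_integrable; first exact: segment_compact.
    by apply: continuous_subspaceT => s; exact: ck.
  apply: integrableS h => //.
  by apply: subset_itvr; rewrite bnd_simp.
have cK : continuous K.
  by move=> s; apply: differentiable_continuous; apply/derivable1_diffP; case: (dK s).
rewrite /Rintegral (@continuous_FTC2 R k K)//.
- exact: continuous_subspaceT.
- split; first by move=> s _; case: (dK s).
    exact/cvg_at_right_filter/cK.
  exact/cvg_at_left_filter/cK.
- by move=> s _; rewrite derive1E; apply: derive_val.
Qed.

(** The excess [k] is recorded through a primitive [K], so that exponential weights and constants
    are covered by one statement. *)
Lemma has_integral_le l1 l2 K k a b A1 A2 : a <= b ->
  (forall s : R, is_derive s 1 K (k s)) -> continuous k ->
  has_integral l1 a b A1 -> has_integral l2 a b A2 ->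
  {ae mu, forall s, a < s < b -> (l1 s <= l2 s + (k s)%:E)%E} ->
  A1 <= A2 + (K b - K a).
Proof.
move=> ab dK ck [f1 [i1 h1 ->]] [f2 [i2 h2 ->]] h.
rewrite -(Rintegral_derive ab dK ck).
(* [k] may fail to be integrable on the whole line, hence its restriction to [[a, b]]. *)
have ki := integrable_restr ab ck.
have -> : \int[mu]_(s in `]a, b]) k s = \int[mu]_(s in `]a, b]) (k \_ `[a, b]) s.
  apply: eq_Rintegral => s; rewrite inE/= in_itv/= => /andP[s1 s2].
  by rewrite patchE mem_set//= in_itv/= (ltW s1).
rewrite -RintegralD//; last 2 first.
  by apply: integrableS i2 => //; exact: measurable_itv.
  by apply: integrableS ki => //; exact: measurable_itv.
apply: ae_le_Rintegral => //.
  rewrite (_ : EFin \o _ = (EFin \o f2) \+ (EFin \o (k \_ `[a, b])))%E; last by apply/funext.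
  exact: integrableD.
have h12 := ae_imp2 h1 h2 (fun s => @conj _ _).
apply: (ae_imp2 h h12) => s hs [e1 e2] sab; move: (hs sab); rewrite e1// e2// -EFinD lee_fin.
rewrite patchE mem_set//=; rewrite in_itv/=.
by case/andP : sab => s1 s2; rewrite !ltW.
Qed.

Let shift (h : R) (x : measurableTypeR R) : measurableTypeR R := x + h.

Let measurable_shift h : measurable_fun [set: measurableTypeR R] (shift h).
Proof. by rewrite /shift; exact: measurable_funD. Qed.

Let preimage_shift_itv h a b : shift h @^-1` `]a, b] = `]a - h, b - h]%classic.
Proof. by apply/seteqP; split => x; rewrite /shift /= !in_itv/= ltrBlDr lerBrDr. Qed.

Let lebesgue_measure_shift h (D : set (measurableTypeR R)) : measurable D ->
  pushforward mu (shift h) D = mu D.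
Proof.
move=> mD; apply/esym/lebesgue_measure_unique => //= _ [[a b]] _ <-.
rewrite /pushforward preimage_shift_itv !lebesgue_measure_itv/= !lte_fin ltrD2r.
by case: ifP => // _; rewrite -!EFinB opprB addrA subrK.
Qed.

Lemma has_integral_shift l a b A h : has_integral l (a + h) (b + h) A ->
  has_integral (fun s => l (s + h)) a b A.
Proof.
move=> [f [fi fl ->]].
have mf : measurable_fun [set: measurableTypeR R] (EFin \o f) by case/integrableP : fi.
have mfh : measurable_fun [set: measurableTypeR R] ((EFin \o f) \o shift h).
  exact: measurableT_comp mf (measurable_shift h).
have fhi : mu.-integrable setT ((EFin \o f) \o shift h).
  apply/integrableP; split => //; case/integrableP : fi => _; apply: le_lt_trans.
  have -> : (\int[mu]_x `|(EFin \o f) x| = \int[pushforward mu (shift h)]_x `|(EFin \o f) x|)%E.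
    by apply: eq_measure_integral => B mB _; first [exact: lebesgue_measure_shift|exact/esym/lebesgue_measure_shift].
  rewrite ge0_integral_pushforward//; exact: measurableT_comp.
exists (f \o shift h); split => //.
  case: fl => N [mN N0 hN]; exists (shift h @^-1` N); split.
  - by rewrite -[X in measurable X]setTI; exact: measurable_shift.
  - by rewrite -N0 -(lebesgue_measure_shift h mN).
  - move=> s /= hs; apply: hN => /= hs'; apply: hs => /andP[s1 s2].
    by apply: hs'; rewrite /shift !ltrD2r s1.
rewrite /Rintegral; congr fine.
transitivity (\int[pushforward mu (shift h)]_(x in `](a + h)%R, (b + h)%R]) (EFin \o f) x)%E.
  by apply: eq_measure_integral => B mB _; first [exact: lebesgue_measure_shift|exact/esym/lebesgue_measure_shift].
rewrite integral_pushforward//; last by apply: integrableS fhi => //; rewrite preimage_shift_itv; exact: measurable_itv.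
by rewrite preimage_shift_itv !addrK.
Qed.

Definition measurable_version l a b := exists2 F : measurableTypeR R -> \bar R,
  measurable_fun setT F & {ae mu, forall s, a < s < b -> l s = F s}.

Lemma measurable_version_cat l a b c : measurable_version l a b -> measurable_version l b c ->
  measurable_version l a c.
Proof.
move=> [F1 m1 l1] [F2 m2 l2].
pose F (s : measurableTypeR R) := if s <= b then F1 s else F2 s.
exists F.
  apply: measurable_fun_ifT => //.
  by apply: measurable_fun_ler => //; exact: measurable_cst.
have l12 := ae_imp2 l1 l2 (fun s => @conj _ _).
apply: (ae_imp2 (ae_neq b) l12) => s /eqP sb [h1 h2] /andP[s1 s2]; rewrite /F.
case: leP => sb'; first by apply: h1; rewrite s1 lt_neqAle sb sb'.
by apply: h2; rewrite sb' s2.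
Qed.

Let integrable_has_integral l a b (G : measurableTypeR R -> \bar R) :
  mu.-integrable setT G -> {ae mu, forall s, a < s < b -> l s = G s} ->
  exists A, has_integral l a b A.
Proof.
move=> Gi lG; exists (\int[mu]_(s in `]a, b]) fine (G s)), (fine \o G); split => //.
  apply: (le_integrable _ _ _ Gi) => //.
    apply/measurable_EFinP/measurableT_comp => //; by case/integrableP : Gi.
  by move=> s _ /=; case: (G s) => [r||] //=; rewrite normr0 leey.
apply: (ae_imp2 lG (integrable_ae measurableT Gi)) => s h fG /h ->.
by rewrite /= fineK// fG.
Qed.

(** On a bounded interval the lower bound [- C] makes the negative part integrable; finiteness of
    the integral then forces integrability of the positive part. *)
Lemma measurable_version_has_integral l a b C : a <= b -> measurable_version l a b ->
  (forall s, a <= s <= b -> ((- C)%:E <= l s)%E) ->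
  (\int[mu]_(s in `[a, b]) l s < +oo)%E -> exists A, has_integral l a b A.
Proof.
move=> ab [F mF lF] lC linf.
pose G := (fun s : measurableTypeR R => maxe (F s) (- C)%:E) \_ `[a, b].
have mG : measurable_fun [set: measurableTypeR R] G.
  apply/(measurable_restrict _ (measurable_itv _) measurableT).
  by apply: measurable_funTS; exact: measurable_maxe.
have lG : {ae mu, forall s, `[a, b]%classic s -> l s = G s}.
  have h2 := ae_imp2 (ae_neq a) (ae_neq b) (fun s => @conj _ _).
  apply: (ae_imp2 h2 lF) => s [/eqP sa /eqP sb] h; rewrite /= in_itv/= => /andP[as_ sb'].
  have sab : a < s < b by rewrite !lt_neqAle as_ sb' eq_sym sa sb.
  by rewrite /G patchE mem_set/= ?in_itv/= ?as_ ?sb'// -h// max_l// lC// as_ sb'.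
have GC s : (- (`|C|%:E) <= G s)%E.
  rewrite /G patchE; case: ifP => _; last by rewrite -EFinN lee_fin oppr_le0.
  by rewrite le_max -EFinN !lee_fin lerN2 ler_norm orbT.
have iG : (\int[mu]_s G s < +oo)%E.
  have -> : (\int[mu]_s G s = \int[mu]_(s in `[a, b]) G s)%E.
    rewrite [RHS]integral_mkcond; apply: eq_integral => s _.
    by rewrite [RHS]patchE; case: ifPn => // h; rewrite /G patchE (negbTE h).
  by rewrite -(ae_eq_integral_nonmeasurable lG).
have nG : (\int[mu]_s G^\- s < +oo)%E.
  apply: (@le_lt_trans _ _ (\int[mu]_(s in `[a, b]) cst `|C|%:E s))%E; last first.
    rewrite integral_cst//= lebesgue_measure_itv/= lte_fin; by case: ifP => _; rewrite -?EFinB -EFinM ltry.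
  rewrite [leRHS]integral_mkcond; apply: ge0_le_integral => //.
  - exact: measurable_funeneg.
  - by apply/(measurable_restrict _ (measurable_itv _) measurableT).
  - move=> s _; rewrite funenegE patchE; case: ifPn => h.
      by rewrite ge_max -{1}[`|C|%:E]oppeK leeN2 GC/= lee_fin.
    by rewrite /G patchE (negbTE h) oppe0 maxxx.
have pG : (\int[mu]_s G^\+ s < +oo)%E.
  move: iG; rewrite integralE => iG.
  rewrite ltey; apply/eqP => pG; move: iG; rewrite pG.
  have nGf : (\int[mu]_s G^\- s \is a fin_num)%E.
    by rewrite ge0_fin_numE// integral_ge0.
  by rewrite -(fineK nGf) -EFinN addye.
apply: (@integrable_has_integral _ _ _ G).
  apply/integrableP; split => //.
  under eq_integral do rewrite -[`|G _|%E]/((abse \o G) _) fune_abse.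
  rewrite ge0_integralD//.
  - exact: lte_add_pinfty.
  - exact: measurable_funepos.
  - exact: measurable_funeneg.
apply: (ae_imp lG) => s h /andP[s1 s2]; apply: h.
by rewrite /= in_itv/= !ltW.
Qed.

Lemma measurable_version_dominated l a b (g : R -> R) : measurable_version l a b ->
  mu.-integrable setT (EFin \o g) -> {ae mu, forall s, a < s < b -> (`|l s| <= (g s)%:E)%E} ->
  exists A, has_integral l a b A.
Proof.
move=> [F mF lF] gi lg.
have mg : measurable_fun [set: measurableTypeR R] (EFin \o g) by case/integrableP : gi.
(* Clipping to the range between [- |g s|] and [|g s|] changes nothing almost everywhere in the
   interval, but makes the function integrable on the whole line. *)
pose G (s : measurableTypeR R) := maxe (- `|(EFin \o g) s|)%E (mine (F s) `|(EFin \o g) s|%E).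
apply: (@integrable_has_integral _ _ _ G).
  apply: (le_integrable _ _ _ gi) => //.
    apply: measurable_maxe; first by apply: measurableT_comp => //; exact: measurableT_comp.
    by apply: measurable_mine => //; exact: measurableT_comp.
  move=> s _; rewrite /= -[(`|g s|)%:E]/((`|g s|%R)%:E).
  have h1 : (- (`|g s|%R)%:E <= G s)%E by rewrite /G /= le_max lexx.
  have h2 : (G s <= (`|g s|%R)%:E)%E.
    by rewrite /G /= ge_max ge_min lexx orbT andbT lee_fin ge0_cp.
  by case: (G s) h1 h2 => [r||]//=; rewrite ?lee_fin => h1 h2; rewrite ?lee_fin ?ler_norml ?h1.
apply: (ae_imp2 lF lg) => s h1 h2 sab; move: (h2 sab); rewrite (h1 sab) /G /=.
case: (F s) => [r||] //=; rewrite ?leye_eq// lee_fin => hr.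
have h3 := le_trans hr (ler_norm _).
rewrite -EFin_min -EFin_max; congr EFin.
by rewrite min_l ?max_r//; move: h3; rewrite ler_norml => /andP[].
Qed.

End IntervalIntegral.

(** * Hamiltonians in charts *)

Lemma near_eq_is_diff (R : realType) (V W : normedModType R) (f g df : V -> W) (x : V) :
  {near x, f =1 g} -> is_diff x f df -> is_diff x g df.
Proof.
move=> fg [fd fE].
have gE : g \o shift x = cst (g x) + 'd f x +o_ 0 id.
  have /diff_locally := fd; move/eqaddoP => h; apply/eqaddoP => e e0.
  have : \forall h \near (0 : V), (f (h + x) = g (h + x)).
    move: fg; rewrite (near_shift 0); apply: filterS => z /=.
    by rewrite subr0.
  have fgx := nbhs_singleton fg.
  move: (h e e0); apply: filterS2 => z /= hz fgz.
  by move: hz; rewrite !fctE /= fgz fgx.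
have gd := diff_unique (diff_continuous fd) gE.
split; last by rewrite gd.
by apply/diff_locallyP; rewrite gd; split => //; exact: diff_continuous.
Qed.

Section Charts.
Context {R : realType} {n : nat} {M : topologicalType} (A : atlas R n M).
Implicit Types (c d x : M) (y v q p : 'rV[R]_n).

Lemma img_chart c x : dom A c x -> img A c (chart A c x).
Proof. by move=> cx; exists x. Qed.

Lemma cinvK c y : img A c y -> chart A c (cinv A c y) = y.
Proof. by move=> [x cx <-]; rewrite chartK. Qed.

Lemma dom_cinv c y : img A c y -> dom A c (cinv A c y).
Proof. by move=> [x cx <-]; rewrite chartK. Qed.

Lemma near_img c y : img A c y -> \forall z \near y, img A c z.
Proof. by move=> cy; apply: open_nbhs_nbhs; split => //; exact: img_open. Qed.

Lemma near_dom c x : dom A c x -> \forall z \near x, dom A c z.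
Proof. by move=> cx; apply: open_nbhs_nbhs; split => //; exact: dom_open. Qed.

Lemma near_cinv c y (P : set M) : img A c y -> (\forall x \near cinv A c y, P x) ->
  \forall z \near y, P (cinv A c z).
Proof. by move=> cy; exact: (cinv_continuous cy). Qed.

Lemma near_chart c x (P : set 'rV[R]_n) : dom A c x -> (\forall y \near chart A c x, P y) ->
  \forall z \near x, P (chart A c z).
Proof. by move=> cx; exact: (chart_continuous cx). Qed.

Lemma overlapP c d y : img A c y -> dom A d (cinv A c y) ->
  (chart A c @` (dom A c `&` dom A d)) y.
Proof. by move=> cy dy; exists (cinv A c y); [split => //; exact: dom_cinv|exact: cinvK]. Qed.

Lemma near_overlap c d y : img A c y -> dom A d (cinv A c y) ->
  \forall z \near y, img A c z /\ dom A d (cinv A c z).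
Proof.
move=> cy dy; near=> z; split; near: z; first exact: near_img.
by apply: near_cinv => //; exact: near_dom.
Unshelve. all: by end_near. Qed.

Lemma transition_differentiable c d y : img A c y -> dom A d (cinv A c y) ->
  differentiable (chart A d \o cinv A c) y.
Proof. by move=> cy dy; have [+ _] := chart_smooth A c d 1; apply; exact: overlapP. Qed.

Lemma mul_jacobian (m k : nat) (f : 'rV[R]_m -> 'rV[R]_k) (z w : 'rV[R]_m) : w *m 'J f z = 'd f z w.
Proof. exact: mul_rV_lin1. Qed.

Lemma jacobian_transition c d y : img A c y -> dom A d (cinv A c y) ->
  'J (chart A d \o cinv A c) y *m 'J (chart A c \o cinv A d) (chart A d (cinv A c y)) = 1%:M.
Proof.
move=> cy dy; apply/row_matrixP => i; rewrite !rowE mulmxA !mul_jacobian mulmx1.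
set t := chart A d \o cinv A c; set s := chart A c \o cinv A d.
have dt : differentiable t y by exact: transition_differentiable.
have ds : differentiable s (t y).
  apply: transition_differentiable; first exact: img_chart.
  by rewrite /t /= chartK//; exact: dom_cinv.
have st : {near y, s \o t =1 id}.
  move: (near_overlap cy dy); apply: filterS => z [cz dz].
  by rewrite /s /t /= chartK// cinvK.
have [_ h] := near_eq_is_diff st (differentiableP (differentiable_comp dt ds)).
pose ev (F : 'rV[R]_n -> 'rV[R]_n) := F (delta_mx 0 i).
have h1 := congr1 ev (diff_comp dt ds).
have h2 := congr1 ev h.
have h3 := congr1 ev (@diff_val _ _ _ _ _ _ _ (is_diff_id y)).
exact: etrans (esym h1) (etrans (esym h2) h3).
Qed.

(** The matrix inside [cotangent_of_chart]: it converts coordinates of a covector in chart [c] into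
    those of the chart around its base point, and may vary with that point without continuity. *)
Definition chart_cotangent c y : 'M[R]_n :=
  ('J (chart A c \o cinv A (cinv A c y)) (chart A (cinv A c y) (cinv A c y)))^T.

Lemma cotangent_of_chartE c y q :
  cotangent_of_chart A c (y, q) = (cinv A c y, q *m chart_cotangent c y).
Proof. by []. Qed.

Lemma chart_cotangentK c y : img A c y ->
  chart_cotangent c y *m ('J (chart A (cinv A c y) \o cinv A c) y)^T = 1%:M.
Proof.
move=> cy; rewrite /chart_cotangent -trmx_mul jacobian_transition ?trmx1//.
exact: dom_center.
Qed.

Lemma chart_cotangent_inj c y q : img A c y -> q *m chart_cotangent c y = 0 -> q = 0.
Proof.
move=> cy h; rewrite -[q]mulmx1 -(chart_cotangentK cy) mulmxA h.
by rewrite mul0mx.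
Qed.

Lemma chart_cotangent_center x : chart_cotangent x (chart A x x) = 1%:M.
Proof.
have xx := dom_center A x; rewrite /chart_cotangent (chartK xx).
apply/eqP; rewrite -trmx1 (inj_eq trmx_inj); apply/eqP/row_matrixP => i.
rewrite !rowE mul_jacobian mulmx1.
have ix : img A x (chart A x x) by exact: img_chart.
have e : {near chart A x x, id =1 chart A x \o cinv A x}.
  by move: (near_img ix); apply: filterS => z cz /=; rewrite cinvK.
by have [_ ->] := near_eq_is_diff e (is_diff_id _).
Qed.

Lemma pairing_chart c y v q : img A c y ->
  pairing (v *m 'J (chart A (cinv A c y) \o cinv A c) y) (q *m chart_cotangent c y) = pairing v q.
Proof.
move=> cy; rewrite /pairing trmx_mul mulmxA -(mulmxA v).
by rewrite -[X in v *m X]trmxK [X in (X)^T]trmx_mul trmxK chart_cotangentK// trmx1 mulmx1.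
Qed.

Lemma pairingDl v w q : pairing (v + w) q = pairing v q + pairing w q.
Proof. by rewrite /pairing mulmxDl mxE. Qed.
Lemma pairingDr v w q : pairing q (v + w) = pairing q v + pairing q w.
Proof. by rewrite /pairing linearD mulmxDr mxE. Qed.
Lemma pairingZl (k : R) w q : pairing (k *: w) q = k * pairing w q.
Proof. by rewrite /pairing -scalemxAl mxE. Qed.
Lemma pairingZr (k : R) w q : pairing q (k *: w) = k * pairing q w.
Proof. by rewrite /pairing linearZ -scalemxAr mxE. Qed.
Lemma pairingNr v q : pairing v (- q) = - pairing v q.
Proof. by rewrite -scaleN1r pairingZr mulN1r. Qed.
Lemma pairingBr v p q : pairing v (p - q) = pairing v p - pairing v q.
Proof. by rewrite pairingDr pairingNr. Qed.
Lemma pairingNl v q : pairing (- v) q = - pairing v q.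
Proof. by rewrite -scaleN1r pairingZl mulN1r. Qed.
Lemma pairingBl v p q : pairing (p - q) v = pairing p v - pairing q v.
Proof. by rewrite pairingDl pairingNl. Qed.
Lemma pairing0r v : pairing v 0 = 0.
Proof. by rewrite -(scale0r 0) pairingZr mul0r. Qed.
Lemma pairing0l v : pairing 0 v = 0.
Proof. by rewrite -(scale0r 0) pairingZl mul0r. Qed.
Lemma pairingE v q : pairing v q = \sum_j v 0 j * q 0 j.
Proof. by rewrite /pairing mxE; apply: eq_bigr => j _; rewrite mxE. Qed.
Lemma pairingC v q : pairing v q = pairing q v.
Proof. by rewrite !pairingE; apply: eq_bigr => j _; rewrite mulrC. Qed.

Lemma coord_norm_le v j : `|v 0 j| <= `|v|.
Proof. by rewrite [leRHS]mx_normrE; exact: (le_bigmax _ (fun ij => `|v ij.1 ij.2|) (0, j)). Qed.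

Lemma pairing_le v q : `|pairing v q| <= n%:R * (`|v| * `|q|).
Proof.
rewrite pairingE (le_trans (ler_norm_sum _ _ _))//.
rewrite (le_trans (ler_sum _ (G := fun=> `|v| * `|q|) _))//.
  by move=> j _; rewrite normrM ler_pM// coord_norm_le.
by rewrite sumr_const card_ord mulr_natl.
Qed.

(* The sup norm of ['rV[R]_n] is attained by testing against a signed basis covector. *)
Lemma norm_pairing v : exists q, `|q| <= 1 /\ pairing v q = `|v|.
Proof.
have [->|v0] := eqVneq v 0; first by exists 0; rewrite pairing0r !normr0.
have [j hj] : exists j, `|v| = `|v 0 j|.
  have /rV0Pn[j0 _] := v0.
  have h := @bigmax_eq_arg _ R _ 0 (0, j0) xpredT (fun ij => `|v ij.1 ij.2|) isT (fun _ _ => normr_ge0 _).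
  by move: h; case: [arg max_(_ > _) _]%O => i j h; exists j; rewrite [LHS]mx_normrE h (ord1 i).
exists (Num.sg (v 0 j) *: delta_mx 0 j); split.
  rewrite [leLHS]mx_normrE; apply: bigmax_le => //= -[i k] _; rewrite !mxE/= normrM.
  rewrite normr_sg; case: (v 0 j != 0); rewrite ?mul0r// mul1r normr_nat.
  by case: (_ && _).
rewrite hj pairingE (bigD1 j)//= big1 => [|k kj]; last first.
  by rewrite !mxE eqxx (negbTE kj)/= mulr0 mulr0.
by rewrite !mxE !eqxx mulr1 addr0 normrEsg mulrC.
Qed.

End Charts.

(** * Legendre duality and convexity in a fixed chart *)

Section Legendre.
Context {R : realType} {n : nat} {M : topologicalType} (A : atlas R n M).
Implicit Types (c d x : M) (y v q p : 'rV[R]_n) (H G : cotangent A * R -> R).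

Lemma is_derive_row (f : R -> 'rV[R]_n) (s : R) v :
  (forall j, is_derive s 1 (fun t => f t 0 j) (v 0 j)) -> is_derive s 1 f v.
Proof.
move=> h; have df : derivable f s 1.
  by apply/derivable_mxP => i j; rewrite (ord1 i); case: (h j).
split => //; rewrite derive_mx//; apply/rowP => j; rewrite !mxE.
by case: (h j).
Qed.

Definition in_chart G c y q (u : R) : R := G (cotangent_of_chart A c (y, q), u).

Lemma in_chartE G c y q u : in_chart G c y q u = G (cinv A c y, q *m chart_cotangent A c y, u).
Proof. by []. Qed.

Lemma in_chart_center G x p u : in_chart G x (chart A x x) p u = G (x, p, u).
Proof. by rewrite in_chartE chart_cotangent_center mulmx1 chartK//; exact: dom_center. Qed.

(** The chart used by [lagrangian] jumps with the base point. Reading velocity and covectors in one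
    chart [c] removes the jumps, because the Jacobians cancel in the pairing. *)
Lemma lagrangian_chart H c y v u : img A c y ->
  lagrangian H (cinv A c y) (v *m 'J (chart A (cinv A c y) \o cinv A c) y) u =
  ereal_sup [set (pairing v q - in_chart H c y q u)%:E | q in [set: 'rV[R]_n]].
Proof.
move=> cy; rewrite /lagrangian; congr ereal_sup; apply/seteqP; split => _ [p _ <-].
  exists (p *m ('J (chart A (cinv A c y) \o cinv A c) y)^T) => //.
  rewrite -(pairing_chart _ _ cy) in_chartE -mulmxA.
  by rewrite (mulmx1C (chart_cotangentK cy)) mulmx1.
by exists (p *m chart_cotangent A c y) => //; rewrite (pairing_chart _ _ cy).
Qed.

Lemma velocity_chart c (gamma : R -> M) (s : R) v : {for s, continuous gamma} ->
  dom A c (gamma s) -> is_derive s 1 (chart A c \o gamma) v ->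
  velocity A gamma s = v *m 'J (chart A (gamma s) \o cinv A c) (chart A c (gamma s)).
Proof.
move=> cg cs dy; set x := gamma s.
pose t := chart A x \o cinv A c; pose y := chart A c \o gamma.
have dt : differentiable t (y s).
  by apply: transition_differentiable; rewrite /y/= ?chartK//; [exact: img_chart|exact: dom_center].
have dfy : differentiable y s by apply/derivable1_diffP; case: dy.
have e : \forall r \near s, (t \o y) r = (chart A x \o gamma) r.
  have h : \forall r \near s, dom A c (gamma r) := cg _ (near_dom cs).
  move: h; apply: filterS => r /= cr.
  by rewrite /t /y /= chartK.
rewrite /velocity derive1E -(near_eq_derive _ e) deriveE; last exact: differentiable_comp.
pose ev (F : R -> 'rV[R]_n) := F 1.
have h1 := congr1 ev (diff_comp dfy dt).
rewrite [LHS]h1 /ev /= mul_jacobian; congr ('d _ _ _).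
by rewrite -deriveE//; case: dy.
Qed.

Lemma le_lagrangian_chart H c (gamma : R -> M) (s : R) v q u : {for s, continuous gamma} ->
  dom A c (gamma s) -> is_derive s 1 (chart A c \o gamma) v ->
  ((pairing v q - in_chart H c (chart A c (gamma s)) q u)%:E <=
    lagrangian H (gamma s) (velocity A gamma s) u)%E.
Proof.
move=> cg cs dy; rewrite (velocity_chart cg cs dy).
have := lagrangian_chart H v u (img_chart cs); rewrite chartK// => ->.
by apply: ereal_sup_ubound; exists q.
Qed.

Lemma Ck_cotangent_differentiable H k c y q u : Ck_cotangent k.+1 H -> img A c y ->
  differentiable (fun z : 'rV[R]_n * 'rV[R]_n * R^o => H (cotangent_of_chart A c z.1, z.2) : R^o)
    ((y, q), u).
Proof. by move=> hH cy; have [h _] := hH c; exact: h. Qed.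

Lemma Ck_cotangent_continuous H k c y q u : Ck_cotangent k.+1 H -> img A c y ->
  {for ((y, q), u), continuous (fun z : 'rV[R]_n * 'rV[R]_n * R^o => in_chart H c z.1.1 z.1.2 z.2 : R^o)}.
Proof.
move=> hH cy; exact: differentiable_continuous (Ck_cotangent_differentiable q u hH cy).
Qed.

(** [i] is affine with linear part [L], so the two difference quotients coincide term by term. *)
Lemma derive_slice (V W X : normedModType R) (F : V -> X) (i : W -> V) (L : W -> V) (w z : W) :
  (forall (h : R) w z, i (h *: w + z) = h *: L w + i z) ->
  'D_w (F \o i) z = 'D_(L w) F (i z).
Proof.
move=> h; rewrite /derive; set f := fun r => _; set g := fun r => _.
by have -> : f = g by apply/funext => r; rewrite /f /g /= h.
Qed.

Lemma derivable_slice (V W X : normedModType R) (F : V -> X) (i : W -> V) (L : W -> V) (w z : W) :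
  (forall (h : R) w z, i (h *: w + z) = h *: L w + i z) ->
  derivable F (i z) (L w) -> derivable (F \o i) z w.
Proof.
move=> h; rewrite /derivable; set f := fun r => _; set g := fun r => _.
by have -> : f = g by apply/funext => r; rewrite /f /g /= h.
Qed.

Section Convexity.
Variables (H : cotangent A * R -> R).
Hypotheses (H_C3 : Ck_cotangent 3 H)
  (H_convex : forall x p u, posdef (hessian (fun q => H (x, q, u)) p)).

Let line p w : R -> 'rV[R]_n := fun t => t *: w + p.

Let lineE p w (h : R) (t z : R^o) : line p w (h *: t + z) = h *: (t *: w) + line p w z.
Proof. by rewrite /line scalerDl scalerA addrA. Qed.

Lemma is_derive_line (h : 'rV[R]_n -> R) p w (t : R) : differentiable (h : _ -> R^o) (t *: w + p) ->
  is_derive t 1 (fun t => h (t *: w + p)) ('D_w (h : _ -> R^o) (t *: w + p)).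
Proof.
move=> dh; have e := @derive_slice _ R^o _ (h : _ -> R^o) (line p w) (fun t => t *: w) 1 t (lineE p w).
split.
  by apply: (@derivable_slice _ R^o _ (h : _ -> R^o) (line p w) (fun t => t *: w) 1 t (lineE p w)); exact: diff_derivable.
by rewrite [LHS]e scale1r.
Qed.

Lemma derive_gradient (h : 'rV[R]_n -> R) p w : differentiable (h : _ -> R^o) p ->
  'D_w (h : _ -> R^o) p = pairing w (gradient h p).
Proof.
move=> dh; rewrite deriveE// {1}(row_sum_delta w) linear_sum pairingE.
by apply: eq_bigr => j _; rewrite linearZ/= /gradient mxE deriveE.
Qed.

(** [v] is the gradient in [p]. The mean value theorem is applied twice along the segment from [p]
    to [q], and the second derivative met there is a positive value of the Hessian form. Strictness
    isolates [p] as the maximizer of the Legendre transform, as [near_tangent] requires. *)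
Lemma strict_tangent x p u : exists v, forall q, q != p ->
  H (x, p, u) + pairing v (q - p) < H (x, q, u).
Proof.
pose F (z : 'rV[R]_n * 'rV[R]_n * R^o) : R^o := H (cotangent_of_chart A x z.1, z.2).
pose y := chart A x x.
have iy : img A x y by apply: img_chart; exact: dom_center.
pose h q : R^o := H (x, q, u).
pose i q : 'rV[R]_n * 'rV[R]_n * R^o := ((y, q), u).
pose L w : 'rV[R]_n * 'rV[R]_n * R^o := ((0, w), 0).
have iE (k : R) (w z : 'rV[R]_n) : i (k *: w + z) = k *: L w + i z.
  by rewrite /i /L; congr (_, _, _); rewrite /= scaler0 add0r.
have hE : h = F \o i.
  by apply/funext => q; rewrite /h /F /i /= -in_chart_center.
have dL w z : 'D_w h z = 'D_(L w) F (i z).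
  by rewrite hE; exact: derive_slice.
have di q : differentiable i q.
  apply: differentiable_pair; last exact: differentiable_cst.
  by apply: differentiable_pair; [exact: differentiable_cst|exact: ex_diff].
have [dF d2F] := H_C3 x.
have dh q : differentiable h q.
  by rewrite hE; apply: differentiable_comp => //; exact: dF.
have ddh w q : differentiable ('D_w h : _ -> R^o) q.
  have -> : 'D_w h = 'D_(L w) F \o i by apply/funext => z; exact: dL.
  by apply: differentiable_comp => //; have [+ _] := d2F (L w); exact.
have h2 w q : w != 0 -> 0 < 'D_w ('D_w h) q.
  move=> w0; have := H_convex x q u w0.
  (* Expanding the inner derivative in the basis turns the second directional derivative into the
     Hessian form, in the order of differentiation used by [hessian]. *)
  have hw : 'D_w h = \sum_(j < n) (w 0 j *: 'D_('e_j) h).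
    apply/funext => z; rewrite fct_sumE derive_gradient// pairingE.
    by apply: eq_bigr => j _; rewrite /gradient mxE.
  suff -> : 'D_w ('D_w h) q = (w *m hessian h q *m w^T) 0 0 by [].
  have dj j : derivable ('D_('e_j) h : _ -> R^o) q w by apply: diff_derivable; exact: ddh.
  rewrite hw derive_sum; last by move=> j; exact: derivableZ.
  rewrite mxE; apply: eq_bigr => j _; rewrite deriveZ// [in RHS]mxE mulrC; congr (_ * _); first by rewrite mxE.
  rewrite derive_gradient; last exact: ddh.
  by rewrite pairingE; apply: eq_bigr => k _; rewrite !mxE.
exists (gradient h p) => q qp; rewrite pairingC -derive_gradient//.
pose w := q - p; have w0 : w != 0 by rewrite subr_eq0.
pose g t : R := h (t *: w + p).
have dg (t : R) : is_derive t 1 g ('D_w h (t *: w + p)) by exact: is_derive_line.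
have ddg (t : R) : is_derive t 1 (fun t => 'D_w h (t *: w + p) : R) ('D_w ('D_w h) (t *: w + p)).
  exact: is_derive_line.
have cont (f f' : R -> R) : (forall t : R, is_derive t 1 f (f' t)) -> forall B : set R, {within B, continuous f}.
  move=> df B; apply: continuous_subspaceT => t; apply: differentiable_continuous.
  by apply/derivable1_diffP; case: (df t).
have [t t01 gt] := MVT ltr01 (fun t _ => dg t) (cont _ _ dg _).
move: t01; rewrite in_itv/= => /andP[t0 t1].
have [s _ gs] := MVT t0 (fun t _ => ddg t) (cont _ _ ddg _).
have : 0 < 'D_w h (t *: w + p) - 'D_w h (0 *: w + p).
  by rewrite gs subr0 mulr_gt0// h2.
rewrite scale0r add0r subr_gt0; move: gt; rewrite subr0 mulr1 /g scale1r subrK scale0r add0r.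
rewrite -/w /h; lra.
Qed.

End Convexity.

End Legendre.

(** * Locally uniform estimates for the Hamiltonian *)

Section Bounds.
Context {R : realType} {n : nat} {M : topologicalType} (A : atlas R n M) (g : riemannian_metric A).
Implicit Types (c d x : M) (y v q p : 'rV[R]_n).
Variables (H : cotangent A * R -> R) (lambda : R).
Hypotheses (H_C3 : Ck_cotangent 3 H)
  (H_convex : forall x p u, posdef (hessian (fun q => H (x, q, u)) p))
  (H_superlinear : forall x (u a : R), exists C : R,
      forall p, a * conorm g x p - C <= H (x, p, u))
  (H_lipschitz : forall x p u, `| derive1 (fun s : R => H (x, p, s)) u | <= lambda).

Let Hc := in_chart H.

Lemma hamiltonian_lipschitz x p u u' : `|H (x, p, u) - H (x, p, u')| <= lambda * `|u - u'|.
Proof.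
pose F (z : 'rV[R]_n * 'rV[R]_n * R^o) : R^o := H (cotangent_of_chart A x z.1, z.2).
pose i (s : R^o) : 'rV[R]_n * 'rV[R]_n * R^o := ((chart A x x, p), s).
have hE : (fun s : R => H (x, p, s)) = F \o i.
  by apply/funext => s; rewrite /F /i /= -in_chart_center.
have iE (k : R) (w z : R^o) : i (k *: w + z) = k *: ((0, 0), w) + i z.
  by rewrite /i; congr (_, _, _); rewrite /= scaler0 add0r.
have df s : derivable (fun s : R => H (x, p, s)) s 1.
  rewrite hE; apply: (derivable_slice iE); apply: diff_derivable.
  by have [+ _] := H_C3 x; apply; apply: img_chart; exact: dom_center.
have main a b : a <= b -> `|H (x, p, b) - H (x, p, a)| <= lambda * (b - a).
  move=> ab; have [|s _ ->] := MVT_segment ab (fun t _ => derivableP (df t)).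
    apply: continuous_subspaceT => t; apply: differentiable_continuous.
    exact/derivable1_diffP.
  rewrite normrM (ger0_norm (_ : 0 <= b - a)) ?subr_ge0// ler_wpM2r ?subr_ge0//.
  by have := H_lipschitz x p s; rewrite derive1E.
have [ab|/ltW ba] := leP u' u; first by rewrite (ger0_norm (_ : 0 <= u - u')) ?subr_ge0//; exact: main.
by rewrite distrC (distrC u) (ger0_norm (_ : 0 <= u' - u)) ?subr_ge0//; exact: main.
Qed.

Lemma in_chart_lipschitz c y q u u' : `|Hc c y q u - Hc c y q u'| <= lambda * `|u - u'|.
Proof. by rewrite /Hc !in_chartE hamiltonian_lipschitz. Qed.

Lemma lambda_ge0 : M -> 0 <= lambda.
Proof. by move=> x; exact: le_trans (normr_ge0 _) (H_lipschitz x 0 0). Qed.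

Lemma strict_tangent_chart c y q0 u : img A c y -> exists v, forall q, q != q0 ->
  Hc c y q0 u + pairing v (q - q0) < Hc c y q u.
Proof.
move=> cy; pose B := chart_cotangent A c y.
have [v hv] := strict_tangent H_C3 H_convex (cinv A c y) (q0 *m B) u.
exists (v *m B^T) => q qq; rewrite /Hc !in_chartE.
have -> : pairing (v *m B^T) (q - q0) = pairing v (q *m B - q0 *m B).
  by rewrite -mulmxBl /pairing trmx_mul mulmxA.
apply: hv; apply: contra qq => /eqP e; rewrite -subr_eq0; apply/eqP.
by apply: (chart_cotangent_inj cy); rewrite mulmxBl e subrr.
Qed.

Lemma tangent_chart c y q0 u : img A c y -> exists v, forall q,
  Hc c y q0 u + pairing v (q - q0) <= Hc c y q u.
Proof.
move=> cy; have [v hv] := strict_tangent_chart q0 u cy; exists v => q.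
by have [->|/hv/ltW//] := eqVneq q q0; rewrite subrr pairing0r addr0.
Qed.

Lemma ray_convex c y q0 w u (s : R) : img A c y -> 1 <= s ->
  s * (Hc c y (q0 + w) u - Hc c y q0 u) <= Hc c y (q0 + s *: w) u - Hc c y q0 u.
Proof.
move=> cy s1; have [v hv] := tangent_chart (q0 + w) u cy.
have := hv q0; have := hv (q0 + s *: w).
have -> : q0 + s *: w - (q0 + w) = (s - 1) *: w.
  by rewrite opprD addrACA subrr add0r scalerBl scale1r.
have -> : q0 - (q0 + w) = - w by rewrite opprD addrA subrr add0r.
rewrite pairingNr pairingZr; set P := pairing v w.
set a := Hc _ _ _ _; set b := Hc _ _ _ _; set d := Hc _ _ _ _ => h1 h2.
nra.
Qed.

(** The covector is separated from the other variables in the filter, which is the shape that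
    covering arguments over a compact set of covectors require. *)
Lemma near_chart_cont c y0 q u0 (e : R) : img A c y0 -> 0 < e ->
  \forall q' \near q & z \near (y0, u0), `|Hc c y0 q u0 - Hc c z.1 q' z.2| < e.
Proof.
move=> cy e0.
have hc := @Ck_cotangent_continuous _ _ _ _ H 2 c y0 q u0 H_C3 cy.
have [[S1 S2] [/= [[T1 T2] [/= hT1 hT2] hT] hS2] hS] := (cvgrPdist_lt _ _).1 hc _ e0.
exists (T2, T1 `*` S2) => /=; first by split => //; exists (T1, S2).
by move=> [q' [y u]] [/= h1 [h2 h3]]; apply: (hS ((y, q'), u)); split => //; exact: hT.
Qed.

Lemma compact_near_forall (X : topologicalType) (T : Type) (F : set_system T) (FF : Filter F) (K : set X)
    (P : T -> X -> Prop) : compact K ->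
  (forall k, K k -> \forall k' \near k & z \near F, P z k') ->
  \forall z \near F, forall k, K k -> P z k.
Proof. by move=> cK h; exact: ((compact_near_coveringP K).1 cK _ F P _ h). Qed.

Lemma near_norm q (e : R) : 0 < e -> \forall q' \near q, `|q - q'| < e.
Proof. by move=> e0; apply/nbhs_normP; exists e. Qed.

Lemma compact_ball (r : R) (z : 'rV[R]_n) : compact [set q : 'rV[R]_n | `|q - z| <= r].
Proof.
apply: bounded_closed_compact.
  exists (r + `|z|); split; first exact: num_real.
  move=> s rs q /= qr; apply: ltW; apply: le_lt_trans rs.
  by rewrite -{1}(subrK z q) (le_trans (ler_normD _ _))// lerD2r.
have -> : [set q : 'rV[R]_n | `|q - z| <= r] = closed_ball_ Num.Def.normr z r.
  by apply/seteqP; split => q /=; rewrite /closed_ball_/= distrC.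
exact: closed_closed_ball_.
Qed.

(** Compactness of the ball of covectors settles [u = 0], the Lipschitz condition all other [u]. The
    constant takes part in the covering argument as a variable tending to infinity, so the bound
    comes out uniform over the ball. *)
Lemma bounded_chart c y0 (K : R) : img A c y0 -> exists C : R, \forall y \near y0,
  forall q u, `|q| <= K -> `|Hc c y q u| <= C + lambda * `|u|.
Proof.
move=> cy; have cK := @compact_ball K 0.
have [] := (compact_near_coveringP _).1 cK _ (filter_prod (nbhs (y0, 0 : R^o)) (pinfty_nbhs R))
  (fun i q => `|Hc c i.1.1 q i.1.2| <= i.2) _.
  move=> q _; have [[Q1 Q2] [/= hQ1 hQ2] hQ] := near_chart_cont q 0 cy ltr01.
  exists (Q1, [set i | Q2 i.1 /\ `|Hc c y0 q 0| + 1 <= i.2]) => /=.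
    split => //; exists (Q2, [set C | `|Hc c y0 q 0| + 1 <= C]); last by move=> i [].
    by split => //; exact: nbhs_pinfty_ge.
  move=> [q' [z C]] [/= h1 [h2 h3]]; apply: le_trans h3.
  have := hQ (q', z) (conj h1 h2) => /= h4.
  by rewrite -lerBlDl (le_trans _ (ltW h4))// (le_trans (lerB_dist _ _))// distrC.
move=> [S1 S2] [/= hS1 hS2] hS; have [C hC] := filter_ex hS2.
exists C; have [[T1 T2] [/= hT1 hT2] hT] := hS1.
move: hT1; apply: filterS => y hy q u qK.
have := hS ((y, 0), C) (conj (hT (y, 0) (conj hy (nbhs_singleton hT2))) hC) q.
rewrite /= subr0 => /(_ qK) h.
have := in_chart_lipschitz c y q u 0; rewrite subr0 => h'.
by rewrite -(subrK (Hc c y q 0) (Hc c y q u)) (le_trans (ler_normD _ _))// addrC lerD.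
Qed.

(* Beyond the sphere where [Hc] exceeds its tangent plane, convexity along rays keeps it above. *)
Lemma near_tangent c y0 p0 u0 : img A c y0 -> exists v, forall eta, 0 < eta ->
  \forall z \near (y0, u0), img A c z.1 -> forall q,
    pairing v q - Hc c z.1 q z.2 <= pairing v p0 - Hc c y0 p0 u0 + eta.
Proof.
move=> cy; have [v hv] := strict_tangent_chart p0 u0 cy.
exists v => eta eta0.
pose D z q := Hc c z.1 q z.2 - pairing v q.
pose d0 := D (y0, u0) p0.
have cD q (e : R) : 0 < e -> \forall q' \near q & z \near (y0, u0), `|D (y0, u0) q - D z q'| < e.
  move=> e0; have e2 : 0 < e / 2 by rewrite divr_gt0.
  have [[Q1 Q2] [/= hQ1 hQ2] hQ] := near_chart_cont q u0 cy e2.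
  have V0 : 0 < n%:R * `|v| + 1 by rewrite ltr_wpDl// mulr_ge0.
  exists ([set q' | Q1 q' /\ `|q - q'| < e / 2 / (n%:R * `|v| + 1)], Q2) => /=.
    split => //; apply: filterI => //.
    by apply: near_norm; exact: divr_gt0.
  move=> [q' z] [/= [h1 h2] h3]; have := hQ (q', z) (conj h1 h3) => /= h4.
  have -> : D (y0, u0) q - D z q' = (Hc c y0 q u0 - Hc c z.1 q' z.2) - pairing v (q - q').
    by rewrite /D/= pairingBr; lra.
  rewrite (le_lt_trans (ler_normB _ _))// (splitr e) ltr_leD//.
  rewrite (le_trans (pairing_le _ _))// mulrA.
  move: h2; rewrite ltr_pdivlMr// => /ltW; apply: le_trans.
  by rewrite mulrC ler_wpM2l// lerDl.
have Dd0 q : d0 <= D (y0, u0) q.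
  have [->//|/hv h] := eqVneq q p0.
  by move: h; rewrite /d0 /D/= pairingBr; lra.
have inside : \forall z \near (y0, u0), forall q, `|q - p0| <= 1 -> d0 - eta <= D z q.
  apply: (@compact_near_forall _ _ (nbhs (y0, u0)) _ [set q | `|q - p0| <= 1] (fun z q => d0 - eta <= D z q)).
    exact: compact_ball.
  move=> q _; have := cD q eta eta0; apply: filterS => -[q' z] /=.
  by have := Dd0 q; rewrite ltr_norml; set X := D _ q; set Y := D z q' => h1 /andP[h2 h3]; lra.
have at0 (e : R) : 0 < e -> \forall z \near (y0, u0), `|d0 - D z p0| < e.
  move=> e0; have [[Q1 Q2] [/= hQ1 hQ2] hQ] := cD p0 e e0.
  move: hQ2; apply: filterS => z hz.
  by have := hQ (p0, z) (conj (nbhs_singleton hQ1) hz).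
have sphere : \forall z \near (y0, u0), forall q, `|q - p0| <= 1 -> `|q - p0| = 1 -> D z p0 <= D z q.
  apply: (@compact_near_forall _ _ (nbhs (y0, u0)) _ [set q | `|q - p0| <= 1] (fun z q => `|q - p0| = 1 -> D z p0 <= D z q)).
    exact: compact_ball.
  move=> q _; have [q1|q1|q1] := ltgtP `|q - p0| 1.
  - have e0 : 0 < 1 - `|q - p0| by rewrite subr_gt0.
    exists ([set q' | `|q - q'| < 1 - `|q - p0|], setT) => /=.
      by split; [exact: near_norm|exact: filterT].
    move=> [q' z] [/= h _] h1; exfalso; move: (ler_distD q q' p0); rewrite h1 distrC.
    by rewrite leNgt => /negP; apply; rewrite -ltrBrDr.
  - exists ([set q' | `|q - q'| < `|q - p0| - 1], setT) => /=.
      by split; [apply: near_norm; rewrite subr_gt0|exact: filterT].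
    move=> [q' z] [/= h _] h1; exfalso; move: (ler_distD q' q p0); rewrite h1.
    by rewrite leNgt => /negP; apply; rewrite -ltrBrDr.
  - have qp : q != p0 by apply/eqP => e; move: q1; rewrite e subrr normr0 => /eqP; rewrite eq_sym oner_eq0.
    have m0 : 0 < D (y0, u0) q - d0 by rewrite subr_gt0 /d0 /D/=; have := hv q qp; rewrite pairingBr; lra.
    have m2 : 0 < (D (y0, u0) q - d0) / 2 by rewrite divr_gt0.
    have [[Q1 Q2] [/= hQ1 hQ2] hQ] := cD q _ m2.
    exists (Q1, [set z | Q2 z /\ `|d0 - D z p0| < (D (y0, u0) q - d0) / 2]) => /=.
      by split => //; apply: filterI => //; exact: at0.
    move=> [q' z] [/= h1 [h2 h3]] _; have := hQ (q', z) (conj h1 h2) => /=.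
    move: h3; rewrite !ltr_norml => /andP[h3 h4] /andP[h5 h6].
    move: h3 h4 h5 h6; set X := D _ q; set Y := D z q'; set Z := D z p0; lra.
near=> z => cz q.
suff : d0 - eta <= D z q by rewrite /d0 /D/=; lra.
have in1 : forall q, `|q - p0| <= 1 -> d0 - eta <= D z q by near: z.
have sp1 : forall q, `|q - p0| = 1 -> D z p0 <= D z q.
  move=> r r1; have h : forall q, `|q - p0| <= 1 -> `|q - p0| = 1 -> D z p0 <= D z q by near: z.
  by apply: h => //=; rewrite r1.
have [q1|q1] := leP `|q - p0| 1; first exact: in1.
have q0 : 0 < `|q - p0| := lt_trans ltr01 q1.
pose w := `|q - p0|^-1 *: (q - p0).
have w1 : `|w| = 1 by rewrite normrZ normfV normr_id mulVf// gt_eqF.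
have := ray_convex p0 w z.2 cz (ltW q1).
have e1 : p0 + `|q - p0| *: w = q by rewrite scalerA divff ?gt_eqF// scale1r addrC subrK.
rewrite e1.
have h1 : D z p0 <= D z (p0 + w) by apply: sp1; rewrite addrC addKr.
have h2 : d0 - eta <= D z p0 by apply: in1; rewrite subrr normr0.
have e2 := pairingDr p0 (`|q - p0| *: w) v; rewrite e1 pairingZr in e2.
move: h1 h2; rewrite /D e2 pairingDr.
set P := pairing v w; set Hq := Hc _ z.1 q _; set Hw := Hc _ _ (p0 + w) _; set H0 := Hc _ z.1 p0 _.
set s := `|q - p0|; set V := pairing v p0 => h1 h2 h3.
have : 0 <= s * (Hw - H0 - P) by rewrite mulr_ge0// ?(ltW q0)//; lra.
lra.
Unshelve. all: by end_near. Qed.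

Lemma norm_mulmx (q : 'rV[R]_n) (D : 'M[R]_n) : `|q *m D| <= n%:R * (`|q| * `|D|).
Proof.
rewrite [leLHS]mx_normrE; apply: bigmax_le => [|[i j] _]; first by rewrite mulr_ge0// mulr_ge0.
rewrite (ord1 i) /= mxE (le_trans (ler_norm_sum _ _ _))//.
rewrite (le_trans (ler_sum _ (G := fun=> `|q| * `|D|) _))//.
  move=> k _; rewrite normrM ler_pM// ?coord_norm_le//.
  by rewrite [leRHS]mx_normrE; exact: (le_bigmax _ (fun ij => `|D ij.1 ij.2|) (k, j)).
by rewrite sumr_const card_ord mulr_natl.
Qed.

(** Cauchy-Schwarz for the Gram form [B]: with [w = p *m invmx G], the number [B w w] is the squared
    conorm, and [|p| = B w q] for some [q] of norm at most 1, so [S0] only has to bound [B q q]. *)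
Lemma norm_conorm x : exists2 S : R, 0 <= S & forall p, `|p| <= S * conorm g x p.
Proof.
pose G := metric g x.
have Gs : G^T = G := Defs.metric_sym g x.
have Gp : posdef G := @metric_posdef _ _ _ _ g x.
have Gu : G \in unitmx.
  rewrite -row_free_unit -kermx_eq0; apply/eqP/row_matrixP => i; rewrite row0.
  apply/eqP; apply: contraT => /Gp.
  have -> : row i (kermx G) *m G = 0 by apply/sub_kermxP; exact: row_sub.
  by rewrite mul0mx mxE ltxx.
pose B (u w : 'rV[R]_n) : R := (u *m G *m w^T) 0 0.
have BE u w : B u w = pairing (u *m G) w by [].
have BC u w : B u w = B w u.
  rewrite /B -{1}Gs -{1}[u]trmxK -trmx_mul -trmx_mul mulmxA -{1}[w]trmxK.
  by rewrite [in LHS]mxE trmxK.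
have B0 u : 0 <= B u u.
  have [->|/Gp/ltW//] := eqVneq u 0; by rewrite /B !mul0mx mxE.
have BCS q w : (B q w) ^+ 2 <= B q q * B w w.
  have [->|w0] := eqVneq w 0.
    by rewrite BC /B !mul0mx mxE expr0n/= mulr0.
  have d0 : 0 < B w w by exact: Gp.
  pose t := B q w / B w w.
  have := B0 (q - t *: w).
  have -> : B (q - t *: w) (q - t *: w) = B q q - 2 * t * B q w + t ^+ 2 * B w w.
    rewrite !BE mulmxBl -scalemxAl pairingBr !pairingBl !pairingZl !pairingZr -!BE (BC w q); ring.
  have -> : B q q - 2 * t * B q w + t ^+ 2 * B w w = B q q - (B q w) ^+ 2 / B w w.
    by rewrite /t; field; rewrite gt_eqF.
  by rewrite subr_ge0 ler_pdivrMr.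
pose S0 := n%:R * (n%:R * `|G|) : R.
have S00 : 0 <= S0 by rewrite mulr_ge0// mulr_ge0.
exists (Num.sqrt S0) => [|p]; first exact: sqrtr_ge0.
have [q [q1 hq]] := norm_pairing p.
pose w := p *m invmx G.
have pE : p = w *m G by rewrite /w mulmxKV.
have dE : (p *m invmx G *m p^T) 0 0 = B w w.
  by rewrite {2}pE trmx_mul Gs mulmxA.
have -> : `|p| = B w q by rewrite BE -pE hq.
rewrite /conorm dE -sqrtrM// -[leLHS]ger0_norm; last by rewrite BE -pE hq.
rewrite -sqrtr_sqr ler_sqrt; last by rewrite mulr_ge0.
rewrite BC (le_trans (BCS _ _))// ler_wpM2r//.
rewrite BE (le_trans (ler_norm _))// (le_trans (pairing_le _ _))// /S0 ler_wpM2l//.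
rewrite (le_trans (ler_wpM2l (normr_ge0 _) q1))// mulr1 (le_trans (norm_mulmx _ _))//.
by rewrite ler_wpM2l// ler_piMl.
Qed.

Lemma compact_sphere (r : R) : compact [set q : 'rV[R]_n | `|q| = r].
Proof.
apply: (subclosed_compact _ (@compact_ball r 0)); last by move=> q /= <-; rewrite subr0.
have -> : [set q : 'rV[R]_n | `|q| = r] = (fun q : 'rV[R]_n => `|q|) @^-1` [set r] by [].
apply: closed_comp; last exact: closed_eq.
by move=> q _; exact: norm_continuous.
Qed.

(** Superlinearity is assumed point by point, without uniformity in [x]. At [y0] it makes the growth
    from [0] to the sphere of radius [r] exceed [K * r]; this persists nearby by compactness of the
    sphere, and [ray_convex] propagates it outwards. *)
Lemma coercive_chart c y0 (K : R) : img A c y0 -> 0 <= K -> exists C : R, \forall y \near y0,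
  forall q u, K * `|q| - C - lambda * `|u| <= Hc c y q u.
Proof.
move=> cy K0; pose x0 := cinv A c y0; pose B := chart_cotangent A c y0.
have [S S0 hS] := norm_conorm x0.
pose D := ('J (chart A x0 \o cinv A c) y0)^T.
have BD : B *m D = 1%:M by exact: chart_cotangentK.
pose L := n%:R * `|D| : R.
have L0 : 0 <= L by rewrite mulr_ge0.
have hq q : `|q| <= L * `|q *m B|.
  rewrite -{1}(mulmx1 q) -BD mulmxA (le_trans (norm_mulmx _ _))//.
  by rewrite /L -mulrA ler_wpM2l// mulrC.
have [C0 hC0] := H_superlinear x0 0 ((K + 1) * L * S).
pose Q y q := Hc c y q 0.
have QK q : (K + 1) * `|q| - C0 <= Q y0 q.
  rewrite /Q /Hc in_chartE; apply: le_trans (hC0 _); rewrite lerB// -mulrA -mulrA ler_wpM2l ?addr_ge0//.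
  by rewrite (le_trans (hq q))// ler_wpM2l.
(* At radius [r] the surplus of slope [K + 1] over slope [K] pays for [C0], for [Q y0 0] and for the
   two continuity errors of [4^-1] below. *)
pose r := Num.max 1 (2 * (C0 + Q y0 0) + 2).
have r1 : 1 <= r by rewrite /r le_max lexx.
have r2 : 2 * (C0 + Q y0 0) + 2 <= r by rewrite /r le_max lexx orbT.
have [C1 hC1] := bounded_chart r cy.
have sphere : \forall y \near y0, forall q, `|q| = r -> K * r <= Q y q - Q y 0.
  apply: (@compact_near_forall _ _ (nbhs y0) _ [set q | `|q| = r] (fun y q => K * r <= Q y q - Q y 0)).
    exact: compact_sphere.
  move=> q /= qr; have e2 : 0 < (4^-1 : R) by rewrite invr_gt0.
  have [[Q1 Q2] [/= hQ1 [[T1 T2] /= [hT1 hT2] hT]] hQ] := near_chart_cont q 0 cy e2.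
  have [[P1 P2] [/= hP1 [[U1 U2] /= [hU1 hU2] hU]] hP] := near_chart_cont 0 0 cy e2.
  exists (Q1, T1 `&` U1) => /=; first by split => //; exact: filterI.
  move=> [q' y] [/= h1 [h2 h3]].
  have := hQ (q', (y, 0)) (conj h1 (hT (y, 0) (conj h2 (nbhs_singleton hT2)))).
  have := hP (0, (y, 0)) (conj (nbhs_singleton hP1) (hU (y, 0) (conj h3 (nbhs_singleton hU2)))).
  have := QK q; rewrite qr /=.
  rewrite -/(Q y 0) -/(Q y q') -/(Q y0 0) -/(Q y0 q) !ltr_norml => h5 /andP[h6 h7] /andP[h8 h9].
  move: h5 h6 h7 h8 h9 r2; set a := Q y0 q; set b := Q y0 0; set a' := Q y q'; set b' := Q y 0; lra.
exists (C1 + K * r); near=> y => q u.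
have cy' : img A c y by near: y; exact: near_img.
have hs : forall q, `|q| = r -> K * r <= Q y q - Q y 0 by near: y.
have hb : forall q u, `|q| <= r -> `|Hc c y q u| <= C1 + lambda * `|u| by near: y.
have hb0 q1 : `|q1| <= r -> - C1 <= Q y q1.
  by move/(hb _ 0); rewrite normr0 mulr0 addr0 ler_norml => /andP[].
have r0 : 0 < r by exact: lt_le_trans r1.
suff h : K * `|q| - (C1 + K * r) <= Q y q.
  have := in_chart_lipschitz c y q u 0; rewrite subr0 ler_norml -/(Q y q) => /andP[h1 _].
  by rewrite /Q in h h1; lra.
have [qr|qr] := leP `|q| r.
  apply: le_trans (hb0 q qr); rewrite opprD addrCA gerDl subr_le0.
  exact: ler_wpM2l.
have q0 : 0 < `|q| := lt_trans r0 qr.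
pose w := (r / `|q|) *: q.
have w1 : `|w| = r by rewrite normrZ ger0_norm ?divr_ge0// ?(ltW r0)// divfK// gt_eqF.
have s1 : 1 <= `|q| / r by rewrite ler_pdivlMr// mul1r ltW.
have := ray_convex 0 w 0 cy' s1; rewrite !add0r scalerA.
have -> : `|q| / r * (r / `|q|) = 1 by field; rewrite !gt_eqF.
rewrite scale1r -/(Q y w) -/(Q y q) -/(Q y 0) => h1.
have h2 := hs w w1; have h3 := hb0 0; rewrite normr0 in h3; have {}h3 := h3 (ltW r0).
have h4 : `|q| / r * (K * r) <= `|q| / r * (Q y w - Q y 0).
  by rewrite ler_wpM2l// divr_ge0// ltW.
have e4 : `|q| / r * (K * r) = K * `|q| by field; rewrite gt_eqF.
have h5 : 0 <= K * r by rewrite mulr_ge0// ltW.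
rewrite e4 in h4; have {h4}h4 := le_trans h4 h1.
move: h3 h4 h5; set a := Q y 0; set b := Q y q; set e := K * _; set f := K * r.
move=> h5 h6 h7; rewrite lerBlDr (le_trans h6)// lerD2l (@le_trans _ _ C1)// 1?lerNl//.
by rewrite lerDl.
Unshelve. all: by end_near. Qed.

End Bounds.

(** * Curves and their action *)

(** Real induction: the supremum of the [t] with [P a t] satisfies [P] as well and cannot lie before
    [b]. This chains statements valid inside one chart along a curve that crosses many. *)
Lemma itv_local_global (R : realType) (P : R -> R -> Prop) (a b : R) : a <= b ->
  (forall r s t, a <= r -> r <= s -> s <= t -> t <= b -> P r s -> P s t -> P r t) ->
  (forall s, a <= s <= b -> exists2 e : R, 0 < e & forall s1 s2, a <= s1 -> s1 <= s2 -> s2 <= b ->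
    `|s1 - s| < e -> `|s2 - s| < e -> P s1 s2) ->
  P a b.
Proof.
move=> ab hcat hloc; pose S := [set t | a <= t <= b /\ P a t].
have Sa : S a.
  split; first by rewrite lexx ab.
  have [|e e0 he] := hloc a; first by rewrite lexx ab.
  by apply: he; rewrite ?subrr ?normr0.
have hS : has_sup S by split; [exists a|exists b => t [/andP[]]].
pose c := sup S.
have ac : a <= c by apply: ub_le_sup => //; case: hS.
have cb : c <= b by apply: ge_sup; [exists a|move=> t [/andP[]]].
have [|e e0 he] := hloc c; first by rewrite ac cb.
have [t [/andP[at_ tb] Pat] ct] := sup_adherent e0 hS.
have tc : t <= c by apply: ub_le_sup; [case: hS|split => //; rewrite at_ tb].
pose d := Num.min (c + e / 2) b.
have cd : c <= d by rewrite /d le_min cb andbT lerDl divr_ge0// ltW.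
have db : d <= b by rewrite /d ge_min lexx orbT.
have Pad : P a d.
  apply: hcat Pat _ => //; first exact: le_trans cd.
  apply: he => //; first exact: le_trans cd.
    by rewrite distrC ger0_norm ?subr_ge0// ltrBlDl -ltrBlDr.
  rewrite ger0_norm ?subr_ge0// /d ltrBlDl (@le_lt_trans _ _ (c + e / 2)) ?ge_min ?lexx//.
  by rewrite ltrD2l; lra.
have dc : d <= c by apply: ub_le_sup; [case: hS|split => //; rewrite db (le_trans ac)].
suff -> : b = d by [].
move: dc; rewrite /d; case: (leP (c + e / 2) b) => // h; by rewrite gerDl leNgt divr_gt0.
Qed.

(** Composition with it freezes a function outside [[a, b]], turning continuity within the interval
    into continuity on the line. *)
Definition clamp (R : realType) (a b s : R) : R := Num.max a (Num.min s b).

Section Clamp.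
Context {R : realType} (a b : R) (ab : a <= b).

Lemma clamp_itv s : a <= clamp a b s <= b.
Proof. by rewrite /clamp le_max lexx /= ge_max ab ge_min lexx orbT. Qed.

Lemma clamp_id s : a <= s <= b -> clamp a b s = s.
Proof. by move=> /andP[as_ sb]; rewrite /clamp (min_l sb) (max_r as_). Qed.

Lemma clamp_continuous : continuous (clamp a b).
Proof.
have H u v : u <= v -> `|clamp a b v - clamp a b u| <= v - u.
  move=> uv; rewrite ger0_norm ?subr_ge0; last by rewrite /clamp le_max2// le_min2.
  rewrite /clamp; case: (leP v b) => vb; case: (leP u b) => ub.
  - by case: (leP a v) => av; case: (leP a u) => au; lra.
  - lra.
  - by rewrite (max_r ab); case: (leP a u) => au; lra.
  - by rewrite subrr subr_ge0.
move=> s; apply/cvgrPdist_lt => e e0; near=> t; apply: (@le_lt_trans _ _ `|s - t|).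
  have [st|ts] := leP s t; last by rewrite (le_trans (H _ _ (ltW ts)))// ler_norm.
  by rewrite distrC (le_trans (H _ _ st))// distrC ler_norm.
by near: t; exact: (@cvgr_dist_lt _ _ _ (nbhs s) _ id s cvg_id).
Unshelve. all: by end_near. Qed.

Lemma within_continuous_clamp (T : topologicalType) (f : R -> T) :
  {within `[a, b], continuous f} -> continuous (f \o clamp a b).
Proof.
move=> cf s P hP.
have h : `[a, b]%classic (clamp a b s) by rewrite /= in_itv /= clamp_itv.
have := cf (clamp a b s) P hP; rewrite nbhs_simpl/= /nbhs/= -nbhs_subspace_in//.
rewrite /within /= => hP'.
have h1 : \forall r \near s, clamp a b r \in `[a, b] -> P (f (clamp a b r)) := clamp_continuous hP'.
change (\forall r \near s, P (f (clamp a b r))); move: h1; apply: filterS => r; apply.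
by rewrite in_itv /= clamp_itv.
Qed.

Lemma clamp_within_continuous (T : topologicalType) (f : R -> T) :
  continuous (f \o clamp a b) -> {within `[a, b], continuous f}.
Proof.
move=> cf; apply: (@subspace_eq_continuous _ _ _ (f \o clamp a b)).
  by move=> s; rewrite inE /= in_itv/= => /clamp_id ->.
exact: continuous_subspaceT.
Qed.

Lemma within_continuous_interior (T : topologicalType) (f : R -> T) (s : R) :
  {within `[a, b], continuous f} -> a < s < b -> {for s, continuous f}.
Proof.
move=> cf /andP[as_ sb].
have e : \forall r \near s, (f \o clamp a b) r = f r.
  near=> r; rewrite /= clamp_id//; apply/andP; split; apply: ltW; near: r.
    exact: lt_nbhsr.
  exact: lt_nbhsl.
have h : (f \o clamp a b) r @[r --> s] --> f s.
  have := @within_continuous_clamp T f cf s.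
  by rewrite /continuous_at /= clamp_id// (ltW as_) (ltW sb).
by apply: cvg_trans h; apply: near_eq_cvg; move: e; apply: filterS => r /= ->.
Unshelve. all: by end_near. Qed.

End Clamp.

Section Curves.
Context {R : realType} {n : nat} {M : topologicalType} (A : atlas R n M).
Implicit Types (gamma : R -> M) (a b s t : R).

Lemma ac_curve_sub a b a' b' gamma : a <= a' -> b' <= b -> ac_curve A a b gamma ->
  ac_curve A a' b' gamma.
Proof.
move=> aa bb [cg hg]; split.
  apply: continuous_subspaceW cg => s; rewrite /= !in_itv/= => /andP[as_ sb].
  by rewrite (le_trans aa as_) (le_trans sb bb).
by move=> c s t as_ tb; apply: hg; [exact: le_trans as_|exact: le_trans bb].
Qed.

Definition curve_cat b gamma1 gamma2 s : M := if s <= b then gamma1 s else gamma2 s.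

Lemma abs_continuous_cat (f : R -> 'rV[R]_n) a b c :
  abs_continuous a b f -> abs_continuous b c f -> a <= b -> b <= c -> abs_continuous a c f.
Proof.
move=> h1 h2 ab bc e e0; have e2 : 0 < e / 2 by rewrite divr_gt0.
have [d1 d10 hd1] := h1 _ e2; have [d2 d20 hd2] := h2 _ e2.
exists (Num.min d1 d2); first by rewrite lt_min d10.
move=> m s t hst hd hl.
have hl1 : \sum_i (Num.min (t i) b - Num.min (s i) b) <= \sum_i (t i - s i).
  apply: ler_sum => i _; have [_ st _] := hst i.
  by case: (leP (t i) b); case: (leP (s i) b) => *; lra.
have hl2 : \sum_i (Num.max (t i) b - Num.max (s i) b) <= \sum_i (t i - s i).
  apply: ler_sum => i _; have [_ st _] := hst i.
  by case: (leP (t i) b); case: (leP (s i) b) => *; lra.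
move: hl; rewrite lt_min => /andP[l1 l2].
have H1 : \sum_i `|f (Num.min (t i) b) - f (Num.min (s i) b)| < e / 2.
  apply: hd1 (le_lt_trans hl1 l1) => [i|i j ij].
    have [as_ st tc] := hst i; split; [by rewrite le_min as_ ab|exact: le_min2|].
    by rewrite ge_min lexx orbT.
  by case: (hd i j ij) => h; [left|right]; rewrite le_min2.
have H2 : \sum_i `|f (Num.max (t i) b) - f (Num.max (s i) b)| < e / 2.
  apply: hd2 (le_lt_trans hl2 l2) => [i|i j ij].
    have [as_ st tc] := hst i; split; [by rewrite le_max lexx orbT|exact: le_max2|].
    by rewrite ge_max tc bc.
  by case: (hd i j ij) => h; [left|right]; rewrite le_max2.
rewrite (splitr e) (le_lt_trans _ (ltrD H1 H2))// -big_split/=.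
apply: ler_sum => i _; have [_ st _] := hst i.
have [tb|bt] := leP (t i) b; first by rewrite (min_l (le_trans st tb)) lerDl.
have [sb|bs] := leP (s i) b; last by rewrite subrr normr0 add0r.
by rewrite addrC (le_trans _ (ler_normD _ _))// addrA subrK.
Qed.

Lemma abs_continuous_eq (f g : R -> 'rV[R]_n) a b : (forall s, a <= s <= b -> f s = g s) ->
  abs_continuous a b f -> abs_continuous a b g.
Proof.
move=> fg h e e0; have [d d0 hd] := h e e0; exists d => // m s t hst hdis hl.
rewrite (eq_bigr (fun i => `|f (t i) - f (s i)|)); first exact: hd.
move=> i _; have [as_ st tb] := hst i.
by rewrite -!fg// ?as_ ?(le_trans st tb)// ?tb (le_trans as_ st).
Qed.

(** Absolute continuity is tested on each subinterval that stays in a chart domain; only one that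
    straddles [b] requires gluing estimates. *)
Lemma ac_curve_cat a b c gamma1 gamma2 : a <= b -> b <= c -> gamma1 b = gamma2 b ->
  ac_curve A a b gamma1 -> ac_curve A b c gamma2 -> ac_curve A a c (curve_cat b gamma1 gamma2).
Proof.
move=> ab bc gb [c1 h1] [c2 h2].
set gamma := curve_cat b gamma1 gamma2.
have e1 s : s <= b -> gamma s = gamma1 s by rewrite /gamma /curve_cat => ->.
have e2 s : b <= s -> gamma s = gamma2 s.
  rewrite le_eqVlt /gamma /curve_cat => /predU1P[<-|h]; first by rewrite lexx.
  by rewrite leNgt h.
split.
  have -> : `[a, c]%classic = `[a, b]%classic `|` `[b, c]%classic.
    apply/seteqP; split => s /=; rewrite !in_itv/=.
      by move=> /andP[as_ sc]; case: (leP s b) => h; [left|right]; rewrite ?as_ ?sc ?(ltW h).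
    by move=> [/andP[-> h]|/andP[h ->]]; rewrite ?(le_trans h bc) ?(le_trans ab h).
  apply: withinU_continuous; try exact: interval_closed.
    apply: (@subspace_eq_continuous _ _ _ gamma1) => //.
    by move=> s; rewrite inE/= in_itv/= => /andP[_ /e1].
  apply: (@subspace_eq_continuous _ _ _ gamma2) => //.
  by move=> s; rewrite inE/= in_itv/= => /andP[/e2].
move=> d s t as_ tc hd.
have [tb|bt] := leP t b.
  apply: (@abs_continuous_eq (chart A d \o gamma1)).
    by move=> r /andP[_ rt] /=; rewrite e1// (le_trans rt).
  by apply: h1 => // r /andP[sr rt]; rewrite -(e1 _ (le_trans rt tb)); apply: hd; rewrite sr.
have [bs|sb] := leP b s.
  apply: (@abs_continuous_eq (chart A d \o gamma2)).
    by move=> r /andP[sr _] /=; rewrite e2// (le_trans bs).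
  by apply: h2 => // r /andP[sr rt]; rewrite -(e2 _ (le_trans bs sr)); apply: hd; rewrite sr.
apply: (@abs_continuous_cat _ s b t); rewrite ?(ltW sb) ?(ltW bt)//.
  apply: (@abs_continuous_eq (chart A d \o gamma1)).
    by move=> r /andP[_ rt] /=; rewrite e1.
  by apply: h1 => // r /andP[sr rt]; rewrite -(e1 _ rt); apply: hd; rewrite sr (le_trans rt)// ltW.
apply: (@abs_continuous_eq (chart A d \o gamma2)).
  by move=> r /andP[sr _] /=; rewrite e2.
by apply: h2 => // r /andP[sr rt]; rewrite -(e2 _ sr); apply: hd; rewrite rt andbT (le_trans _ sr)// ltW.
Qed.

Lemma ac_curve_shift a b gamma (h : R) : a <= b -> ac_curve A (a + h) (b + h) gamma ->
  ac_curve A a b (fun s => gamma (s + h)).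
Proof.
move=> ab [cg hg]; split.
  apply: clamp_within_continuous => //.
  have abh : a + h <= b + h by rewrite lerD2r.
  have -> : (fun s => gamma (s + h)) \o clamp a b = (gamma \o clamp (a + h) (b + h)) \o (fun s => s + h).
    by apply/funext => s; rewrite /= /clamp addr_maxl addr_minl.
  move=> s; apply: continuous_comp; last exact: within_continuous_clamp.
  by apply: cvgD; [exact: cvg_id|exact: cvg_cst].
move=> c s t as_ tb hd.
have := hg c (s + h) (t + h); rewrite !lerD2r => /(_ as_ tb) H e e0.
have [|d d0 hdd] := H _ e e0.
  move=> r /andP[sr rt]; rewrite -[r](subrK h); apply: hd.
  by rewrite lerBrDr sr lerBlDr.
exists d => // m s' t' h1 h2 h3.
apply: (hdd m (fun i => s' i + h) (fun i => t' i + h)).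
- by move=> i; rewrite !lerD2r.
- by move=> i j ij; rewrite !lerD2r; exact: h2.
- by under eq_bigr do rewrite opprD addrACA subrr addr0.
Qed.

Lemma ac_curve_chart c a b gamma : a < b -> ac_curve A a b gamma ->
  (forall s, a <= s <= b -> dom A c (gamma s)) ->
  exists Y : R -> 'rV[R]_n,
    (forall j, (@lebesgue_measure R).-integrable setT (EFin \o (fun s => Y s 0 j))) /\
    {ae (@lebesgue_measure R), forall s, a < s < b -> is_derive s 1 (chart A c \o gamma) (Y s)}.
Proof.
move=> ab [cg hg] hd; have acy := hg c a b (lexx _) (lexx _) hd.
have hj j : exists Yj : R -> R, (@lebesgue_measure R).-integrable setT (EFin \o Yj) /\
    {ae (@lebesgue_measure R), forall s, a < s < b -> is_derive s 1 (fun t => (chart A c (gamma t)) 0 j) (Yj s)}.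
  have acj : ac_fun a b (fun t => (chart A c (gamma t)) 0 j).
    apply: (abs_continuous_ac_fun (K := 1) acy) => s t _ _; rewrite mul1r /=.
    by have := coord_norm_le (chart A c (gamma t) - chart A c (gamma s)) j; rewrite !mxE.
  by have [Yj [h1 _ h3]] := ac_fun_FTC ab acj; exists Yj.
have [Y hY] := choice hj.
exists (fun s => \row_j Y j s); split.
  move=> j; have [+ _] := hY j; congr (_.-integrable _ _).
  by apply/funext => s /=; rewrite mxE.
have : {ae (@lebesgue_measure R), forall s, forall j, a < s < b ->
    is_derive s 1 (fun t => (chart A c (gamma t)) 0 j) (Y j s)}.
  apply: (@filter_forall _ 'I_n (fun j s => a < s < b ->
    is_derive s 1 (fun t => (chart A c (gamma t)) 0 j) (Y j s)) _
    (ae_filter_ringOfSetsType (@lebesgue_measure R))) => j.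
  by have [] := hY j.
move=> h; apply: (ae_imp h) => s hs sab; apply: is_derive_row => j.
by rewrite mxE; exact: hs.
Qed.

End Curves.

Section IntegralExtra.
Context {R : realType}.
Implicit Types (l : R -> \bar R) (a b A m : R).

Lemma has_integral_ext l l' a b A : {ae (@lebesgue_measure R), forall s, a < s < b -> l s = l' s} ->
  has_integral l a b A -> has_integral l' a b A.
Proof.
move=> e [f [fi fl ->]]; exists f; split => //.
by apply: (ae_imp2 e fl) => s h1 h2 sab; rewrite -h1// h2.
Qed.

Lemma has_integral0 a b : has_integral (fun=> 0%E) a b (0 : R).
Proof.
exists (fun=> 0); split; last 1 first.
- by rewrite /Rintegral integral0.
- exact: integrable0.
- by apply: aeW.
Qed.

Lemma has_integral_le_cst l a b A m : a <= b -> has_integral l a b A ->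
  {ae (@lebesgue_measure R), forall s, a < s < b -> (l s <= m%:E)%E} -> A <= m * (b - a).
Proof.
move=> ab hl h.
rewrite -[leRHS]add0r mulrBr.
apply: (@has_integral_le R l (fun=> 0%E) (fun s => m * s) (fun=> m) a b A 0 ab) => //.
- move=> s; have := is_deriveZ m (is_derive_id s (1 : R^o)).
  by rewrite /GRing.scale/= mulr1.
- by move=> s; exact: cvg_cst.
- exact: has_integral0.
- by apply: (ae_imp h) => s hs sab; rewrite add0e hs.
Qed.

End IntegralExtra.

Section CompactBound.
Context {R : realType}.

Lemma compact_bound_on (X : topologicalType) (K : set X) (S : X -> R -> Prop) : compact K ->
  (forall x C C', S x C -> C <= C' -> S x C') ->
  (forall x0, K x0 -> exists C, \forall x \near x0, S x C) -> exists C, forall x, K x -> S x C.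
Proof.
move=> cK mono loc.
have h : (pinfty_nbhs R) [set C | forall x, K x -> S x C].
  have FF : Filter (pinfty_nbhs R) by apply: filter_filter.
  refine (@compact_near_forall X R (pinfty_nbhs R) FF K (fun C x => S x C) cK _) => x Kx.
  have [C hC] := loc x Kx; exists ([set x' | S x' C], [set C' | C <= C']).
    by split => //=; exists C; split => [|r /ltW//]; exact: num_real.
  by move=> [x' C'] [/= h1 h2]; exact: mono h1 h2.
have [C hC] := filter_ex h; exists C => x; exact: hC.
Qed.

Lemma compact_bound (M : topologicalType) (S : M -> R -> Prop) : compact [set: M] ->
  (forall x C C', S x C -> C <= C' -> S x C') ->
  (forall x0 : M, exists C, \forall x \near x0, S x C) -> exists C, forall x, S x C.
Proof.
move=> cM mono loc; have [C hC] := compact_bound_on cM mono (fun x _ => loc x).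
by exists C => x; exact: hC.
Qed.

End CompactBound.

Section Action.
Context {R : realType} {n : nat} {M : topologicalType} (A : atlas R n M).
Variables (g : riemannian_metric A) (M_compact : compact [set: M]).
Variables (H : cotangent A * R -> R) (lambda : R).
Hypotheses (H_C3 : Ck_cotangent 3 H)
  (H_convex : forall x p u, posdef (hessian (fun q => H (x, q, u)) p))
  (H_superlinear : forall x (u a : R), exists C : R, forall p, a * conorm g x p - C <= H (x, p, u))
  (H_lipschitz : forall x p u, `| derive1 (fun s : R => H (x, p, s)) u | <= lambda).
Implicit Types (gamma : R -> M) (w : R -> M -> R) (a b s t L : R).

Definition running_cost w gamma s : \bar R :=
  lagrangian H (gamma s) (velocity A gamma s) (w s (gamma s)).

(** A relation with a real value [L] instead of an extended-real function: pieces can be split,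
    glued, shifted and compared by ordinary arithmetic. *)
Definition has_action w gamma a b L :=
  [/\ a <= b, ac_curve A a b gamma & has_integral (running_cost w gamma) a b L].

(* The value of [w] at negative times is irrelevant. *)
Definition time_continuous w := continuous (fun z : M * R => w (Num.max 0 z.2) z.1).

Lemma time_continuous_curve w gamma a b : 0 <= a -> a <= b -> time_continuous w ->
  {within `[a, b], continuous gamma} ->
  continuous (fun s => w (clamp a b s) (gamma (clamp a b s))).
Proof.
move=> a0 ab cw cg s.
have -> : (fun s => w (clamp a b s) (gamma (clamp a b s))) =
    (fun z : M * R => w (Num.max 0 z.2) z.1) \o (fun s => (gamma (clamp a b s), clamp a b s)).
  apply/funext => r /=; rewrite max_r//.
  by have /andP[h _] := clamp_itv ab r; exact: le_trans h.
apply: continuous_comp; last exact: cw.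
apply: (@cvg_pair _ _ _ _ (nbhs (gamma (clamp a b s))) (nbhs (clamp a b s))).
  exact: (within_continuous_clamp ab cg).
exact: clamp_continuous.
Qed.

(** Testing the Lagrangian with the zero covector turns this into a lower bound for running costs
    that does not depend on the velocity. *)
Lemma hamiltonian_zero_bound : exists C0 : R, forall x u, H (x, 0, u) <= C0 + lambda * `|u|.
Proof.
suff [C hC] : exists C, forall x, forall u, H (x, 0, u) <= C + lambda * `|u| by exists C.
apply: (@compact_bound R M (fun x C => forall u, H (x, 0, u) <= C + lambda * `|u|) M_compact).
  by move=> x C C' h CC u; rewrite (le_trans (h u))// lerD2r.
move=> x0; have cx0 := dom_center A x0.
have [C hC] := bounded_chart H_C3 H_lipschitz 0 (img_chart cx0).
exists C; have := near_chart cx0 hC; have := near_dom cx0; apply: filterS2 => x dx h u.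
have := h 0 u; rewrite normr0 lexx => /(_ isT); rewrite in_chartE mul0mx chartK//.
by apply: le_trans; exact: ler_norm.
Qed.

Lemma lagrangian_lower x v u : ((- H (x, 0%R, u))%:E <= lagrangian H x v u)%E.
Proof.
by apply: ereal_sup_ubound; exists 0 => //; rewrite pairing0r sub0r.
Qed.

Lemma lagrangian_lipschitz x v u u' : (lagrangian H x v u <= lagrangian H x v u' + (lambda * `|u - u'|)%:E)%E.
Proof.
apply: ge_ereal_sup => _ [p _ <-].
apply: (@le_trans _ _ ((pairing v p - H (x, p, u'))%:E + (lambda * `|u - u'|)%:E)%E).
  rewrite -EFinD lee_fin; have := hamiltonian_lipschitz H_C3 H_lipschitz x p u u'.
  by rewrite ler_norml => /andP[h _]; lra.
by apply: leeD => //; apply: ereal_sup_ubound; exists p.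
Qed.

Lemma running_cost_lower w gamma a b : 0 <= a -> a <= b -> time_continuous w ->
  ac_curve A a b gamma -> exists C, forall s, a <= s <= b -> ((- C)%:E <= running_cost w gamma s)%E.
Proof.
move=> a0 ab cw [cg _]; have [C0 hC0] := hamiltonian_zero_bound.
have cwg := time_continuous_curve a0 ab cw cg.
have [|c _ hc] := @EVT_max R (fun s => `|w (clamp a b s) (gamma (clamp a b s))|) a b ab.
  apply: continuous_subspaceT => s; apply: continuous_comp; first exact: cwg.
  exact: norm_continuous.
exists (C0 + lambda * `|w (clamp a b c) (gamma (clamp a b c))|) => s sab.
apply: le_trans (lagrangian_lower _ _ _); rewrite lee_fin lerN2 (le_trans (hC0 _ _))// lerD2l.
rewrite ler_wpM2l//; first exact: lambda_ge0 H_lipschitz (gamma s).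
by have := hc s; rewrite in_itv/= sab clamp_id// => /(_ isT).
Qed.

(** By continuity in the covector, the supremum defining the Lagrangian may be taken over rational
    covectors, and a countable supremum of measurable functions is measurable. *)
Lemma measurable_running_cost_chart c w gamma a b : 0 <= a -> a < b -> time_continuous w ->
  ac_curve A a b gamma -> (forall s, a <= s <= b -> dom A c (gamma s)) ->
  measurable_version (running_cost w gamma) a b.
Proof.
move=> a0 ab cw acg hd; have [Y [Yi Yd]] := ac_curve_chart ab acg hd.
have lab := ltW ab; have [cg _] := acg.
pose y s := chart A c (gamma (clamp a b s)).
pose u s := w (clamp a b s) (gamma (clamp a b s)).
have hdc s : dom A c (gamma (clamp a b s)) by apply: hd; exact: clamp_itv.
(* An enumeration of the rational covectors; a code that decodes to nothing yields the covector [0],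
   which is harmless in the supremum. *)
pose q (k : nat) : 'rV[R]_n := if (unpickle k : option 'rV[rat]_n) is Some r then map_mx ratr r else 0.
pose f k (s : measurableTypeR R) : R := pairing (Y s) (q k) - in_chart H c (y s) (q k) (u s).
have cy : continuous y.
  move=> s; apply: (@continuous_comp _ _ _ (gamma \o clamp a b) (chart A c)).
    exact: (within_continuous_clamp lab cg).
  by apply: chart_continuous; apply: hdc.
have cu : continuous u := time_continuous_curve a0 lab cw cg.
have iy s : img A c (y s) by exact: img_chart.
have mf k : measurable_fun [set: measurableTypeR R] (f k).
  apply: measurable_funB.
    rewrite (_ : (fun s => _) = (fun s => \sum_j (q k 0 j * Y s 0 j))).
      apply: measurable_sum => j; apply: measurable_funM; first exact: measurable_cst.
      by have /measurable_int/measurable_EFinP := Yi j.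
    by apply/funext => s; rewrite pairingE; apply: eq_bigr => j _; rewrite mulrC.
  apply: (@continuous_measurable_fun R) => s.
  apply/cvgrPdist_lt => e e0.
  have [[S1 S2] [/= h1 h2] h'] := near_chart_cont H_C3 (q k) (u s) (iy s) e0.
  have [[T1 T2] [/= t1 t2] ht] := h2.
  have h3 : \forall t \near s, T1 (y t) by exact: cy t1.
  have h4 : \forall t \near s, T2 (u t) by exact: cu t2.
  apply: filterS2 h3 h4 => t y1 y2; apply: (h' (q k, (y t, u t))); split => /=.
    exact: nbhs_singleton h1.
  by apply: ht.
exists (fun s => ereal_sup [set (f k s)%:E | k in [set: nat]]).
  rewrite (_ : (fun s => _) = (fun s => esups (fun k => (f k s)%:E) 0%N)).
    by apply: measurable_fun_esups => k; apply/measurable_EFinP; exact: mf.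
  apply/funext => s; rewrite /esups /sdrop; congr ereal_sup.
  by apply/seteqP; split => _ [k _ <-]; exists k.
apply: (ae_imp Yd) => s dY sab.
have sab' : a <= s <= b by case/andP : sab => *; rewrite !ltW.
have cs := hd s sab'.
have -> : running_cost w gamma s =
    ereal_sup [set (pairing (Y s) p - in_chart H c (y s) p (u s))%:E | p in [set: 'rV[R]_n]].
  rewrite /running_cost (velocity_chart _ cs (dY sab)).
    have := lagrangian_chart H (Y s) (w s (gamma s)) (img_chart cs).
    by rewrite chartK// /y /u clamp_id.
  exact: within_continuous_interior cg sab.
apply/eqP; rewrite eq_le; apply/andP; split; last first.
  by apply: ge_ereal_sup => _ [k _ <-]; apply: ereal_sup_ubound; exists (q k).
apply: ge_ereal_sup => _ [p _ <-]; apply/lee_addgt0Pr => e e0.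
have e20 : 0 < e / 2 by rewrite divr_gt0.
have /nbhs_ballP[r /= r0 hr] : \forall q' \near p, `|in_chart H c (y s) p (u s) - in_chart H c (y s) q' (u s)| < e / 2.
  have := near_chart_cont H_C3 p (u s) (iy s) e20.
  move=> [[S1 S2] [/= h1 h2] h']; apply: filterS h1 => q' hq'.
  by apply: (h' (q', (y s, u s))); split => //; exact: nbhs_singleton h2.
have [r1 r10 hr1] : exists2 r1 : R, 0 < r1 & forall z : 'rV[R]_n, `|z| <= r1 -> pairing (Y s) z <= e / 2.
  have h0 : 0 <= n%:R * `|Y s| by rewrite mulr_ge0.
  exists (e / 2 / (1 + n%:R * `|Y s|)); first by rewrite divr_gt0// ltr_pwDl.
  move=> z hz; apply: le_trans (ler_norm _) _; apply: le_trans (pairing_le _ _) _.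
  rewrite mulrA; apply: (@le_trans _ _ ((1 + n%:R * `|Y s|) * `|z|)).
    by rewrite ler_wpM2r// lerDr.
  by rewrite mulrC -ler_pdivlMr// ltr_pwDl.
have rr0 : 0 < Num.min r r1 by rewrite lt_min r0.
have /choice[z hz] : forall j, exists z : rat, ratr z \in `](p 0 j - Num.min r r1), (p 0 j + Num.min r r1)[.
  by move=> j; apply: rat_in_itvoo; rewrite ltrBlDr -addrA ltrDl addr_gt0.
pose k := pickle (\row_j z j).
have qk : q k = \row_j ratr (z j) by rewrite /q /k pickleK; apply/rowP => j; rewrite !mxE.
have hj j : `|p 0 j - q k 0 j| < Num.min r r1.
  by have := hz j; rewrite qk mxE in_itv/= ltr_distlC.
apply: (@le_trans _ _ ((f k s)%:E + e%:E)%E); last first.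
  by rewrite leeD2r//; apply: ereal_sup_ubound; exists k.
rewrite -EFinD lee_fin /f.
have h1 : `|in_chart H c (y s) p (u s) - in_chart H c (y s) (q k) (u s)| < e / 2.
  apply: hr; split => // i j; rewrite ord1; apply: lt_le_trans (hj j) _.
  by rewrite ge_min lexx.
have h2 : pairing (Y s) (p - q k) <= e / 2.
  apply: hr1; rewrite -[leLHS]/(mx_norm _) mx_normrE.
  elim/big_ind: _ => [|a1 a2 h1' h2'|[i j] _ /=]; first exact: ltW.
    by rewrite ge_max h1'.
  rewrite ord1 !mxE ltW//; have := hj j; rewrite lt_min => /andP[_].
  by rewrite qk !mxE.
rewrite pairingBr in h2; move: h1; rewrite ltr_norml => /andP[h1 _].
set X1 := pairing _ p in h2 *; set X2 := pairing _ (q k) in h2 *.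
set X3 := in_chart _ _ _ p _ in h1 *; set X4 := in_chart _ _ _ (q k) _ in h1 *.
lra.
Qed.

Lemma near_within_continuous (P : set M) gamma a b s : a <= b -> {within `[a, b], continuous gamma} ->
  a <= s <= b -> (\forall x \near gamma s, P x) ->
  exists2 e : R, 0 < e & forall t, a <= t <= b -> `|t - s| < e -> P (gamma t).
Proof.
move=> ab cg sab Ps.
have cc := within_continuous_clamp ab cg.
have /nbhs_ballP[e /= e0 he] : \forall t \near s, P (gamma (clamp a b t)).
  by apply: (cc s); rewrite /= clamp_id.
exists e => // t tab ts; have := he t; rewrite clamp_id//; apply.
by rewrite /ball/= distrC.
Qed.

Lemma measurable_running_cost w gamma a b : 0 <= a -> a <= b -> time_continuous w ->
  ac_curve A a b gamma -> measurable_version (running_cost w gamma) a b.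
Proof.
move=> a0 ab cw acg; have [cg _] := acg.
apply: (@itv_local_global R (measurable_version (running_cost w gamma))) => //.
  by move=> r s t *; apply: (@measurable_version_cat R _ r s t).
move=> s sab.
have [e e0 he] := near_within_continuous ab cg sab (near_dom (dom_center A (gamma s))).
exists e => // s1 s2 as1 s12 s2b d1 d2.
have [->|s1s2] := eqVneq s1 s2.
  exists (fun=> 0%E); first exact: measurable_cst.
  by apply: aeW => r; rewrite lt_asym.
apply: (@measurable_running_cost_chart (gamma s)) => //.
- exact: le_trans as1.
- by rewrite lt_neqAle s1s2.
- exact: ac_curve_sub acg.
move=> r /andP[r1 r2]; apply: he; first by rewrite (le_trans as1 r1) (le_trans r2 s2b).
move: d1 d2; rewrite !ltr_norml => /andP[d1 _] /andP[_ d2].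
by rewrite (lt_le_trans d1) ?lerD2r// (le_lt_trans _ d2)// lerD2r.
Qed.

Lemma velocity_eq gamma1 gamma2 s : (\forall t \near s, gamma1 t = gamma2 t) ->
  velocity A gamma1 s = velocity A gamma2 s.
Proof.
move=> h; rewrite /velocity (nbhs_singleton h) !derive1E; apply: near_eq_derive.
by apply: filterS h => t /= ->.
Qed.

Lemma running_cost_eq w gamma1 gamma2 a b s : (forall t, a < t < b -> gamma1 t = gamma2 t) ->
  a < s < b -> running_cost w gamma1 s = running_cost w gamma2 s.
Proof.
move=> h sab; have /andP[s1 s2] := sab; have e := h s sab.
suff v : velocity A gamma1 s = velocity A gamma2 s by rewrite /running_cost v e.
apply: velocity_eq; near=> t; apply: h; apply/andP; split; near: t.
  exact: lt_nbhsr.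
exact: lt_nbhsl.
Unshelve. all: by end_near. Qed.

Lemma has_action_le w gamma a b L : has_action w gamma a b L -> a <= b. Proof. by case. Qed.

Lemma has_action_split w gamma a b c L : a <= b -> b <= c -> has_action w gamma a c L ->
  exists L1 L2, [/\ has_action w gamma a b L1, has_action w gamma b c L2 & L = L1 + L2].
Proof.
move=> ab bc [ac cg hi]; have [L1 [L2 [h1 h2 ->]]] := has_integral_split ab bc hi.
by exists L1, L2; split=> //; split => //; exact: ac_curve_sub cg.
Qed.

Lemma has_action_cat w gamma1 gamma2 a b c L1 L2 : gamma1 b = gamma2 b ->
  has_action w gamma1 a b L1 -> has_action w gamma2 b c L2 ->
  has_action w (curve_cat b gamma1 gamma2) a c (L1 + L2).
Proof.
move=> e [ab c1 i1] [bc c2 i2]; split; [exact: le_trans bc|exact: ac_curve_cat|].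
apply: (has_integral_cat ab bc).
  apply: has_integral_ext i1; apply: aeW => s sab; apply: running_cost_eq sab => t /andP[_ tb].
  by rewrite /curve_cat ltW.
apply: has_integral_ext i2; apply: aeW => s sab; apply: running_cost_eq sab => t /andP[bt _].
by rewrite /curve_cat leNgt bt.
Qed.

Lemma running_cost_shift w gamma h s :
  running_cost (fun t => w (t + h)) (fun t => gamma (t + h)) s = running_cost w gamma (s + h).
Proof.
suff v : velocity A (fun t => gamma (t + h)) s = velocity A gamma (s + h) by rewrite /running_cost v.
rewrite /velocity /derive1.
have -> : (fun r : R => r^-1 *: ((chart A (gamma (s + h)) \o (fun t => gamma (t + h))) (r + s) -
    (chart A (gamma (s + h)) \o (fun t => gamma (t + h))) s)) =
  (fun r : R => r^-1 *: ((chart A (gamma (s + h)) \o gamma) (r + (s + h)) -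
    (chart A (gamma (s + h)) \o gamma) (s + h))) by apply/funext => r /=; rewrite addrA.
by [].
Qed.

Lemma has_action_shift w gamma a b L h : a <= b -> has_action w gamma (a + h) (b + h) L ->
  has_action (fun t => w (t + h)) (fun t => gamma (t + h)) a b L.
Proof.
move=> ab [_ cg hi]; split => //; first exact: ac_curve_shift.
apply: has_integral_ext (has_integral_shift hi); apply: aeW => s _.
by rewrite running_cost_shift.
Qed.

Lemma integrable_bounded_itv (C a b : R) : (@lebesgue_measure R).-integrable setT
  (EFin \o (fun s => C * \1_(`[a, b]%classic : set (measurableTypeR R)) s)).
Proof.
have -> : EFin \o (fun s => C * \1_(`[a, b]%classic : set (measurableTypeR R)) s) =
    (fun s => (C%:E * (\1_(`[a, b]%classic : set (measurableTypeR R)) s)%:E)%E).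
  by apply/funext => s /=; rewrite EFinM.
by apply: integrableZl => //; exact: integrable_indic_itv a b true false.
Qed.

(** The Lagrangian inherits the Lipschitz constant [lambda] in [u]. The new cost lies between the
    bound from the zero covector and the old cost plus [lambda * k], which makes it integrable. *)
Lemma has_action_change w w' gamma K k a b L : 0 <= a -> time_continuous w -> time_continuous w' ->
  has_action w gamma a b L -> (forall s : R, is_derive s 1 K (k s)) -> continuous k ->
  (forall s, a <= s <= b -> `|w' s (gamma s) - w s (gamma s)| <= k s) ->
  exists2 L', has_action w' gamma a b L' & L' <= L + lambda * (K b - K a).
Proof.
move=> a0 cw cw' [ab cg hi] dK ck hk.
have l0 : 0 <= lambda := lambda_ge0 H_lipschitz (gamma a).
have up s : a < s < b -> (running_cost w' gamma s <= running_cost w gamma s + (lambda * k s)%:E)%E.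
  move=> /andP[/ltW s1 /ltW s2]; apply: le_trans (lagrangian_lipschitz _ _ _ (w s (gamma s))) _.
  by rewrite leeD2l// lee_fin ler_wpM2l// hk// s1.
have [C hC] := running_cost_lower a0 ab cw' cg.
have [|m _ hm] := @EVT_max R k a b ab; first by apply: continuous_subspaceT.
have [f [fi fl LE]] := hi.
have [|||L' hL'] := @measurable_version_dominated R (running_cost w' gamma) a b
  (fun s => `|f s| + (lambda * k m + `|C|) * \1_(`[a, b]%classic : set (measurableTypeR R)) s).
- exact: measurable_running_cost.
- rewrite (_ : _ \o _ = (EFin \o (fun s => `|f s|)) \+ (EFin \o
    (fun s => (lambda * k m + `|C|) * \1_(`[a, b]%classic : set (measurableTypeR R)) s))).
    apply: integrableD => //; last exact: integrable_bounded_itv.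
    exact: integrable_norm.
  by apply/funext => s.
- apply: (ae_imp fl) => s fs sab; have := up s sab; rewrite (fs sab) => u1.
  have sab' : a <= s <= b by case/andP : sab => *; rewrite !ltW.
  have := hC s sab' => h1; have km := hm s; rewrite in_itv/= sab' in km.
  have {}km := km isT.
  have -> : \1_(`[a, b]%classic : set (measurableTypeR R)) s = 1 :> R.
    by rewrite indicE mem_set//= in_itv/= sab'.
  have lk : lambda * k s <= lambda * k m by rewrite ler_wpM2l.
  have lkm : 0 <= lambda * k m.
    by apply: le_trans lk; rewrite mulr_ge0// (le_trans _ (hk s sab')).
  case: (running_cost w' gamma s) h1 u1 => [r||]//=; rewrite -?EFinD !lee_fin => h1 u1.
  rewrite mulr1 ler_norml.
  have f1 := ler_norm (f s); have f2 := ler_norm (- f s); rewrite normrN in f2.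
  have C1 := ler_norm C; have C2 := ler_norm (- C); rewrite normrN in C2.
  have C3 : 0 <= `|f s| by []. have C4 : 0 <= `|C| by [].
  set X := `|f s| in f1 f2 C3 *; set Z := `|C| in C1 C2 C4 *.
  by apply/andP; split; lra.
exists L' => //; rewrite mulrBr.
apply: (has_integral_le ab (K := fun s => lambda * K s) (k := fun s => lambda * k s) _ _ hL' hi).
- by move=> s; apply: cvgM; [exact: cvg_cst|exact: ck].
- by apply: aeW.
Qed.

(** The running cost is bounded below on [[0, t]], so an integral other than [+oo] is finite. *)
Lemma action_dichotomy w phi gamma t : 0 <= t -> time_continuous w -> ac_curve A 0 t gamma ->
  action H w phi t gamma = +oo%E \/
  exists2 L, has_action w gamma 0 t L & action H w phi t gamma = (phi (gamma 0) + L)%:E.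
Proof.
move=> t0 cw cg; have [C hC] := running_cost_lower (lexx 0) t0 cw cg.
have mv := measurable_running_cost (lexx 0) t0 cw cg.
have [h|h] := eqVneq (\int[lebesgue_measure]_(s in `[0%R, t]) running_cost w gamma s)%E +oo%E.
  by left; rewrite /action -/(running_cost w gamma) h addeC.
right; have [|L hL] := measurable_version_has_integral t0 mv hC; first by rewrite ltey.
by exists L; [split|rewrite /action (has_integralE t0 hL)].
Qed.

Lemma has_action_action w phi gamma t L : has_action w gamma 0 t L ->
  action H w phi t gamma = (phi (gamma 0) + L)%:E.
Proof. by move=> [t0 _ hL]; rewrite /action (has_integralE t0 hL). Qed.

Lemma is_derive_pairing (f : R -> 'rV[R]_n) s v q : is_derive s 1 f v ->
  is_derive s 1 (fun t => pairing (f t) q) (pairing v q).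
Proof.
move=> [df dv].
have h : (fun h : R => h^-1 *: (pairing (f (h *: 1 + s)) q - pairing (f s) q)) @ 0^' --> pairing v q.
  have -> : (fun h : R => h^-1 *: (pairing (f (h *: 1 + s)) q - pairing (f s) q)) =
      (fun y => pairing y q) \o (fun h : R => h^-1 *: (f (h *: 1 + s) - f s)).
    by apply/funext => h /=; rewrite pairingZl pairingBl.
  apply: (@cvg_comp _ _ _ _ (fun y => pairing y q) _ (nbhs v)).
    by rewrite -dv; exact: df.
  apply/cvgrPdist_lt => e e0.
  have h0 : 0 < 1 + n%:R * `|q| :> R by rewrite ltr_pwDl// mulr_ge0.
  have := near_norm v (divr_gt0 e0 h0); apply: filterS => z hz.
  rewrite -pairingBl; apply: le_lt_trans (pairing_le _ _) _.
  rewrite ltr_pdivlMr// in hz; apply: le_lt_trans hz.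
  by rewrite mulrDr mulr1 mulrCA lerDr.
split; first by apply/cvg_ex; exists (pairing v q).
exact: cvg_lim h.
Qed.

(** The Fenchel inequality integrated with a constant chart covector [q]. Action thus controls
    displacement, and [q] may be adapted to the displacement at hand. *)
Lemma has_action_ge_pairing c w gamma a b L q (m : R) : a < b -> has_action w gamma a b L ->
  (forall s, a <= s <= b -> dom A c (gamma s)) ->
  (forall s, a < s < b -> in_chart H c (chart A c (gamma s)) q (w s (gamma s)) <= m) ->
  pairing (chart A c (gamma b) - chart A c (gamma a)) q <= L + m * (b - a).
Proof.
move=> ab [_ acg hi] hd hm; have [cg ac] := acg.
have acc := ac c a b (lexx a) (lexx b) hd.
have ach : ac_fun a b (fun s => pairing (chart A c (gamma s)) q).
  apply: (abs_continuous_ac_fun (K := n%:R * `|q|) acc) => s t _ _.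
  by rewrite -pairingBl (le_trans (pairing_le _ _))// mulrAC mulrA.
have [Y [Yi YE Yd]] := ac_fun_FTC ab ach.
have [V [_ Vd]] := ac_curve_chart ab acg hd.
have := YE b; rewrite (ltW ab) lexx => /(_ isT) e.
rewrite pairingBl e addrAC subrr add0r mulrBr.
apply: (@has_integral_le R (EFin \o Y) (running_cost w gamma) (fun s => m * s) (fun=> m) a b).
- exact: ltW.
- by move=> s; have := is_deriveZ m (is_derive_id s (1 : R^o)); rewrite /GRing.scale/= mulr1.
- by move=> s; exact: cvg_cst.
- by exists Y; split => //; apply: aeW.
- exact: hi.
apply: (ae_imp2 Yd Vd) => s hY hV sab.
have sab' : a <= s <= b by case/andP : sab => *; rewrite !ltW.
have := hY sab => {}hY; have := hV sab => {}hV.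
have eY : Y s = pairing (V s) q.
  have [_ <-] := hY; have [_ <-] := is_derive_pairing q hV.
  by [].
have := @le_lagrangian_chart _ _ _ A H c gamma s (V s) q (w s (gamma s))
  (within_continuous_interior (ltW ab) cg sab) (hd s sab') hV.
rewrite /= eY => h1; rewrite -/(running_cost w gamma s) in h1.
have h2 := hm s sab.
apply: le_trans (leeD2r m%:E h1); rewrite -EFinD lee_fin.
by rewrite -addrA lerDl addrC subr_ge0.
Qed.

Lemma pairing_delta (v : 'rV[R]_n) j : pairing v (delta_mx 0 j) = v 0 j.
Proof.
rewrite pairingE (bigD1 j)//= mxE !eqxx mulr1 big1 ?addr0// => k kj.
by rewrite mxE (negbTE kj) andbF mulr0.
Qed.

(** A straight segment of chart [c] has to be absolutely continuous in every other chart as well;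
    there it is Lipschitz, since transition maps have continuous derivatives along the compact
    segment. *)
Lemma transition_line_lipschitz c d y0 v a b : a <= b ->
  (forall s, a <= s <= b -> img A c (y0 + s *: v) /\ dom A d (cinv A c (y0 + s *: v))) ->
  abs_continuous a b (fun s => chart A d (cinv A c (y0 + s *: v))).
Proof.
move=> ab hs.
pose T := chart A d \o cinv A c; pose l (s : R) := y0 + s *: v.
have hU s : a <= s <= b -> (chart A c @` (dom A c `&` dom A d)) (l s).
  by move=> /hs[h1 h2]; exact: overlapP.
have [dT cT] := chart_smooth A c d 1; have {}cT := cT v.
have lc : continuous l.
  by move=> s; apply: cvgD; [exact: cvg_cst|apply: cvgZr_tmp; exact: cvg_id].
have der s : a <= s <= b -> is_derive s 1 (T \o l) ('D_v T (l s)).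
  move=> sab; have dTs := dT _ (hU s sab).
  have e z : l z = z *: v + y0 by rewrite /l addrC.
  have h1 : is_derive s 1 (fun t : R => T (t *: v + y0)) ('D_v T (l s)).
    have lE (h r z : R^o) : (h *: r + z) *: v + y0 = h *: (r *: v) + (z *: v + y0).
      by rewrite scalerDl addrA scalerA.
    have dT' : differentiable T (s *: v + y0) by rewrite -e.
    split.
      apply: (@derivable_slice _ _ R^o _ T (fun t : R => t *: v + y0) (fun t => t *: v) 1 s lE).
      exact: diff_derivable.
    rewrite e; have := @derive_slice _ _ R^o _ T (fun t : R => t *: v + y0) (fun t => t *: v) 1 s lE.
    by rewrite scale1r.
  by rewrite (_ : T \o l = (fun t : R => T (t *: v + y0)))//; apply/funext => z; rewrite /= e.
have derj j s : a <= s <= b -> is_derive s 1 (fun t => T (l t) 0 j) ('D_v T (l s) 0 j).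
  move=> sab; have := is_derive_pairing (delta_mx 0 j) (der s sab).
  by rewrite pairing_delta; under eq_fun do rewrite pairing_delta.
have cj j : {within `[a, b], continuous (fun s => 'D_v T (l s) 0 j)}.
  apply: clamp_within_continuous => // s.
  have h := cT _ (hU _ (clamp_itv ab s)).
  apply: (@continuous_comp _ _ _ (fun s => 'D_v T (l (clamp a b s))) (fun z : 'rV[R]_n => z 0 j)); last exact: coord_continuous.
  apply: (@continuous_comp _ _ _ (l \o clamp a b) (fun z => 'D_v T z)); last exact: h.
  by apply: continuous_comp; [exact: clamp_continuous|exact: lc].
have /choice[K hK] : forall j, exists K : R, forall s, a <= s <= b -> `|'D_v T (l s) 0 j| <= K.
  move=> j; have [|z _ hz] := @EVT_max R (fun s => `|'D_v T (l s) 0 j|) a b ab.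
    apply: clamp_within_continuous => // s.
    apply: (@continuous_comp _ _ _ ((fun s => 'D_v T (l s) 0 j) \o clamp a b) (fun r : R => `|r|)).
      exact: (within_continuous_clamp ab (cj j)).
    exact: norm_continuous.
  by exists `|'D_v T (l z) 0 j| => s sab; apply: hz; rewrite in_itv.
apply: (@lipschitz_abs_continuous _ _ _ _ (\sum_j `|K j|)) => s t as_ st tb.
rewrite -[leLHS]/(mx_norm _) mx_normrE.
elim/big_ind: _ => [|a1 a2 h1' h2'|[i j] _ /=].
- by rewrite mulr_ge0 ?subr_ge0// sumr_ge0.
- by rewrite ge_max h1'.
rewrite ord1 !mxE -/(T (l s)) -/(T (l t)).
apply: (@le_trans _ _ (`|K j| * (t - s))); last first.
  rewrite ler_wpM2r ?subr_ge0// (bigD1 j)//= lerDl sumr_ge0//.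
have [<-|nst] := eqVneq s t; first by rewrite !subrr normr0 mulr0.
have {nst}st' : s < t by rewrite lt_neqAle nst.
have [||z zst ->] := @MVT R (fun t => T (l t) 0 j) (fun s => 'D_v T (l s) 0 j) s t st'.
- move=> z; rewrite in_itv/= => /andP[sz zt]; apply: derj.
  by rewrite (le_trans as_ (ltW sz)) (le_trans (ltW zt) tb).
- apply: derivable_within_continuous => z; rewrite in_itv/= => /andP[sz zt].
  by have [|] := derj j z; rewrite ?(le_trans as_ sz) ?(le_trans zt tb).
move: zst; rewrite in_itv/= => /andP[sz zt].
rewrite normrM (ger0_norm (x := t - s)) ?subr_ge0// ler_wpM2r ?subr_ge0//.
apply: le_trans (ler_norm _); apply: hK.
by rewrite (le_trans as_ (ltW sz)) (le_trans (ltW zt) tb).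
Qed.

(** The explicit curves from which upper bounds are built: at constant chart velocity the running
    cost is a Legendre transform with [v] fixed. *)
Lemma has_action_segment c w y0 v a b (m : R) : 0 <= a -> a <= b -> time_continuous w ->
  (forall s, a <= s <= b -> img A c (y0 + s *: v)) ->
  (forall s q, a <= s <= b ->
    pairing v q - in_chart H c (y0 + s *: v) q (w s (cinv A c (y0 + s *: v))) <= m) ->
  exists2 L, has_action w (fun s => cinv A c (y0 + s *: v)) a b L & L <= m * (b - a).
Proof.
move=> a0 ab cw hs hm; pose l (s : R) := y0 + s *: v; pose gamma s := cinv A c (l s).
have lc : continuous l.
  by move=> s; apply: cvgD; [exact: cvg_cst|apply: cvgZr_tmp; exact: cvg_id].
have cg : {within `[a, b], continuous gamma}.
  apply: clamp_within_continuous => // s.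
  apply: (@continuous_comp _ _ _ (l \o clamp a b) (cinv A c)).
    by apply: continuous_comp; [exact: clamp_continuous|exact: lc].
  by apply: cinv_continuous; apply: hs; exact: clamp_itv.
have acg : ac_curve A a b gamma.
  split => // d a' b' aa' bb' hd.
  have [ab'|ba'] := leP a' b'.
    apply: transition_line_lipschitz => // s /andP[s1 s2]; split.
      by apply: hs; rewrite (le_trans aa' s1) (le_trans s2 bb').
    by apply: hd; rewrite s1.
  apply: (@lipschitz_abs_continuous _ _ _ _ 0) => s t s1 st t1.
  by have := le_lt_trans (le_trans s1 (le_trans st t1)) ba'; rewrite ltxx.
have up s : a < s < b -> (running_cost w gamma s <= m%:E)%E.
  move=> sab; have sab' : a <= s <= b by case/andP : sab => *; rewrite !ltW.
  have is_ := hs s sab'.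
  have dv : is_derive s 1 (chart A c \o gamma) v.
    have dl : is_derive s 1 l v.
      apply: is_derive_row => j.
      have h1 := is_deriveD (is_derive_cst (y0 0 j : R^o) s 1) (is_deriveZ (v 0 j) (is_derive_id s (1 : R^o))).
      have e1 : (fun t => l t 0 j) = (cst (y0 0 j : R^o) + v 0 j \*: id).
        by apply/funext => t; rewrite /l !mxE mulrC.
      by rewrite e1; move: h1; rewrite add0r /GRing.scale/= mulr1.
    apply: near_eq_is_derive dl; have := near_img is_ => /(lc s) h.
    have h1 : \forall t \near s, img A c (l t) by exact: h.
    by apply: filterS h1 => t /= it; rewrite /gamma cinvK.
  rewrite /running_cost (velocity_chart (within_continuous_interior ab cg sab) (dom_cinv is_) dv).
  rewrite {3}/gamma cinvK// lagrangian_chart//.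
  by apply: ge_ereal_sup => _ [q _ <-]; rewrite lee_fin; exact: hm.
have [C hC] := running_cost_lower a0 ab cw acg.
have [|||L hL] := @measurable_version_dominated R (running_cost w gamma) a b
  (fun s => (`|m| + `|C|) * \1_(`[a, b]%classic : set (measurableTypeR R)) s).
- exact: measurable_running_cost.
- exact: integrable_bounded_itv.
- apply: aeW => s sab; have u1 := up s sab.
  have sab' : a <= s <= b by case/andP : sab => *; rewrite !ltW.
  have h1 := hC s sab'.
  have -> : \1_(`[a, b]%classic : set (measurableTypeR R)) s = 1 :> R.
    by rewrite indicE mem_set//= in_itv/= sab'.
  case: (running_cost w gamma s) h1 u1 => [r||]//=; rewrite -?EFinD !lee_fin => h1 u1.
  rewrite mulr1 ler_norml.
  have f1 := ler_norm m; have C2 := ler_norm C.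
  have C3 : 0 <= `|m| by []. have C4 : 0 <= `|C| by [].
  by apply/andP; split; lra.
exists L; first by split.
apply: (has_integral_le_cst ab hL); apply: aeW => s; exact: up.
Qed.

(** * Existence of backward solutions *)

Hypothesis lambda0 : 0 < lambda.

(* The value map is a contraction for the sup norm weighted by [weight]. *)
Definition weight (s : R) : R := expR (2 * lambda * s).

Lemma weight_gt0 s : 0 < weight s. Proof. exact: expR_gt0. Qed.
Lemma weight0 : weight 0 = 1. Proof. by rewrite /weight mulr0 expR0. Qed.
Lemma weightD s t : weight (s + t) = weight s * weight t.
Proof. by rewrite /weight mulrDr expRD. Qed.
Lemma weight_le s t : s <= t -> weight s <= weight t.
Proof. by move=> st; rewrite ler_expR ler_wpM2l// mulr_ge0// ltW. Qed.
Lemma weight_ge1 s : 0 <= s -> 1 <= weight s.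
Proof. by move=> s0; rewrite -weight0; exact: weight_le. Qed.

Lemma weight_increment s t : weight t - weight s <= 2 * lambda * (t - s) * weight t.
Proof.
have h : 1 - 2 * lambda * (t - s) <= expR (- (2 * lambda * (t - s))) by exact: expR_ge1Dx.
have := ler_wpM2r (ltW (weight_gt0 t)) h.
have -> : expR (- (2 * lambda * (t - s))) * weight t = weight s.
  by rewrite /weight -expRD; congr expR; ring.
by rewrite mulrBl mul1r; lra.
Qed.

Lemma is_derive_weight D s : is_derive s 1 (fun s => D * weight s) (D * (2 * lambda) * weight s).
Proof.
rewrite -mulrA.
have h1 : is_derive s 1 (fun s : R => 2 * lambda * s) (2 * lambda).
  by have := is_deriveZ (2 * lambda) (is_derive_id s (1 : R^o)); rewrite /GRing.scale/= mulr1.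
have h2 : is_derive s 1 weight (2 * lambda * weight s).
  have := @is_derive1_comp _ expR (fun s : R => 2 * lambda * s) s _ _ (is_derive_expR _) h1.
  by rewrite [X in is_derive _ _ _ X -> _]mulrC.
by have := is_deriveZ D h2.
Qed.

Lemma weight_continuous : continuous weight.
Proof.
move=> s; apply: (@continuous_comp _ _ _ (fun s : R => 2 * lambda * s) expR).
  by apply: cvgM; [exact: cvg_cst|exact: cvg_id].
exact: continuous_expR.
Qed.

(** Integrating [lambda * (D * weight s)] divides by the rate [2 * lambda], whence [D / 2]. *)
Lemma has_action_change_weight w w' gamma D a b L : 0 <= a -> time_continuous w ->
  time_continuous w' -> has_action w gamma a b L ->
  (forall s, a <= s <= b -> `|w' s (gamma s) - w s (gamma s)| <= D * weight s) ->
  exists2 L', has_action w' gamma a b L' & L' <= L + D / 2 * (weight b - weight a).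
Proof.
move=> a0 cw cw' hL hD.
have [||L' h1 h2] := @has_action_change w w' gamma (fun s => D / (2 * lambda) * weight s)
   (fun s => D * weight s) a b L a0 cw cw' hL _ _ hD.
- move=> s; have := is_derive_weight (D / (2 * lambda)) s.
  by rewrite divfK// mulf_neq0// gt_eqF.
- by move=> s; apply: cvgM; [exact: cvg_cst|exact: weight_continuous].
exists L' => //; apply: le_trans h2 _; rewrite lerD2l -mulrBr mulrA ler_wpM2r//.
  by rewrite subr_ge0 weight_le// (has_action_le hL).
by rewrite invfM mulrCA mulrA -[X in _ <= X]mulr1 -[X in _ <= _ * X](mulVf (lt0r_neq0 lambda0)) le_eqVlt -subr_eq0; apply/orP; left; apply/eqP; ring.
Qed.

(** Reference with the [u] argument frozen at [0]: its actions are estimated once, and those of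
    other [w] follow by [has_action_change_weight]. *)
Let w0 : R -> M -> R := fun _ _ => 0.

Lemma time_continuous0 : time_continuous w0. Proof. by move=> z; exact: cvg_cst. Qed.

Lemma action_lower : exists2 C : R, 0 <= C & forall gamma a b L, has_action w0 gamma a b L ->
  - C * (b - a) <= L.
Proof.
have [C hC] := hamiltonian_zero_bound.
exists `|C| => // gamma a b L [ab _ hi].
have := @has_integral_le R (fun=> 0%E) (running_cost w0 gamma) (fun s => `|C| * s) (fun=> `|C|) a b 0 L ab.
rewrite -mulrBr => h; rewrite mulNr -subr_ge0 opprK; apply: h.
- by move=> s; have := is_deriveZ `|C| (is_derive_id s (1 : R^o)); rewrite /GRing.scale/= mulr1.
- by move=> s; exact: cvg_cst.
- exact: has_integral0.
- exact: hi.
apply: aeW => s sab; rewrite -leeBlDr//.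
apply: le_trans (lagrangian_lower _ _ _); rewrite sub0e -EFinN lee_fin lerN2.
by apply: le_trans (hC _ _) _; rewrite normr0 mulr0 addr0 ler_norm.
Qed.

(** Coercivity with slope [n] absorbs the pairing, which [pairing_le] bounds by [n * |q|] for speeds
    at most 1. *)
Lemma slow_cost_bound c : exists2 C : R, 0 <= C & \forall y \near chart A c c,
  img A c y /\ forall v q, `|v| <= 1 -> pairing v q - in_chart H c y q 0 <= C.
Proof.
have ic := img_chart (dom_center A c).
have [C hC] := coercive_chart H_C3 H_convex H_superlinear H_lipschitz ic (ler0n _ n).
exists `|C| => //; apply: filterS2 (near_img ic) hC => y iy h; split => // v q v1.
have := h q 0; rewrite normr0 mulr0 subr0 => h1.
have h2 := le_trans (ler_norm _) (pairing_le v q).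
have h3 : n%:R * (`|v| * `|q|) <= n%:R * `|q| by rewrite ler_wpM2l// ler_piMl.
have := ler_norm C; lra.
Qed.

(** Travel time equals chart distance, so the speed is at most 1, and the ball, being convex,
    contains the whole segment. *)
Lemma slow_segment c : exists2 C : R, 0 <= C & exists2 r : R, 0 < r & forall y z a b,
  `|chart A c c - y| < r -> `|chart A c c - z| < r -> 0 <= a -> a <= b -> b - a = `|z - y| ->
  exists gamma L, [/\ gamma a = cinv A c y, gamma b = cinv A c z, has_action w0 gamma a b L &
    L <= C * (b - a)].
Proof.
have [C C0 /nbhs_normP[r /= r0 hr]] := slow_cost_bound c; exists C => //; exists r => // y z a b hy hz a0 ab e.
(* For [y = z] the inverse of [0] is [0], so [v] vanishes; then also [a = b]. *)
pose v := `|z - y|^-1 *: (z - y).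
have v1 : `|v| <= 1.
  rewrite normrZ normfV normr_id; have [->|h] := eqVneq `|z - y| 0; first by rewrite mulr0.
  by rewrite mulVf.
pose y0 := y - a *: v.
have ya : y0 + a *: v = y by rewrite /y0 subrK.
have yb : y0 + b *: v = z.
  rewrite /y0 -addrA -scaleNr -scalerDl addrC (addrC (- a)) e /v scalerA.
  have [h|h] := eqVneq `|z - y| 0; last by rewrite divff// scale1r subrK.
  by rewrite h mul0r scale0r add0r; apply/esym/eqP; rewrite -subr_eq0 -normr_eq0 h.
have ball s : a <= s <= b -> `|chart A c c - (y0 + s *: v)| < r.
  move=> /andP[as_ sb]; have [ab0|nab] := eqVneq a b.
    have -> : s = a by apply/eqP; rewrite eq_le as_ ab0 sb.
    by rewrite ya.
  have {}nab : 0 < b - a by rewrite subr_gt0 lt_neqAle nab.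
  pose k := (s - a) / (b - a).
  have k01 : 0 <= k <= 1 by rewrite /k ler_pdivrMr// mul1r lerD2r sb divr_ge0 ?subr_ge0 ?(ltW nab)// ltW// -subr_gt0.
  have -> : chart A c c - (y0 + s *: v) = (1 - k) *: (chart A c c - y) + k *: (chart A c c - z).
    have sv : s *: v = a *: v + k *: (z - y).
      by rewrite /v /k -e !scalerA -scalerDl -mulrDl (addrC a) subrK.
    by rewrite sv addrA ya; apply/rowP => j; rewrite !mxE; ring.
  case/andP: k01 => k0 k1.
  have e1 : `|k| = k by apply: ger0_norm.
  have e2 : `|1 - k| = 1 - k by apply: ger0_norm; rewrite subr_ge0.
  apply: le_lt_trans (ler_normD _ _) _; rewrite [X in X + _]normrZ [X in _ + X]normrZ e1 e2.
  have [->|nk] := eqVneq k 0; first by rewrite mul0r addr0 subr0 mul1r.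
  have {}k0 : 0 < k by rewrite lt_neqAle eq_sym nk.
  apply: (@lt_le_trans _ _ ((1 - k) * r + k * r)); last by rewrite -mulrDl subrK mul1r.
  by rewrite ler_ltD// ?ltr_pM2l// ler_wpM2l// ?subr_ge0// ltW.
have [||L hL Lm] := @has_action_segment c w0 y0 v a b C a0 ab time_continuous0.
- by move=> s /ball/hr[].
- by move=> s q /ball/hr[_]; exact.
exists (fun s => cinv A c (y0 + s *: v)), L; split => //; first by rewrite ya.
by rewrite yb.
Qed.

(** At velocity [0] the Lagrangian is the supremum of [- H (x, q, 0)] over [q], which
    [slow_cost_bound] controls near each point. *)
Lemma stay : exists2 C : R, 0 <= C & forall x a b, 0 <= a -> a <= b ->
  exists2 L, has_action w0 (fun=> x) a b L & L <= C * (b - a).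
Proof.
have [|C hC] := @compact_bound R M (fun x C => forall q, - H (x, q, 0) <= C) M_compact
   (fun x C C' h CC q => le_trans (h q) CC) _.
  move=> x0; have [C _ h] := slow_cost_bound x0; exists C.
  apply: filterS2 (near_chart (dom_center A x0) h) (near_dom (dom_center A x0)) => x [_ hx] dx q.
  have e := lagrangian_chart H 0 0 (img_chart dx); rewrite mul0mx chartK// in e.
  rewrite -lee_fin; apply: (@le_trans _ _ (lagrangian H x 0 0)).
    by apply: ereal_sup_ubound; exists q => //; rewrite pairing0l sub0r.
  rewrite e; apply: ge_ereal_sup => _ [q' _ <-]; rewrite lee_fin; apply: hx.
  by rewrite normr0.
exists `|C| => // x a b a0 ab.
have [||L] := @has_action_segment x w0 (chart A x x) 0 a b `|C| a0 ab time_continuous0.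
- by move=> s _; rewrite scaler0 addr0; exact: img_chart (dom_center A x).
- move=> s q _; rewrite scaler0 addr0 pairing0l sub0r in_chart_center.
  exact: le_trans (hC _ _) (ler_norm _).
move=> h1 h2; exists L; last exact: h2.
move: h1.
rewrite (_ : (fun s => _) = (fun=> x))//; apply/funext => s.
by rewrite scaler0 addr0 chartK//; exact: dom_center.
Qed.

Lemma time_continuous_shift w h : 0 <= h -> time_continuous w -> time_continuous (fun t => w (t + h)).
Proof.
move=> h0 cw z.
have e : (fun z : M * R => w (Num.max 0 z.2 + h) z.1) =
    (fun z : M * R => w (Num.max 0 z.2) z.1) \o (fun z : M * R => (z.1, Num.max 0 z.2 + h)).
  apply/funext => y /=; rewrite (max_r (x := 0) (y := _ + h))//.
  by rewrite addr_ge0// le_max lexx.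
rewrite e; apply: continuous_comp; last exact: cw.
have c2 : {for z, continuous (fun z : M * R => Num.max 0 z.2 + h)}.
  apply: (@continuousD _ _ _ (fun z : M * R => Num.max 0 z.2) (fun=> h)); last exact: cvg_cst.
  apply: (@continuous_comp _ _ _ (fun z : M * R => z.2) (fun r : R => Num.max 0 r)); first exact: cvg_snd.
  apply: (@continuous_max _ _ (fun=> 0) id); [exact: cvg_cst|exact: cvg_id].
apply: (@cvg_pair _ _ _ _ (nbhs z.1) (nbhs (Num.max 0 z.2 + h))); [exact: cvg_fst|exact: c2].
Qed.

(** * Picard iteration of the value map *)

Section Picard.
Variables (phi : M -> R) (F C : R).
Hypotheses (F0 : 0 <= F) (phi_bound : forall x, `|phi x| <= F) (C0 : 0 <= C)
  (cost_lower : forall gamma a b L, has_action w0 gamma a b L -> - C * (b - a) <= L)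
  (cost_stay : forall x a b, 0 <= a -> a <= b ->
    exists2 L, has_action w0 (fun=> x) a b L & L <= C * (b - a))
  (phi_dominated : forall gamma a b L, 0 <= a -> has_action w0 gamma a b L ->
    phi (gamma b) <= phi (gamma a) + L + C * (b - a)).

(** [B] makes the bound [B * weight t] reproduce itself under the value map ([initial_weight]). [D]
    does the same for the time-Lipschitz bound: up to weights, the map adds [(C + lambda * B) * h]
    and passes on half of the old constant, so [D / 2 = C + lambda * B] closes the loop. *)
Let B := 2 * F + C / lambda.
Let D := 2 * (C + lambda * B).

Let B0 : 0 <= B. Proof. by rewrite addr_ge0 ?mulr_ge0// invr_ge0 ltW. Qed.
Let lB0 : 0 <= lambda * B. Proof. by rewrite mulr_ge0// ltW. Qed.
Let D0 : 0 <= D. Proof. by rewrite mulr_ge0// addr_ge0. Qed.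

Let initial_weight t : 0 <= t -> F + C * t + B / 2 * (weight t - weight 0) <= B * weight t.
Proof.
move=> t0; have h : 1 + 2 * lambda * t <= weight t by exact: expR_ge1Dx.
have := ler_wpM2l B0 h; rewrite weight0.
have e : B * (1 + 2 * lambda * t) = 2 * F + C / lambda + 4 * (F * lambda * t) + 2 * C * t.
  by rewrite /B; field; rewrite gt_eqF.
have h1 : 0 <= F * lambda * t by rewrite !mulr_ge0// ltW.
have h2 : 0 <= C / lambda by rewrite divr_ge0// ltW.
have h3 : 0 <= B := B0.
have -> : B / 2 * (weight t - 1) = B * weight t / 2 - B / 2 by field.
rewrite e; have h4 : B = 2 * F + C / lambda by [].
move: h1 h2 h3 h4; move: (B * weight t) (C / lambda) (F * lambda * t) B => X Y Z b h1 h2 h3 h4 h5.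
lra.
Qed.

(** The last clause makes the value map preserve continuity: curves shifted in time see a different
    [w], and the difference has to be of order [h]. *)
Let admissible w := [/\ time_continuous w,
  forall t x, 0 <= t -> `|w t x| <= B * weight t &
  forall t h x, 0 <= t -> 0 <= h -> `|w (t + h) x - w t x| <= D * h * weight (t + h)].

Let drop_w w gamma a b L : admissible w -> 0 <= a -> has_action w gamma a b L ->
  exists2 L0, has_action w0 gamma a b L0 & L0 <= L + B / 2 * (weight b - weight a).
Proof.
move=> [cw bw _] a0 h; apply: has_action_change_weight h _ => //; first exact: time_continuous0.
by move=> s /andP[s1 _]; rewrite sub0r normrN bw// (le_trans a0).
Qed.

Let add_w w gamma a b L : admissible w -> 0 <= a -> has_action w0 gamma a b L ->
  exists2 L0, has_action w gamma a b L0 & L0 <= L + B / 2 * (weight b - weight a).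
Proof.
move=> [cw bw _] a0 h; apply: has_action_change_weight h _ => //; first exact: time_continuous0.
by move=> s /andP[s1 _]; rewrite subr0 bw// (le_trans a0).
Qed.

Let costs w t x := [set r | exists gamma L, [/\ gamma t = x, has_action w gamma 0 t L &
  r = phi (gamma 0) + L]].

(** One Picard step: the [u] argument of the cost is taken from [w], and fixed points are backward
    solutions. *)
Definition value w t x := inf (costs w t x).

Let weight_half s t : 0 <= s -> s <= t -> B / 2 * (weight t - weight s) <= lambda * B * (t - s) * weight t.
Proof.
move=> s0 st; have := ler_wpM2l B0 (weight_increment s t).
set X := weight t; set Y := weight s.
rewrite (_ : B * (2 * lambda * (t - s) * X) = 2 * (lambda * B * (t - s) * X)); last by ring.
by set Z := lambda * _ * _ * _; lra.
Qed.

Let costs_lower w t x r : admissible w -> 0 <= t -> costs w t x r -> - (B * weight t) <= r.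
Proof.
move=> aw t0 [gamma [L [_ hL ->]]]; have [L0 h1 h2] := drop_w aw (lexx 0) hL.
have := cost_lower h1; have := initial_weight t0; have := phi_bound (gamma 0).
rewrite ler_norml subr0 => /andP[h3 _]; lra.
Qed.

Let stay_w w x a b : admissible w -> 0 <= a -> a <= b ->
  exists2 L, has_action w (fun=> x) a b L & L <= C * (b - a) + B / 2 * (weight b - weight a).
Proof.
move=> aw a0 ab; have [L h1 h2] := cost_stay x a0 ab; have [L' h3 h4] := add_w aw a0 h1.
by exists L' => //; rewrite (le_trans h4)// lerD2r.
Qed.

Let has_inf_costs w t x : admissible w -> 0 <= t -> has_inf (costs w t x).
Proof.
move=> aw t0; split.
  have [L h1 _] := stay_w x aw (lexx 0) t0.
  by exists (phi x + L), (fun=> x), L.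
by exists (- (B * weight t)) => r; exact: costs_lower.
Qed.

Let value_le w t gamma L : admissible w -> has_action w gamma 0 t L ->
  value w t (gamma t) <= phi (gamma 0) + L.
Proof.
move=> aw h; have t0 := has_action_le h.
by apply: ge_inf; [have [] := has_inf_costs (gamma t) aw t0|exists gamma, L].
Qed.

Let value_near w t x e : admissible w -> 0 <= t -> 0 < e -> exists gamma L,
  [/\ gamma t = x, has_action w gamma 0 t L & phi (gamma 0) + L < value w t x + e].
Proof.
move=> aw t0 e0; have [_ [gamma [L [h1 h2 ->]]] h3] := inf_adherent e0 (has_inf_costs x aw t0).
by exists gamma, L.
Qed.

Let value_bound w t x : admissible w -> 0 <= t -> `|value w t x| <= B * weight t.
Proof.
move=> aw t0; rewrite ler_norml; apply/andP; split.
  apply: lb_le_inf; first by have [] := has_inf_costs x aw t0.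
  by move=> r; exact: costs_lower.
have [L h1 h2] := stay_w x aw (lexx 0) t0.
apply: le_trans (value_le aw h1) _; have := initial_weight t0; have := phi_bound x.
by rewrite ler_norml subr0 in h2 *; case/andP; lra.
Qed.

Let value_extend w gamma a b L x : admissible w -> 0 <= a -> has_action w gamma a b L ->
  gamma a = x -> value w b (gamma b) <= value w a x + L.
Proof.
move=> aw a0 h gx; apply/ler_addgt0Pr => e e0.
have [gamma1 [L1 [g1 h1 h2]]] := value_near x aw a0 e0.
have eq : gamma1 a = gamma a by rewrite g1 gx.
have h3 := has_action_cat eq h1 h.
have ab := has_action_le h.
have := value_le aw h3; rewrite /curve_cat a0.
have -> : (if b <= a then gamma1 b else gamma b) = gamma b.
  by case: leP => // ba; have -> : b = a by apply/eqP; rewrite eq_le ab ba.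
by move=> h4; apply: le_trans h4 _; rewrite addrA (addrAC _ L) lerD2r ltW.
Qed.

(** Waiting at [x] during the extra time [h] is a competitor. *)
Let value_later w t h x : admissible w -> 0 <= t -> 0 <= h ->
  value w (t + h) x <= value w t x + (C + lambda * B) * h * weight (t + h).
Proof.
move=> aw t0 h0; have th : t <= t + h by rewrite lerDl.
have [L h1 h2] := stay_w x aw t0 th.
apply: le_trans (value_extend aw t0 h1 erefl) _; rewrite lerD2l (le_trans h2)//.
have := weight_half t0 th; rewrite (addrC t h) addrK (addrC h t) => h3.
have h4 : C * h <= C * h * weight (t + h).
  by rewrite ler_peMr ?weight_ge1 ?addr_ge0 ?mulr_ge0.
by apply: le_trans (lerD h4 h3) _; rewrite mulrDl mulrDl.
Qed.

(** A near-optimal curve for time [t + h] drops its first stretch of length [h]: by [phi_dominated],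
    starting at [gamma h] instead loses at most [C * h] beyond the cost saved. The rest is moved
    back by [h], at the price of the time-Lipschitz bound of [w]. *)
Let value_earlier w t h x : admissible w -> 0 <= t -> 0 <= h ->
  value w t x <= value w (t + h) x + D * h * weight (t + h).
Proof.
move=> aw t0 h0; have th0 : 0 <= t + h by rewrite addr_ge0.
have [cw _ lw] := aw.
apply/ler_addgt0Pr => e e0.
have [gamma [L [gx hL le]]] := value_near x aw th0 e0.
have hth : h <= t + h by rewrite lerDr.
have [L1 [L2 [h1 h2 eL]]] := has_action_split h0 hth hL.
have [L3 h3 h4] := drop_w aw (lexx 0) h1.
have h5 := phi_dominated (lexx 0) h3.
have h2' : has_action w gamma (0 + h) (t + h) L2 by rewrite add0r.
have h6 := has_action_shift t0 h2'.
have [||L4 h7 h8] := has_action_change_weight (w' := w) (D := D * h * weight h) (lexx 0) _ cw h6.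
- exact: time_continuous_shift.
- move=> s /andP[s0 _]; rewrite distrC (le_trans (lw _ _ _ s0 h0))// weightD.
  by rewrite (mulrC (weight s)) mulrA.
have h9 := value_le aw h7; rewrite gx add0r in h9.
have w1 := weight_half (lexx 0) h0; rewrite subr0 in w1.
have W1 := weight_ge1 h0; have W2 := weight_ge1 t0.
have c1 : C * h <= C * h * weight h by rewrite ler_peMr// mulr_ge0.
rewrite weightD; rewrite weight0 in w1 h4 h8.
have hW : 0 <= h * weight h by rewrite mulr_ge0// ltW// weight_gt0.
have key : C * h * weight h + lambda * B * h * weight h + D * h * weight h / 2 * (weight t - 1)
    <= D * h * (weight t * weight h).
  rewrite -subr_ge0 (_ : _ - _ = D / 2 * (h * weight h) * weight t); last by rewrite /D; field.
  by rewrite mulr_ge0 ?(ltW (weight_gt0 t))// mulr_ge0// divr_ge0.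
rewrite subr0 in h5.
move: key; set X1 := C * h * weight h in c1 *; set X2 := lambda * B * h * weight h in w1 *.
set X3 := D * h * weight h / 2 * (weight t - 1) in h8 *; set X4 := D * h * _ => key.
set X5 := B / 2 * (weight h - 1) in w1 h4.
move: key le h4 h5 h8 h9 w1 c1; rewrite eL; move: X1 X2 X3 X4 X5 => X1 X2 X3 X4 X5.
move: (C * h) (value w t x) (phi (gamma h)) (phi (gamma 0)) => Z1 Z2 Z3 Z4; move=> *; lra.
Qed.

Hypothesis phi_continuous : continuous phi.

(** Going from [x] to [y] at speed at most 1 in time [h] bounds the value at [y] at time [t + h];
    [value_earlier] brings the bound back to time [t]. *)
Let value_space w c x y t K r : admissible w -> 0 <= K -> 0 <= t -> dom A c x -> dom A c y ->
  (forall y z a b,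
    `|chart A c c - y| < r -> `|chart A c c - z| < r -> 0 <= a -> a <= b -> b - a = `|z - y| ->
    exists gamma L, [/\ gamma a = cinv A c y, gamma b = cinv A c z, has_action w0 gamma a b L &
      L <= K * (b - a)]) ->
  `|chart A c c - chart A c x| < r -> `|chart A c c - chart A c y| < r ->
  value w t y - value w t x <= (K + lambda * B + D) * `|chart A c y - chart A c x| *
    weight (t + `|chart A c y - chart A c x|).
Proof.
move=> aw K0 t0 dx dy hK hx hy; set h := `|_|.
have h0 : 0 <= h by rewrite /h.
have th : t <= t + h by rewrite lerDl.
have [|gamma [L [ga gb hL LK]]] := hK _ _ t (t + h) hx hy t0 th; first by rewrite addrAC subrr add0r.
rewrite !chartK// in ga gb; rewrite (addrC t h) addrK in LK.
have [L' h1 h2] := add_w aw t0 hL.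
have h3 := value_extend aw t0 h1 ga; rewrite gb in h3.
have h4 := value_earlier y aw t0 h0.
have h5 := weight_half t0 th; rewrite [in X in _ <= X](addrC t h) addrK in h5; rewrite (addrC h t) in h5.
have h6 : K * h <= K * h * weight (t + h).
  by rewrite ler_peMr ?weight_ge1 ?addr_ge0 ?mulr_ge0.
have -> : (K + lambda * B + D) * h * weight (t + h) =
    K * h * weight (t + h) + lambda * B * h * weight (t + h) + D * h * weight (t + h) by ring.
rewrite lerBlDl; apply: le_trans h4 _; rewrite addrA lerD2r; apply: le_trans h3 _.
by rewrite lerD2l; apply: le_trans h2 _; exact: lerD (le_trans LK h6) h5.
Qed.

Let value_lipschitz w x a b : admissible w -> 0 <= a -> a <= b ->
  `|value w b x - value w a x| <= D * (b - a) * weight b.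
Proof.
move=> aw a0 ab; have h1 : 0 <= b - a by rewrite subr_ge0.
have e1 : a + (b - a) = b by rewrite addrC subrK.
have u1 := value_later x aw a0 h1; have u2 := value_earlier x aw a0 h1.
rewrite e1 in u1 u2.
have v2 : (C + lambda * B) * (b - a) * weight b <= D * (b - a) * weight b.
  by rewrite ler_wpM2r ?(ltW (weight_gt0 b))// ler_wpM2r// /D mulr_natl mulr2n lerDl addr_ge0.
rewrite ler_norml lerNl opprB !lerBlDl u2/=; apply: le_trans u1 _.
by rewrite lerD2l.
Qed.

Lemma three_points (p1 p2 p3 e : R) : `|p1 - p2| < e / 2 -> p3 - p1 < e / 2 -> p1 - p3 < e / 2 ->
  `|p2 - p3| < e.
Proof. by rewrite !ltr_norml => /andP[a1 a2] a3 a4; apply/andP; split; lra. Qed.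

Let value_continuous w : admissible w -> time_continuous (value w).
Proof.
move=> aw [x0 s0]; set t0 := Num.max 0 s0.
have [K K0 [r r0 hK]] := slow_segment x0.
apply/cvgrPdist_lt => e e0 /=; rewrite -/t0.
(* Space and time increments below [e / (2 * Q * W)] each give an error below [e / 2]; the times
   that occur stay below [t0 + 2], so [W] bounds their weights. *)
pose W := weight (t0 + 2); pose Q := K + lambda * B + D + 1.
have Q0 : 0 < Q by rewrite /Q ltr_wpDl// !addr_ge0.
have W0 : 0 < W := weight_gt0 _.
pose d := Num.min 1 (Num.min r (e / (2 * Q * W))).
have d0 : 0 < d by rewrite !lt_min ltr01 r0 divr_gt0// !mulr_gt0.
have n1 : \forall y \near x0, dom A x0 y /\ `|chart A x0 x0 - chart A x0 y| < d.
  have dc := dom_center A x0.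
  by apply: filterS2 (near_dom dc) (near_chart dc (near_norm _ d0)) => y.
have n2 : \forall s \near s0, `|s0 - s| < d by apply/nbhs_normP; exists d.
exists ([set y | dom A x0 y /\ `|chart A x0 x0 - chart A x0 y| < d], [set s | `|s0 - s| < d]) => //.
move=> [y s] /= [[dy hy] hs]; set t := Num.max 0 s.
have t00 : 0 <= t0 by rewrite le_max lexx.
have t_0 : 0 <= t by rewrite le_max lexx.
have ts : `|t0 - t| <= `|s0 - s|.
  rewrite /t0 /t; case: (leP 0 s0) => p0; case: (leP 0 s) => p; rewrite ?subrr ?normr0//.
    by rewrite subr0 !ger0_norm//; lra.
  by rewrite sub0r normrN distrC !ger0_norm//; lra.
move: hy hs; rewrite /d !lt_min => /and3P[y1 y2 y3] /and3P[s1 s2 s3].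
have tt0 : t <= t0 + 1.
  have := le_lt_trans ts s1; rewrite ltr_norml => /andP[]; lra.
have dx0 := dom_center A x0.
have hx0 : `|chart A x0 x0 - chart A x0 x0| < r by rewrite subrr normr0.
set h := `|chart A x0 x0 - chart A x0 y| in y1 y2 y3.
have h0 : 0 <= h by rewrite /h.
have a1 := value_space aw K0 t_0 dx0 dy hK hx0 y2.
have a2 := value_space aw K0 t_0 dy dx0 hK y2 hx0.
rewrite (distrC (chart A x0 y)) -/h in a1; rewrite -/h in a2.
have Wh : weight (t + h) <= W by rewrite /W weight_le// (le_trans (lerD tt0 (ltW y1)))// -addrA.
have b1 : (K + lambda * B + D) * h * weight (t + h) <= (K + lambda * B + D) * h * W.
  by rewrite ler_wpM2l// mulr_ge0// !addr_ge0.
have lip a b : 0 <= a -> a <= b -> b <= t0 + 1 -> `|value w b x0 - value w a x0| <= D * (b - a) * W.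
  move=> a0 ab bt; have h1 : 0 <= b - a by rewrite subr_ge0.
  apply: le_trans (value_lipschitz x0 aw a0 ab) _; apply: (ler_wpM2l (mulr_ge0 D0 h1)).
  by rewrite weight_le// (le_trans bt)// lerD2l ler1n.
have c1 : `|value w t x0 - value w t0 x0| <= D * `|t0 - t| * W.
  have [tt|tt] := leP t t0.
    have t01 : t0 <= t0 + 1 by rewrite lerDl.
    have -> : `|t0 - t| = t0 - t by rewrite ger0_norm// subr_ge0.
    by rewrite -normrN opprB; exact: lip.
  have := lip t0 t t00 (ltW tt) tt0.
  by have -> : `|t0 - t| = t - t0 by rewrite distrC ger0_norm// subr_ge0 ltW.
have c2 : D * `|t0 - t| * W <= Q * `|s0 - s| * W.
  apply: ler_wpM2r; first exact: ltW.
  apply: le_trans (ler_wpM2l D0 ts) _; apply: ler_wpM2r => //.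
  by rewrite /Q -addrA addrCA lerDl !addr_ge0.
have c3 : (K + lambda * B + D) * h * W <= Q * h * W.
  apply: ler_wpM2r; first exact: ltW.
  by apply: ler_wpM2r => //; rewrite /Q lerDl.
have c4 z : z < e / (2 * Q * W) -> Q * z * W < e / 2.
  by rewrite ltr_pdivlMr ?mulr_gt0// => hz; rewrite ltr_pdivlMr//; move: hz; congr (_ < _); ring.
have f1 := le_lt_trans c1 (le_lt_trans c2 (c4 _ s3)).
have f2 := le_lt_trans b1 (le_lt_trans c3 (c4 _ y3)).
exact: three_points f1 (le_lt_trans a1 f2) (le_lt_trans a2 f2).
Qed.

Let value_admissible w : admissible w -> admissible (value w).
Proof.
move=> aw; split.
- exact: value_continuous.
- by move=> t x t0; exact: value_bound.
move=> t h x t0 h0; have th : t <= t + h by rewrite lerDl.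
by have := value_lipschitz x aw t0 th; have -> : t + h - t = h by ring.
Qed.

(** Both values are tested with the same near-optimal curve, and the weight supplies the factor one
    half. *)
Let value_contract w w' d : admissible w -> admissible w' ->
  (forall t x, 0 <= t -> `|w t x - w' t x| <= d * weight t) ->
  forall t x, 0 <= t -> `|value w t x - value w' t x| <= d / 2 * weight t.
Proof.
move=> aw aw' hd t x t0.
have d0 : 0 <= d.
  by have := hd 0 x (lexx 0); rewrite weight0 mulr1; apply: le_trans.
suff half v v' : admissible v -> admissible v' ->
    (forall t x, 0 <= t -> `|v t x - v' t x| <= d * weight t) ->
    value v t x <= value v' t x + d / 2 * weight t.
  have h1 := half _ _ aw aw' hd.
  have hd' t' x' : 0 <= t' -> `|w' t' x' - w t' x'| <= d * weight t' by move=> ?; rewrite distrC hd.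
  have h2 := half _ _ aw' aw hd'.
  by rewrite ler_norml; apply/andP; split; lra.
move=> av av' hv; apply/ler_addgt0Pr => e e0.
have [gamma [L [gx hL le]]] := value_near x av' t0 e0.
have [cv _ _] := av; have [cv' _ _] := av'.
have [|L' h1 h2] := has_action_change_weight (D := d) (lexx 0) cv' cv hL.
  by move=> s /andP[s0 _]; exact: hv.
have := value_le av h1; rewrite gx => h3; rewrite weight0 in h2.
have h4 : 0 <= d / 2 by rewrite divr_ge0.
rewrite mulrBr mulr1 in h2; lra.
Qed.

Let iterate_value (k : nat) : R -> M -> R := iter k value (fun _ => phi).

Let iterate_admissible k : admissible (iterate_value k).
Proof.
elim: k => [|k IH]; last exact: value_admissible IH.
split => [z|t x t0|t h x t0 h0] /=.
- by apply: (@continuous_comp _ _ _ fst phi); [exact: cvg_fst|exact: phi_continuous].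
- have := initial_weight t0; have := phi_bound x.
  have h1 : 0 <= B / 2 * (weight t - weight 0) by rewrite mulr_ge0 ?divr_ge0// subr_ge0 weight_le.
  have h2 : 0 <= C * t by rewrite mulr_ge0.
  move: h1 h2; move: (B / 2 * (weight t - weight 0)) (C * t) (B * weight t) => X Y Z h1 h2 h3 h4; lra.
- by rewrite subrr normr0 (mulr_ge0 (mulr_ge0 D0 h0))// ltW// weight_gt0.
Qed.

Let iterate_step k t x : 0 <= t ->
  `|iterate_value k.+1 t x - iterate_value k t x| <= 2 * B / 2 ^+ k * weight t.
Proof.
elim: k t x => [|k IH] t x t0.
  have [_ b0 _] := iterate_admissible 0; have [_ b1 _] := iterate_admissible 1.
  apply: le_trans (ler_normB _ _) _; rewrite expr0 divr1.
  have := b0 t x t0; have := b1 t x t0; move: (iterate_value 0) (iterate_value 1) => v0 v1.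
  rewrite -mulrA; move: (B * weight t) => Z; lra.
rewrite exprS invfM (mulrC 2^-1) mulrA.
exact: (value_contract (iterate_admissible k.+1) (iterate_admissible k) IH).
Qed.

Lemma exists_nat_gt (z : R) : exists k : nat, z < k%:R.
Proof.
by exists (Num.bound `|z|); apply: le_lt_trans (ler_norm z) _; apply: archi_boundP.
Qed.

Lemma four_points (p1 p2 p3 p4 e : R) : 0 < e -> `|p1 - p3| < e / 4 -> `|p2 - p4| < e / 4 ->
  `|p1 - p2| < e / 4 -> `|p3 - p4| < e.
Proof.
rewrite !ltr_norml => e0 /andP[a1 a2] /andP[a3 a4] /andP[a5 a6].
by apply/andP; split; lra.
Qed.

(** Nested intervals: [a k] increases and [b k] decreases, so the limit and its rate come out
    together; applied pointwise, this gives locally uniform convergence of the iterates. *)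
Lemma geometric_limit (v : nat -> R) d : 0 <= d -> (forall k, `|v k.+1 - v k| <= d / 2 ^+ k) ->
  exists l, forall k, `|v k - l| <= 2 * d / 2 ^+ k.
Proof.
move=> d0 hv; pose a k := v k - 2 * d / 2 ^+ k; pose b k := v k + 2 * d / 2 ^+ k.
have e k : 2 * d / 2 ^+ k.+1 = d / 2 ^+ k.
  by rewrite exprS; field; rewrite expf_neq0.
have p k : 0 <= d / 2 ^+ k by rewrite divr_ge0// exprn_ge0.
have a1 k : a k <= a k.+1.
  rewrite /a e -[2 * d / _]mulrA; have := hv k; rewrite ler_norml => /andP[h _]; lra.
have b1 k : b k.+1 <= b k.
  rewrite /b e -[2 * d / _]mulrA; have := hv k; rewrite ler_norml => /andP[_ h]; lra.
have am j k : a j <= a (k + j)%N.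
  by elim: k => [//|k IH]; rewrite addSn (le_trans IH).
have bm j k : b (k + j)%N <= b j.
  by elim: k => [//|k IH]; rewrite addSn (le_trans (b1 _)).
have ab k : a k <= b k by rewrite /a /b -[2 * d / _]mulrA; have := p k; lra.
have abk j k : a j <= b k.
  by rewrite (le_trans (am j k))// (le_trans (ab _))// addnC.
have hs : has_sup (range a).
  by split; [exists (a 0%N), 0%N|exists (b 0%N) => _ [j _ <-]].
exists (sup (range a)) => k.
have h1 : a k <= sup (range a) by apply: ub_le_sup; [case: hs|exists k].
have h2 : sup (range a) <= b k by apply: ge_sup; [case: hs|move=> _ [j _ <-]].
by move: h1 h2; rewrite /a /b ler_norml => h1 h2; apply/andP; split; lra.
Qed.

Lemma le_geometric (a b d : R) : (forall k, a <= b + d / 2 ^+ k) -> a <= b.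
Proof.
move=> h; apply/ler_addgt0Pr => e e0.
have [k hk] : exists k : nat, `|d| / e < k%:R.
  exact: exists_nat_gt.
apply: le_trans (h k) _; rewrite lerD2l ler_pdivrMr ?exprn_gt0//.
rewrite ltr_pdivrMr// in hk; apply: le_trans (ler_norm d) _; apply: le_trans (ltW hk) _.
by rewrite mulrC ler_pM2l// -natrX ler_nat ltnW// ltn_expl.
Qed.

Let picard_limit : exists2 w, admissible w & forall t x, 0 <= t -> value w t x = w t x.
Proof.
(* The limit is chosen pointwise; at negative times, which never matter, it is [0]. *)
have /choice[l hl] : forall z : R * M, exists l, 0 <= z.1 -> forall k,
    `|iterate_value k z.1 z.2 - l| <= 4 * B / 2 ^+ k * weight z.1.
  move=> [t x] /=; have [t0|t0] := leP 0 t; last by exists 0.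
  have [|k|l h] := @geometric_limit (fun k => iterate_value k t x) (2 * B * weight t).
  - by rewrite !mulr_ge0// ltW// weight_gt0.
  - by rewrite (le_trans (iterate_step k x t0))// mulrAC.
  exists l => _ k; apply: le_trans (h k) _.
  by rewrite le_eqVlt; apply/orP; left; apply/eqP; ring.
pose w t x := l (t, x).
have hw t x k : 0 <= t -> `|iterate_value k t x - w t x| <= 4 * B / 2 ^+ k * weight t.
  by move=> t0; exact: (hl (t, x)).
have aw : admissible w.
  split.
  - move=> [x0 s0]; apply/cvgrPdist_lt => e e0 /=; set t0 := Num.max 0 s0.
    have t00 : 0 <= t0 by rewrite le_max lexx.
    have W0 := weight_gt0 (t0 + 1).
    have [k hk] := exists_nat_gt (4 * B * weight (t0 + 1) / (e / 4)).
    have hk' : 4 * B / 2 ^+ k * weight (t0 + 1) < e / 4.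
      rewrite mulrAC ltr_pdivrMr ?exprn_gt0//.
      rewrite ltr_pdivrMr ?divr_gt0// in hk; apply: lt_le_trans hk _.
      by rewrite mulrC ler_pM2l ?divr_gt0// -natrX ler_nat ltnW// ltn_expl.
    have [ck _ _] := iterate_admissible k.
    have n1 : \forall z \near (x0, s0), `|iterate_value k t0 x0 - iterate_value k (Num.max 0 z.2) z.1| < e / 4.
      by have /cvgrPdist_lt := ck (x0, s0); apply; rewrite divr_gt0.
    have n2 : \forall z \near (x0, s0), z.2 < s0 + 1.
      have : \forall s \near s0, s < s0 + 1 by apply: lt_nbhsl; rewrite ltrDl.
      by move=> h; exists (setT, [set s | s < s0 + 1]) => [|[y s] /= []//]; split => //; exact: filterT.
    apply: filterS2 n1 n2 => -[y s] /= h1 h2; set t := Num.max 0 s in h1 *.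
    have t_0 : 0 <= t by rewrite le_max lexx.
    have tt : t <= t0 + 1.
      rewrite /t /t0 ge_max addr_ge0//= (le_trans (ltW h2))// lerD2r le_max lexx orbT //.
    have a1 := hw t0 x0 k t00; have a2 := hw t y k t_0.
    have c0 : 0 <= 4 * B / 2 ^+ k by rewrite divr_ge0 ?mulr_ge0// exprn_ge0.
    have a3 : 4 * B / 2 ^+ k * weight t <= 4 * B / 2 ^+ k * weight (t0 + 1).
      by rewrite ler_wpM2l// weight_le.
    have a4 : 4 * B / 2 ^+ k * weight t0 <= 4 * B / 2 ^+ k * weight (t0 + 1).
      by rewrite ler_wpM2l// weight_le// lerDl.
    have {}a1 := le_lt_trans (le_trans a1 a4) hk'; have {}a2 := le_lt_trans (le_trans a2 a3) hk'.
    exact: (four_points e0 a1 a2 h1).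
  - move=> t x t0; apply: (@le_geometric _ _ (4 * B * weight t)) => k.
    have [_ bk _] := iterate_admissible k.
    have := hw t x k t0; have := bk t x t0; rewrite [in X in _ -> X -> _]mulrAC.
    move: (B * weight t) (4 * B * weight t / _) (iterate_value k t x) => X Y v.
    rewrite !ler_norml => /andP[a1 a2] /andP[a3 a4]; apply/andP; split; lra.
  - move=> t h x t0 h0; have th0 : 0 <= t + h by rewrite addr_ge0.
    apply: (@le_geometric _ _ (4 * B * weight t + 4 * B * weight (t + h))) => k.
    have [_ _ lk] := iterate_admissible k.
    have := hw t x k t0; have := hw (t + h) x k th0; have := lk t h x t0 h0.
    rewrite (mulrDl (4 * B * weight t)) [in X in _ -> _ -> X -> _]mulrAC [in X in _ -> X -> _ -> _]mulrAC.
    move: (D * h * _) (4 * B * weight t / _) (4 * B * weight (t + h) / _) => X Y Z.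
    move: (iterate_value k t x) (iterate_value k (t + h) x) => v v'.
    rewrite !ler_norml => /andP[a1 a2] /andP[a3 a4] /andP[a5 a6]; apply/andP; split; lra.
exists w => // t x t0; apply/eqP; rewrite -subr_eq0 -normr_le0.
apply: (@le_geometric _ _ (4 * B * weight t)) => k; rewrite add0r.
have h1 := value_contract (iterate_admissible k) aw (fun t x => @hw t x k) x t0.
have h2 := hw t x k.+1 t0.
have e1 : 4 * B / 2 ^+ k / 2 * weight t = 4 * B * weight t / 2 ^+ k / 2 by ring.
have e2 : 4 * B / 2 ^+ k.+1 * weight t = 4 * B * weight t / 2 ^+ k / 2.
  by rewrite exprS invfM; ring.
rewrite e1 in h1; rewrite e2 /= in h2.
move: h1 h2; move: (4 * B * weight t / 2 ^+ k) (value (iterate_value k) t x) => X Y.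
rewrite !ler_norml => /andP[a1 a2] /andP[a3 a4]; apply/andP; split; lra.
Qed.

(** Curves of infinite action do not affect the infimum, and on all others [action] agrees with the
    costs behind [value]. *)
Lemma backward_solution_exists : exists w, is_backward_solution H phi w.
Proof.
have [w aw fw] := picard_limit; have [cw _ _] := aw; exists w; split.
  have e : {in [set z : M * R | 0 <= z.2], (fun z : M * R => w (Num.max 0 z.2) z.1) =1 (fun z => w z.2 z.1)}.
    by move=> z; rewrite inE/= => z0; rewrite max_r.
  by apply: (subspace_eq_continuous e); apply: continuous_subspaceT.
move=> t x t0; rewrite -fw//; apply/eqP; rewrite eq_le; apply/andP; split.
  apply: le_ereal_inf_tmp => _ [gamma [cg gx] <-].
  have [->|[L hL ->]] := action_dichotomy phi t0 cw cg; first exact: leey.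
  by rewrite lee_fin -gx; exact: value_le.
apply/lee_addgt0Pr => e e0; have [gamma [L [gx hL h]]] := value_near x aw t0 e0.
apply: (@le_trans _ _ (phi (gamma 0) + L)%:E); last by rewrite -EFinD lee_fin ltW.
apply: ereal_inf_lbound; exists gamma; last exact: has_action_action.
by case: hL.
Qed.

End Picard.

(** * Comparison *)

Lemma continuous_bounded (X : topologicalType) (K : set X) (f : X -> R) : compact K ->
  (forall x, K x -> {for x, continuous f}) -> exists C, forall x, K x -> `|f x| <= C.
Proof.
move=> cK cf; apply: (@compact_bound_on R X K (fun x C => `|f x| <= C)) => //.
  by move=> x C C' h; exact: le_trans.
move=> x0 Kx0; exists (`|f x0| + 1).
have /cvgrPdist_lt/(_ 1 ltr01) := cf x0 Kx0; apply: filterS => x h.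
have := ler_normD (f x - f x0) (f x0); rewrite subrK distrC => h1; lra.
Qed.

Lemma time_continuous_bounded w t : time_continuous w ->
  exists2 C, 0 <= C & forall s x, 0 <= s <= t -> `|w s x| <= C.
Proof.
move=> cw; have cK : compact ([set: M] `*` `[0, t]%classic).
  by apply: compact_setX => //; exact: segment_compact.
have [C hC] := continuous_bounded cK (fun z _ => cw z); exists `|C| => // s x /[dup] sx /andP[s0 _].
have := hC (x, s); rewrite /= max_r// => h; apply: le_trans (ler_norm _); apply: h.
by split => //=; rewrite in_itv.
Qed.

(** The two halves of dynamic programming, in the form that near-optimal curves allow. Apart from
    its initial value, a backward solution enters the later arguments only through these. *)
Definition sol w := [/\ time_continuous w,
  forall gamma a b L, 0 <= a -> has_action w gamma a b L -> w b (gamma b) <= w a (gamma a) + L &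
  forall t x e, 0 <= t -> 0 < e -> exists gamma L,
    [/\ gamma t = x, has_action w gamma 0 t L & w 0 (gamma 0) + L < w t x + e]].

Lemma within_continuous_comp (X Y Z : topologicalType) (D : set Y) (f : Y -> Z) (h : X -> Y) :
  {within D, continuous f} -> continuous h -> (forall x, D (h x)) -> continuous (f \o h).
Proof.
move=> /subspace_continuousP cf ch Dh x P /= nP.
have h1 : \forall y \near h x, D y -> P (f y) by exact: (cf _ (Dh x) _ nP).
have h2 : \forall y \near x, D (h y) -> P (f (h y)) by exact: (ch x _ h1).
by apply: filterS h2 => y /= hy; apply: hy.
Qed.

Lemma has_integral_same (l : R -> \bar R) a L : has_integral l a a L -> L = 0.
Proof.
move=> h; apply/eqP; rewrite eq_le; apply/andP; split.
  have := @has_integral_le_cst R l a a L 0 (lexx a) h; rewrite mul0r; apply.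
  by apply: aeW => s; rewrite lt_asym.
have := @has_integral_le R (fun=> 0%E) l (fun=> 0) (fun=> 0) a a 0 L (lexx a).
rewrite subrr addr0; apply => //.
- by move=> s; exact: cvg_cst.
- exact: has_integral0.
by apply: aeW => s; rewrite lt_asym.
Qed.

Lemma backward_solution_sol phi w : is_backward_solution H phi w -> sol w /\ w 0 = phi.
Proof.
move=> [cw hw].
have cw' : time_continuous w.
  have := @within_continuous_comp (M * R)%type (M * R)%type R _ _ (fun z : M * R => (z.1, Num.max 0 z.2)) cw.
  apply; last by move=> z /=; rewrite le_max lexx.
  move=> z.
  have c2 : {for z, continuous (fun z : M * R => Num.max 0 z.2)}.
    apply: (@continuous_comp _ _ _ (fun z : M * R => z.2) (fun r : R => Num.max 0 r)); first exact: cvg_snd.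
    by apply: (@continuous_max _ _ (fun=> 0) id); [exact: cvg_cst|exact: cvg_id].
  by apply: (@cvg_pair _ _ _ _ (nbhs z.1) (nbhs (Num.max 0 z.2))); [exact: cvg_fst|exact: c2].
have up gamma t L : has_action w gamma 0 t L -> w t (gamma t) <= phi (gamma 0) + L.
  move=> hL; rewrite -lee_fin hw ?(has_action_le hL)// -(has_action_action phi hL).
  by apply: ereal_inf_lbound; exists gamma => //; case: hL.
have low t x e : 0 <= t -> 0 < e -> exists gamma L,
    [/\ gamma t = x, has_action w gamma 0 t L & phi (gamma 0) + L < w t x + e].
  move=> t0 e0; have := hw t x t0 => /esym h.
  have fn : ereal_inf [set action H w phi t gamma | gamma in
      [set gamma | ac_curve A 0 t gamma /\ gamma t = x]] \is a fin_num by rewrite h.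
  have [_ [gamma [cg gx] <-] lt] := lb_ereal_inf_adherent e0 fn.
  have [h1|[L hL h1]] := action_dichotomy phi t0 cw' cg; rewrite h1 h in lt; first by [].
  by exists gamma, L; split => //; move: lt; rewrite -EFinD lte_fin.
(* The initial value is not a clause of [is_backward_solution]: it holds because at [t = 0] every
   finite action vanishes and constant curves have finite action. *)
have w0E : w 0 = phi.
  apply/funext => x; apply/eqP; rewrite eq_le; apply/andP; split.
    have [L h1 _] : exists2 L, has_action w (fun=> x) 0 0 L & L <= 0.
      have [C _ hC] := stay; have [L h2 h3] := hC x 0 0 (lexx 0) (lexx 0).
      have [C' C'0 hC'] := time_continuous_bounded 0 cw'.
      have [|L' h4 h5] := has_action_change_weight (D := C') (lexx 0) time_continuous0 cw' h2.
        move=> s s0; rewrite subr0 (le_trans (hC' s x s0))// ler_peMr// weight_ge1//; by case/andP: s0.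
      by exists L' => //; rewrite subrr mulr0 addr0 in h5; rewrite (le_trans h5)// (le_trans h3)// subrr mulr0.
    have := up _ _ _ h1; have [_ _ hi] := h1.
    by rewrite (has_integral_same hi) addr0.
  apply/ler_addgt0Pr => e e0; have [gamma [L [gx hL h]]] := low 0 x e (lexx 0) e0.
  by move: h; have [_ _ hi] := hL; rewrite (has_integral_same hi) addr0 gx => /ltW.
split => //; split => //; last by rewrite w0E.
move=> gamma a b L a0 hL; apply/ler_addgt0Pr => e e0.
have [gamma1 [L1 [g1 h1 h2]]] := low a (gamma a) e a0 e0.
have h3 := has_action_cat g1 h1 hL; have := up _ _ _ h3.
rewrite /curve_cat a0; have ab := has_action_le hL.
have -> : (if b <= a then gamma1 b else gamma b) = gamma b.
  by case: leP => // ba; have -> : b = a by apply/eqP; rewrite eq_le ab ba.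
by move=> h4; lra.
Qed.

Lemma sol_shift w h : 0 <= h -> sol w -> sol (fun t => w (t + h)).
Proof.
move=> h0 [cw d1 d2]; split.
- exact: time_continuous_shift.
- move=> gamma a b L a0 hL; have ab := has_action_le hL.
  have h1 : has_action (fun t => w (t + h)) gamma (a + h - h) (b + h - h) L by rewrite !addrK.
  have := has_action_shift _ h1; rewrite lerD2r => /(_ ab) h2.
  have e : (fun t => w (t - h + h)) = w by apply/funext => t; rewrite subrK.
  rewrite e in h2; have := d1 _ _ _ _ _ h2; rewrite addr_ge0// => /(_ isT).
  by rewrite !addrK.
move=> t x e t0 e0; have th0 : 0 <= t + h by rewrite addr_ge0.
have [gamma [L [gx hL lt]]] := d2 _ x e th0 e0.
have hth : h <= t + h by rewrite lerDr.
have [L1 [L2 [h1 h2 LE]]] := has_action_split h0 hth hL.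
exists (fun s => gamma (s + h)), L2; split => //.
  by apply: has_action_shift => //; rewrite add0r.
have := d1 _ _ _ _ (lexx 0) h1; rewrite !add0r => h3; lra.
Qed.

(** [s] is the infimum of the starting points of nonnegative stretches ending at [b]; continuity
    makes [f] vanish there unless the stretch reaches back to [a]. It provides the last crossing
    time of a curve. *)
Lemma last_nonneg (f : R -> R) a b : continuous f -> a <= b -> 0 <= f b ->
  exists s, [/\ a <= s <= b, s = a \/ f s = 0 & forall r, s <= r <= b -> 0 <= f r].
Proof.
move=> cf ab fb; pose Z := [set s | a <= s <= b /\ forall r, s <= r <= b -> 0 <= f r].
have Zb : Z b.
  split; first by rewrite ab lexx.
  by move=> r /andP[r1 r2]; have -> : r = b by apply/eqP; rewrite eq_le r1 r2.
have lbZ : lbound Z a by move=> s [/andP[]].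
have iZ : has_inf Z by split; [exists b|exists a].
pose s1 := inf Z.
have as1 : a <= s1 by apply: lb_le_inf => //; exists b.
have s1b : s1 <= b by apply: ge_inf => //; exists a.
have pos r : s1 < r -> r <= b -> 0 <= f r.
  move=> s1r rb; have [z [_ hz] zr] := inf_lt (proj1 iZ) s1r.
  by apply: hz; rewrite rb ltW.
have fs1 : 0 <= f s1.
  rewrite leNgt; apply/negP => fn.
  have [s1b'|bs1] := ltP s1 b; last first.
    have e1 : s1 = b by apply/eqP; rewrite eq_le s1b bs1.
    by move: fn; rewrite e1 ltNge fb.
  have : \forall r \near s1, f r < 0 by exact: (cf s1 _ (lt_nbhsl fn)).
  move=> /nbhs_normP[e /= e0 he].
  pose r := Num.min b (s1 + e / 2).
  have s1r : s1 < r by rewrite /r lt_min s1b' ltrDl divr_gt0.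
  have : f r < 0.
    apply: he; rewrite /= distrC ger0_norm ?subr_ge0 ?ltW// ltrBlDl.
    by rewrite /r gt_min; apply/orP; right; rewrite ltrD2l ltr_pdivrMr// ltr_pMr// ltr1n.
  by rewrite ltNge pos// /r ge_min lexx.
exists s1; split; first by rewrite as1.
  have [->|na] := eqVneq s1 a; first by left.
  right; apply/eqP; rewrite eq_le fs1 andbT leNgt; apply/negP => fp.
  have : \forall r \near s1, 0 < f r by exact: (cf s1 _ (lt_nbhsr fp)).
  move=> /nbhs_normP[e /= e0 he].
  pose r := Num.max a (s1 - e / 2).
  have rs1 : r < s1 by rewrite /r gt_max lt_neqAle eq_sym na as1 ltrBlDr ltrDl divr_gt0.
  have : Z r.
    split; first by rewrite /r le_max lexx/= ltW// (lt_le_trans rs1).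
    move=> z /andP[rz zb]; have [zs1|] := ltP z s1; last first.
      by rewrite le_eqVlt => /predU1P[<-//|/pos]; exact.
    apply/ltW/he; rewrite /= ger0_norm ?subr_ge0 ?ltW// ltrBlDr -ltrBlDl.
    apply: lt_le_trans rz; rewrite /r lt_max; apply/orP; right.
    by rewrite ltrD2l ltrN2 ltr_pdivrMr// ltr_pMr// ltr1n.
  by move=> /(ge_inf (proj2 iZ)); rewrite leNgt rs1.
move=> r /andP[]; rewrite le_eqVlt => /predU1P[<-//|]; exact: pos.
Qed.

Section Comparison.
Variables (w1 w2 : R -> M -> R) (d : R).
Hypotheses (sol1 : sol w1) (sol2 : sol w2) (d0 : 0 <= d) (init : forall x, w1 0 x - w2 0 x <= d).

(* Follow a near-optimal curve of [w2] from the last time at which [w1 - w2] is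
   nonpositive on it: from there on the two actions differ by at most
   [m / 2 * weight t]. *)
Let improve T m : 0 <= m -> (forall s x, 0 <= s <= T -> w1 s x - w2 s x <= m * weight s) ->
  forall t x, 0 <= t <= T -> w1 t x - w2 t x <= (d + m / 2) * weight t.
Proof.
move=> m0 hm t x /andP[t0 tT]; have [c1 D1 _] := sol1; have [c2 D2 E2] := sol2.
have W1 := weight_ge1 t0.
have dm0 : 0 <= d + m / 2 by rewrite addr_ge0 ?divr_ge0.
have [Ft|Ft] := ltP (w1 t x - w2 t x) 0.
  by apply: (le_trans (ltW Ft)); rewrite mulr_ge0// ltW// weight_gt0.
apply/ler_addgt0Pr => e e0; have [gamma [L [gx hL lt]]] := E2 t x e t0 e0.
have [_ [cg _] _] := hL.
pose F s := w1 (clamp 0 t s) (gamma (clamp 0 t s)) - w2 (clamp 0 t s) (gamma (clamp 0 t s)).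
have cF : continuous F.
  move=> s; apply: (@continuousB _ _ _ (fun s => w1 (clamp 0 t s) (gamma (clamp 0 t s)))).
    exact: (time_continuous_curve (lexx 0) t0 c1 cg).
  exact: (time_continuous_curve (lexx 0) t0 c2 cg).
have [|s [/andP[s0 st] Fs hs]] := last_nonneg cF t0.
  by rewrite /F clamp_id ?gx// t0 lexx.
have [L1 [L2 [h1 h2 LE]]] := has_action_split s0 st hL.
have [|L' h3 h4] := has_action_change_weight (D := m) s0 c2 c1 h2.
  move=> r /[dup] rs /andP[sr rt]; have := hs r rs.
  have rr : 0 <= r <= t by rewrite (le_trans s0 sr) rt.
  rewrite /F clamp_id// => h; rewrite ger0_norm// hm//.
  by rewrite (le_trans s0 sr) (le_trans rt tT).
have k1 := D1 _ _ _ _ s0 h3; have k2 := D2 _ _ _ _ (lexx 0) h1; rewrite gx in k1.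
have k3 : w1 s (gamma s) - w2 s (gamma s) <= d.
  case: Fs => [->|]; first exact: init.
  by rewrite /F clamp_id ?s0// => ->.
have k4 : m / 2 * (weight t - weight s) <= m / 2 * weight t.
  by rewrite ler_wpM2l ?divr_ge0// gerBl ltW// weight_gt0.
have k5 : d <= d * weight t by rewrite ler_peMr.
rewrite mulrDl; lra.
Qed.

(** Iterating [improve] from the crude constant [m0] moves towards the fixed point [2 * d] of
    [m |-> d + m / 2], halving the excess each time. *)
Lemma comparison t x : 0 <= t -> w1 t x - w2 t x <= 2 * d * weight t.
Proof.
move=> t0; have [c1 _ _] := sol1; have [c2 _ _] := sol2.
have [C1 C10 hC1] := time_continuous_bounded t c1.
have [C2 C20 hC2] := time_continuous_bounded t c2.
pose m0 := C1 + C2.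
have m00 : 0 <= m0 by rewrite addr_ge0.
have step k : forall s y, 0 <= s <= t -> w1 s y - w2 s y <= (2 * d + m0 / 2 ^+ k) * weight s.
  elim: k => [|k IH] s y sT.
    have /andP[s0 st] := sT.
    have a1 := hC1 s y sT; have a2 := hC2 s y sT.
    apply: (@le_trans _ _ (2 * d + m0)).
      have a3 := le_trans (ler_norm _) a1; have a4 := le_trans (ler_norm _) a2.
      move: a3 a4 (ler_norm (- w2 s y)) ; rewrite normrN => a3 a4 a5.
      have a6 := le_trans a5 a2; apply: (@le_trans _ _ m0); last by rewrite lerDr mulr_ge0.
      by rewrite /m0 -[C2]opprK lerB// lerNl.
    by rewrite expr0 divr1 ler_peMr ?weight_ge1// addr_ge0// mulr_ge0.
  have -> : 2 * d + m0 / 2 ^+ k.+1 = d + (2 * d + m0 / 2 ^+ k) / 2.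
    by rewrite exprS invfM; field; rewrite expf_neq0.
  by apply: improve IH _ _ sT; rewrite addr_ge0 ?mulr_ge0// divr_ge0// exprn_ge0.
apply: (@le_geometric _ _ (m0 * weight t)) => k.
have := step k t x; rewrite t0 lexx => /(_ isT); rewrite mulrDl.
by rewrite (mulrAC m0).
Qed.

End Comparison.

Lemma le_supnorm (f : M -> R) C x : (forall x, `|f x| <= C) -> `|f x| <= supnorm f.
Proof. by move=> h; apply: ub_le_sup; [exists C => _ [y _ <-]|exists x]. Qed.

Lemma supnorm_le (f : M -> R) C : 0 <= C -> (forall x, `|f x| <= C) -> supnorm f <= C.
Proof.
move=> C0 h; have [e|/set0P[x _]] := eqVneq [set: M] set0.
  by rewrite /supnorm e image_set0 sup0.
by apply: ge_sup; [exists `|f x|, x|move=> _ [y _ <-]].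
Qed.

Lemma time_continuous_slice w t : 0 <= t -> time_continuous w -> continuous (w t).
Proof.
move=> t0 cw x.
have e : w t = (fun z : M * R => w (Num.max 0 z.2) z.1) \o (fun x => (x, t)).
  by apply/funext => y /=; rewrite max_r.
rewrite e; apply: continuous_comp; last exact: cw.
by apply: (@cvg_pair _ _ _ _ (nbhs x) (nbhs t)); [exact: cvg_id|exact: cvg_cst].
Qed.

(* Compare [w] with its own time shift by [s], as [s] goes to infinity. *)
Lemma stationary w u : continuous u -> sol w -> w 0 = u ->
  supnorm (w t \- u) @[t --> +oo] --> 0 -> forall t x, 0 <= t -> w t x = u x.
Proof.
move=> cu sw w0u lim t x t0; have [cw _ _] := sw.
have bd s : 0 <= s -> exists C, forall y, `|(w s \- u) y| <= C.
  move=> s0; have [|C hC] := @continuous_bounded M setT (w s \- u) M_compact.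
    by move=> y _; apply: continuousB; [exact: (time_continuous_slice s0 cw)|exact: cu].
  by exists C => y; exact: hC.
have near e : 0 < e -> exists2 s, 0 <= s & forall r y, s <= r -> `|w r y - u y| <= e.
  move=> e0; have [s [_ hs]] : \forall s \near +oo, supnorm (w s \- u) < e.
    by have /cvgrPdist_lt/(_ _ e0) := lim; apply: filterS => s; rewrite sub0r normrN; apply: le_lt_trans; exact: ler_norm.
  exists (Num.max 0 (s + 1)); first by rewrite le_max lexx.
  move=> r y; rewrite ge_max => /andP[r0 sr]; have [C hC] := bd r r0.
  apply: le_trans (le_supnorm y hC) _; apply/ltW/hs.
  by rewrite (lt_le_trans _ sr)// ltrDl.
have W0 := weight_gt0 t.
have bound e : 0 < e -> `|w t x - u x| <= (2 * weight t + 1) * e.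
  move=> e0; have [s s0 hs] := near e e0.
  have ss := sol_shift s0 sw.
  have i1 y : w (0 + s) y - w 0 y <= e.
    by rewrite add0r w0u; apply: le_trans (ler_norm _) (hs _ _ (lexx s)).
  have i2 y : w 0 y - w (0 + s) y <= e.
    by rewrite add0r w0u; apply: le_trans (ler_norm _) _; rewrite distrC hs.
  have c1 := comparison ss sw (ltW e0) i1 x t0.
  have c2 := comparison sw ss (ltW e0) i2 x t0.
  have := hs (t + s) x; rewrite lerDr => /(_ t0); rewrite ler_norml => /andP[a1 a2].
  rewrite mulrDl mul1r (mulrAC 2) ler_norml; apply/andP; split; lra.
apply/eqP; rewrite -subr_eq0 -normr_le0; apply/ler_addgt0Pr => e e0; rewrite add0r.
have k0 : 0 < 2 * weight t + 1 by rewrite addr_gt0// mulr_gt0.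
have := bound (e / (2 * weight t + 1)) (divr_gt0 e0 k0).
by rewrite mulrC divfK// gt_eqF.
Qed.

Definition chart_lipschitz (u : M -> R) c K r := forall y z,
  `|chart A c c - y| < r -> `|chart A c c - z| < r -> `|u (cinv A c y) - u (cinv A c z)| <= K * `|y - z|.

(** Take the covector [K *: q] with [q] norming the chart displacement: [has_action_ge_pairing]
    bounds [K] times the displacement, hence the increase of [u], by the action plus [C * (b - a)].
    Real induction joins the charts. The result is the hypothesis [phi_dominated] of the existence
    proof. *)
Lemma lipschitz_dominated (u : M -> R) :
  (forall c, exists2 K, 0 <= K & exists2 r, 0 < r & chart_lipschitz u c K r) ->
  exists2 C, 0 <= C & forall gamma a b L, 0 <= a -> has_action w0 gamma a b L ->
    u (gamma b) <= u (gamma a) + L + C * (b - a).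
Proof.
move=> lip; pose near_bound (U : set M) C := forall gamma a b L, 0 <= a -> has_action w0 gamma a b L ->
  (forall s, a <= s <= b -> U (gamma s)) -> u (gamma b) <= u (gamma a) + L + C * (b - a).
have [||C hC] := @compact_bound R M (fun x C => exists2 U, nbhs x U & near_bound U C) M_compact.
- move=> x C C' [U nU hU] CC; exists U => // gamma a b L a0 hL gU.
  apply: le_trans (hU _ _ _ _ a0 hL gU) _; rewrite lerD2l ler_wpM2r// subr_ge0.
  exact: has_action_le hL.
- move=> c; have [K K0 [r r0 hK]] := lip c; have dc := dom_center A c.
  have [C hC] := bounded_chart H_C3 H_lipschitz K (img_chart dc).
  pose U := [set x | [/\ dom A c x, `|chart A c c - chart A c x| < r &
    forall q u, `|q| <= K -> `|in_chart H c (chart A c x) q u| <= C + lambda * `|u|]].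
  have nU : \forall x \near c, U x.
    have n1 := near_dom dc; have n2 := near_chart dc (near_norm (chart A c c) r0).
    have n3 := near_chart dc hC.
    by apply: filterS3 n1 n2 n3 => x h1 h2 h3; split.
  have bU : near_bound U C.
    move=> gamma a b L a0 hL gU; have ab := has_action_le hL.
    have [e|nab] := eqVneq a b.
      move: hL; rewrite -e => -[_ _ hi].
      by rewrite (has_integral_same hi) subrr mulr0 !addr0.
    have {nab}ltab : a < b by rewrite lt_neqAle nab.
    have [q [q1 qe]] := norm_pairing (chart A c (gamma b) - chart A c (gamma a)).
    have hd s : a <= s <= b -> dom A c (gamma s) by move=> /gU[].
    have hm s : a < s < b -> in_chart H c (chart A c (gamma s)) (K *: q) (w0 s (gamma s)) <= C.
      move=> /andP[s1 s2]; have [|_ _ h] := gU s; first by rewrite !ltW.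
      have := h (K *: q) 0; rewrite normr0 mulr0 addr0 normrZ (ger0_norm K0) => h1.
      by apply: le_trans (ler_norm _) (h1 _); rewrite ler_piMr.
    have := has_action_ge_pairing ltab hL hd hm.
    rewrite pairingZr qe.
    have [|da ra _] := gU a; first by rewrite lexx.
    have [|db rb _] := gU b; first by rewrite lexx ab.
    have := hK _ _ rb ra; rewrite !chartK// => h1 h2.
    have := le_trans (ler_norm _) h1; lra.
  by exists C; have := near_join nU; apply: filterS => x hx; exists U.
exists `|C| => // gamma a b L a0 hL; have ab := has_action_le hL; have [_ [cg _] _] := hL.
have hC' (x : M) : exists2 U, nbhs x U & near_bound U `|C|.
  have [U nU hU] := hC x; exists U => // g1 a1 b1 L1 a10 h1 gU.
  apply: le_trans (hU _ _ _ _ a10 h1 gU) _; rewrite lerD2l ler_wpM2r ?ler_norm// subr_ge0.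
  exact: has_action_le h1.
suff : forall L, has_action w0 gamma a b L -> u (gamma b) <= u (gamma a) + L + `|C| * (b - a) by exact.
apply: (@itv_local_global R (fun r s => forall L, has_action w0 gamma r s L ->
  u (gamma s) <= u (gamma r) + L + `|C| * (s - r)) a b ab).
  move=> r s t ar rs st tb h1 h2 L1 hL1.
  have [L2 [L3 [k1 k2 ->]]] := has_action_split rs st hL1.
  have := h1 _ k1; have := h2 _ k2; lra.
move=> s sab; have [U nU hU] := hC' (gamma s).
have [e e0 he] := near_within_continuous ab cg sab nU.
exists e => // s1 s2 as1 s12 s2b d1 d2 L1 hL1; apply: hU hL1 _; first exact: le_trans as1.
move=> r /andP[r1 r2]; apply: he; first by rewrite (le_trans as1 r1) (le_trans r2 s2b).
move: d1 d2; rewrite !ltr_norml => /andP[d1 _] /andP[_ d2].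
by rewrite (lt_le_trans d1) ?lerD2r// (le_lt_trans _ d2)// lerD2r.
Qed.

(** * Test functions *)

Section C1.
Implicit Types (V W : normedModType R).

(** Differentiability is required on a neighbourhood, so the notion depends only on the germ of [f]
    and can be moved between charts. *)
Definition C1_at V W (f : V -> W) x := (\forall y \near x, differentiable f y) /\
  forall v, {for x, continuous (fun y => 'D_v f y)}.

Lemma near_eq_continuous (X Y : topologicalType) (f h : X -> Y) (x : X) :
  (\forall y \near x, f y = h y) -> {for x, continuous f} -> {for x, continuous h}.
Proof.
move=> e cf P /=; rewrite -(nbhs_singleton e) => nP.
have h1 : \forall y \near x, P (f y) by exact: cf nP.
by apply: filterS2 e h1 => y /= <-.
Qed.

Lemma C1_eq V W (f h : V -> W) x : (\forall y \near x, f y = h y) -> C1_at f x -> C1_at h x.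
Proof.
move=> e [df cf]; have ee := near_join e; split.
  apply: filterS2 ee df => y ey dy.
  have [d hd] : exists d, is_diff y f d by exists ('d f y); exact: DiffDef.
  by have [] := near_eq_is_diff ey (differentiableP dy).
move=> v; apply: near_eq_continuous (cf v).
by apply: filterS ee => y ey; exact: near_eq_derive.
Qed.

Lemma Ck_on1_at V W U (f : V -> W) x : open U -> Ck_on 1 U f -> U x -> C1_at f x.
Proof.
move=> oU [df cf] Ux; split; last by move=> v; exact: cf.
by have := open_nbhs_nbhs (conj oU Ux); apply: filterS => y; exact: df.
Qed.

Lemma at_Ck_on1 V W U (f : V -> W) : (forall x, U x -> C1_at f x) -> Ck_on 1 U f.
Proof.
move=> h; split; first by move=> x /h[/nbhs_singleton].
by move=> v x /h[_]; exact.
Qed.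

Lemma C1_cst V W (k : W) (x : V) : C1_at (fun _ => k) x.
Proof.
split; first by apply: filterE => y; exact: differentiable_cst.
move=> v; have -> : (fun y : V => 'D_v (fun _ : V => k) y) = (fun=> 0); last exact: cvg_cst.
by apply/funext => y; exact: (derive_cst k).
Qed.

Lemma C1D V W (f h : V -> W) x : C1_at f x -> C1_at h x -> C1_at (fun y => f y + h y) x.
Proof.
move=> [df cf] [dh ch]; split.
  by apply: filterS2 df dh => y d1 d2; exact: differentiableD.
move=> v; apply: (@near_eq_continuous _ _ (fun y => 'D_v f y + 'D_v h y)).
  apply: filterS2 df dh => y d1 d2.
  by rewrite -deriveD//; exact: diff_derivable.
by apply: cvgD; [exact: cf|exact: ch].
Qed.

Lemma C1M V (f h : V -> R^o) x : C1_at f x -> C1_at h x -> C1_at (fun y => f y * h y : R^o) x.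
Proof.
move=> [df cf] [dh ch]; split.
  by apply: filterS2 df dh => y d1 d2; exact: differentiableM.
move=> v; apply: (@near_eq_continuous _ _ (fun y => f y * 'D_v h y + h y * 'D_v f y)).
  apply: filterS2 df dh => y d1 d2.
  by rewrite -[RHS]/('D_v (f * h) y) deriveM//; exact: diff_derivable.
apply: cvgD; apply: cvgM.
- by apply: differentiable_continuous; exact: nbhs_singleton df.
- exact: ch.
- by apply: differentiable_continuous; exact: nbhs_singleton dh.
- exact: cf.
Qed.

Lemma C1_sum V (I : Type) (r : seq I) (f : I -> V -> R^o) x : (forall i, C1_at (f i) x) ->
  C1_at (fun y => \sum_(i <- r) f i y : R^o) x.
Proof.
move=> h; elim: r => [|i r IH].
  by rewrite (_ : (fun y => _) = (fun=> 0)); [exact: C1_cst|apply/funext => y; rewrite big_nil].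
rewrite (_ : (fun y => _) = (fun y => f i y + \sum_(j <- r) f j y)); first exact: (C1D (h i) IH).
by apply/funext => y; rewrite big_cons.
Qed.

Lemma C1_coord m j (x : 'rV[R]_m) : C1_at (fun y : 'rV[R]_m => y 0 j : R^o) x.
Proof.
have df y : differentiable (fun y : 'rV[R]_m => y 0 j : R^o) y by exact: differentiable_coord.
split; first by apply: filterE => y.
move=> v; apply: (@near_eq_continuous _ _ (fun=> v 0 j : R^o)); last exact: cst_continuous.
apply: filterE => y.
have [_ e0] : is_derive (0 : R) 1 (fun t : R => (t *: v + y) 0 j : R^o) (v 0 j).
  have h1 := is_deriveD (is_derive_cst (y 0 j : R^o) (0 : R^o) 1) (is_deriveZ (v 0 j) (is_derive_id (0 : R^o) (1 : R^o))).
  have e1 : (fun t : R => (t *: v + y) 0 j) = (cst (y 0 j : R^o) + v 0 j \*: id).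
    by apply/funext => t; rewrite !mxE /= addrC mulrC.
  by rewrite e1; move: h1; rewrite add0r /GRing.scale/= mulr1.
have lE (h r z : R^o) : (h *: r + z) *: v + y = h *: (r *: v) + (z *: v + y).
  by rewrite scalerDl addrA scalerA.
have := @derive_slice _ _ R^o _ (fun y : 'rV[R]_m => y 0 j : R^o) (fun t : R => t *: v + y) (fun t => t *: v) 1 0 lE.
by rewrite scale1r scale0r add0r => <-; rewrite -e0.
Qed.

Lemma C1_comp_real V (s s' : R -> R) (f : V -> R^o) x : (forall t : R, is_derive t 1 s (s' t)) ->
  continuous s' -> C1_at f x -> C1_at (fun y => s (f y) : R^o) x.
Proof.
move=> ds cs [df cf].
have dS t : differentiable (s : R^o -> R^o) t by apply/derivable1_diffP; case: (ds t).
split; first by apply: filterS df => y dy; apply: differentiable_comp.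
move=> v; apply: (@near_eq_continuous _ _ (fun y => s' (f y) * 'D_v f y)).
  apply: filterS df => y dy.
  have h0 : 'D_v ((s : R^o -> R^o) \o f) y = 'd ((s : R^o -> R^o) \o f) y v.
    by apply: deriveE; exact: differentiable_comp.
  have h1 := congr1 (fun F : V -> R^o => F v) (diff_comp dy (dS (f y))).
  rewrite [RHS](etrans h0 h1) /= deriveE//; set r := 'd f y v.
  have -> : r = r *: (1 : R^o) by rewrite /GRing.scale/= mulr1.
  rewrite linearZ/= -deriveE//; have [_ ->] := ds (f y).
  by rewrite /GRing.scale/= mulr1 mulrC.
apply: cvgM; last exact: cf.
apply: continuous_comp; last exact: cs.
by apply: differentiable_continuous; exact: nbhs_singleton df.
Qed.

Lemma C1_comp V m (F : 'rV[R]_m -> R^o) (T : V -> 'rV[R]_m) x : C1_at T x -> C1_at F (T x) ->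
  C1_at (fun y => F (T y) : R^o) x.
Proof.
move=> [dT cT] [dF cF].
have cTx : {for x, continuous T}.
  by apply: differentiable_continuous; exact: nbhs_singleton dT.
have dF' : \forall y \near x, differentiable F (T y) by exact: cTx dF.
split; first by apply: filterS2 dT dF' => y d1 d2; exact: differentiable_comp.
move=> v; apply: (@near_eq_continuous _ _ (fun y => \sum_j 'D_v T y 0 j * 'D_('e_j) F (T y))).
  apply: filterS2 dT dF' => y d1 d2.
  have h0 : 'D_v (F \o T) y = 'd (F \o T) y v by apply: deriveE; exact: differentiable_comp.
  have h1 := congr1 (fun F : V -> R^o => F v) (diff_comp d1 d2).
  have h2 : 'd T y v = 'D_v T y by rewrite deriveE.
  rewrite [RHS](etrans h0 h1) /= h2; set w := 'D_v T y.
  rewrite [in RHS](row_sum_delta w) linear_sum; apply: eq_bigr => j _.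
  by rewrite linearZ/= deriveE.
apply: cvg_big => [|j _]; first exact: add_continuous.
apply: cvgM.
  apply: (@continuous_comp _ _ _ (fun y => 'D_v T y) (fun z : 'rV[R]_m => z 0 j)); [exact: cT|exact: coord_continuous].
by apply: (@continuous_comp _ _ _ T (fun z => 'D_('e_j) F z)); [exact: cTx|exact: cF].
Qed.

End C1.

Section TestFunctions.
Hypothesis M_hausdorff : hausdorff_space M.

Definition C1_fun (f : M -> R) := forall d y, img A d y -> C1_at (f \o cinv A d : _ -> R^o) y.

Lemma Ck1E (f : M -> R) : Ck A 1 f <-> C1_fun f.
Proof.
split => h d; last by apply: at_Ck_on1 => y; exact: h.
by move=> y; apply: Ck_on1_at (h d); exact: img_open.
Qed.

Lemma transition_C1 c d y : img A c y -> dom A d (cinv A c y) -> C1_at (chart A d \o cinv A c) y.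
Proof.
move=> cy dy; have oU : open [set z | img A c z /\ dom A d (cinv A c z)].
  rewrite openE => z [cz dz] /=; exact: near_overlap.
apply: (Ck_on1_at oU) => //.
have [h1 h2] := chart_smooth A c d 1; split => [z [cz dz]|v z [cz dz]].
  by apply: h1; exact: overlapP.
by apply: h2; exact: overlapP.
Qed.

(** Transition maps are continuously differentiable, so one chart per point decides regularity in
    all of them. *)
Lemma C1_fun_local (f : M -> R) : (forall x, exists2 c, dom A c x & C1_at (f \o cinv A c : _ -> R^o) (chart A c x)) ->
  C1_fun f.
Proof.
move=> h d y dy; have [c cx hf] := h (cinv A d y).
apply: (@C1_eq _ _ (fun z => (f \o cinv A c) ((chart A c \o cinv A d) z) : R^o)).
  by have := near_overlap dy cx; apply: filterS => z [_ cz] /=; rewrite chartK.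
by apply: C1_comp hf; exact: transition_C1.
Qed.

Lemma C1_fun_continuous f : C1_fun f -> continuous f.
Proof.
move=> h x; have cx := dom_center A x; have [df _] := h x _ (img_chart cx).
apply: (@near_eq_continuous _ _ ((f \o cinv A x) \o chart A x)).
  by have := near_dom cx; apply: filterS => y dy /=; rewrite chartK.
apply: continuous_comp; first exact: chart_continuous.
exact: (differentiable_continuous (nbhs_singleton df)).
Qed.

Lemma C1_fun_cst k : C1_fun (fun=> k). Proof. by move=> d y _; exact: C1_cst. Qed.
Lemma C1_funD f h : C1_fun f -> C1_fun h -> C1_fun (fun x => f x + h x).
Proof. by move=> cf ch d y dy; apply: C1D; [exact: cf|exact: ch]. Qed.
Lemma C1_funM f h : C1_fun f -> C1_fun h -> C1_fun (fun x => f x * h x).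
Proof. by move=> cf ch d y dy; apply: C1M; [exact: cf|exact: ch]. Qed.
Lemma C1_fun_sum m (f : 'I_m -> M -> R) : (forall i, C1_fun (f i)) -> C1_fun (fun x => \sum_i f i x).
Proof. by move=> h d y dy; apply: C1_sum => i; exact: h. Qed.

(** Hausdorff separation makes the compact image closed in all of [M], not merely in the chart
    domain; functions constant outside it are then regular across the boundary of the domain. *)
Lemma closed_cinv c K : compact K -> K `<=` img A c -> closed (cinv A c @` K).
Proof.
move=> cK Ki; apply: compact_closed => //; apply: continuous_compact => //.
by apply: continuous_in_subspaceT => y /set_mem/Ki iy; exact: cinv_continuous.
Qed.

(** Squared Euclidean distance: the norm of ['rV[R]_n] is the sup norm, whose square is not
    smooth. *)
Definition sqdist (y z : 'rV[R]_n) : R := \sum_j (y 0 j - z 0 j) ^+ 2.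

Definition sqpos (t : R) : R := (Num.max 0 t) ^+ 2.

Lemma is_derive_sqpos (t : R) : is_derive t 1 sqpos (2 * Num.max 0 t).
Proof.
have cpos : continuous (fun t : R => Num.max 0 t).
  by move=> s; apply: (@continuous_max _ _ (fun=> 0) id); [exact: cvg_cst|exact: cvg_id].
have [t0|t0|t0] := ltgtP t 0.
- rewrite mulr0; have h : is_derive t 1 (cst 0 : R -> R^o) 0 by exact: is_derive_cst.
  apply: (near_eq_is_derive _ h).
  have := lt_nbhsl t0; apply: filterS => s s0.
  by rewrite /sqpos max_l ?expr0n// ltW.
- have h : is_derive t 1 (fun s : R => s ^+ 2 : R^o) (2 * t).
    have := is_deriveM (is_derive_id t (1 : R^o)) (is_derive_id t (1 : R^o)).
    rewrite (_ : _ *: _ + _ = 2 * t); last by rewrite /GRing.scale/= mulr1 mulr_natl mulr2n.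
    by rewrite (_ : _ * _ = (fun s : R => s ^+ 2))//; apply/funext => s; rewrite expr2.
  apply: (near_eq_is_derive _ h).
  by have := lt_nbhsr t0; apply: filterS => s s0; rewrite /sqpos max_r// ltW.
- rewrite t0 ?maxxx mulr0.
  have h : (fun h : R => h^-1 *: (sqpos (h *: 1 + 0) - sqpos 0)) @ 0^' --> (0 : R^o).
    apply/cvgrPdist_lt => e e0; near=> h.
    have hn : h != 0 by near: h; exact: nbhs_dnbhs_neq.
    have he : `|h| < e.
      by near: h; exact: dnbhs0_lt.
    rewrite sub0r normrN /sqpos addr0 maxxx expr0n subr0 /GRing.scale/= mulr1.
    apply: le_lt_trans he; have [h0|h0] := leP 0 h.
      by rewrite expr2 mulrA mulVf// mul1r.
    by rewrite expr0n mulr0 normr0.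
  split; first by apply/cvg_ex; exists (0 : R^o).
  exact: cvg_lim h.
Unshelve. all: by end_near.
Qed.

(** A C1 bump from two uses of [sqpos]: the inner one is at least 1 for [t <= r] and 0 for
    [2 * r <= t], and the outer one flattens these ranges to the exact values 1 and 0. *)
Definition plateau (r t : R) : R := 1 - sqpos (1 - sqpos (2 - t / r)).

Lemma plateau1 r t : 0 < r -> t <= r -> plateau r t = 1.
Proof.
move=> r0 tr; rewrite /plateau (_ : sqpos (1 - _) = 0) ?subr0// /sqpos max_l ?expr0n//.
have h : 1 <= 2 - t / r by have : t / r <= 1; [rewrite ler_pdivrMr// mul1r|lra].
by rewrite subr_le0 max_r ?(le_trans _ h)// exprn_ege1.
Qed.

Lemma plateau0 r t : 0 < r -> 2 * r <= t -> plateau r t = 0.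
Proof.
move=> r0 tr; rewrite /plateau (_ : sqpos (2 - _) = 0).
  by rewrite subr0 /sqpos max_r// expr1n subrr.
by rewrite /sqpos max_l ?expr0n// subr_le0 ler_pdivlMr.
Qed.

Lemma C1_sqpos (V : normedModType R) (f : V -> R^o) (x : V) : C1_at f x -> C1_at (fun y => sqpos (f y) : R^o) x.
Proof.
apply: C1_comp_real is_derive_sqpos _ => t; apply: cvgM; first exact: cvg_cst.
by apply: (@continuous_max _ _ (fun=> 0) id); [exact: cvg_cst|exact: cvg_id].
Qed.

Lemma C1_plateau (V : normedModType R) (r : R) (f : V -> R^o) (x : V) : C1_at f x -> C1_at (fun y => plateau r (f y) : R^o) x.
Proof.
move=> cf; have neg (h : V -> R^o) : C1_at h x -> C1_at (fun y => - 1 * h y : R^o) x.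
  by move=> ch; apply: (C1M _ ch); exact: C1_cst.
have e : (fun y => plateau r (f y)) =
    (fun y => 1 + -1 * sqpos (1 + -1 * sqpos (2 + -1 * (f y * r^-1)))).
  by apply/funext => y; rewrite !mulN1r.
rewrite e; apply: C1D; first exact: C1_cst.
apply: (neg (fun y => sqpos (1 + -1 * sqpos (2 + -1 * (f y * r^-1))))).
apply: (C1_sqpos (f := fun y => 1 + -1 * sqpos (2 + -1 * (f y * r^-1)))).
apply: C1D; first exact: C1_cst.
apply: (neg (fun y => sqpos (2 + -1 * (f y * r^-1)))).
apply: (C1_sqpos (f := fun y => 2 + -1 * (f y * r^-1))).
apply: C1D; first exact: C1_cst.
apply: (neg (fun y => f y * r^-1)).
by apply: (C1M cf); exact: C1_cst.
Qed.

Lemma C1_sqdist (z x : 'rV[R]_n) : C1_at (fun y => sqdist y z : R^o) x.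
Proof.
rewrite /sqdist; apply: (@C1_sum _ _ _ (fun j (y : 'rV[R]_n) => (y 0 j - z 0 j) ^+ 2 : R^o) x _) => j.
have h : C1_at (fun y : 'rV[R]_n => y 0 j - z 0 j : R^o) x.
  by apply: C1D; [exact: C1_coord|exact: C1_cst].
by have := C1M h h.
Qed.

Lemma row_norm_le (v : 'rV[R]_n) (e : R) : 0 <= e -> (forall j, `|v 0 j| <= e) -> `|v| <= e.
Proof.
move=> e0 h; rewrite -[leLHS]/(mx_norm _) mx_normrE.
elim/big_ind: _ => [//|a1 a2 h1 h2|[i j] _ /=]; first by rewrite ge_max h1.
by rewrite ord1.
Qed.

Lemma sqdist_ge0 y z : 0 <= sqdist y z.
Proof. by apply: sumr_ge0 => j _; exact: sqr_ge0. Qed.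

Lemma norm_sqdist y z : `|y - z| ^+ 2 <= sqdist y z.
Proof.
have s0 := sqdist_ge0 y z.
rewrite -(sqr_sqrtr s0) ler_sqr ?nnegrE ?sqrtr_ge0//.
apply: row_norm_le => [|j]; first exact: sqrtr_ge0.
rewrite -sqrtr_sqr ler_sqrt// /sqdist (bigD1 j)//= !mxE lerDl sumr_ge0// => k _.
exact: sqr_ge0.
Qed.

Lemma sqdist_norm y z : sqdist y z <= n%:R * `|y - z| ^+ 2.
Proof.
rewrite /sqdist; apply: (@le_trans _ _ (\sum_(j < n) `|y - z| ^+ 2)).
  apply: ler_sum => j _; rewrite -real_normK ?num_real// ler_sqr ?nnegrE//.
  by have := coord_norm_le (y - z) j; rewrite !mxE.
by rewrite sumr_const card_ord mulr_natl.
Qed.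

Lemma sqdistxx y : sqdist y y = 0.
Proof. by rewrite /sqdist big1// => j _; rewrite subrr expr0n. Qed.

Lemma sqdist_continuous z : continuous (fun y => sqdist y z).
Proof.
move=> y; have [df _] := C1_sqdist z y.
exact: (differentiable_continuous (nbhs_singleton df)).
Qed.

Lemma compact_sqdist z s : compact [set y | sqdist y z <= s].
Proof.
apply: (subclosed_compact _ (@compact_ball R n (`|s| + 1) z)).
  have -> : [set y | sqdist y z <= s] = (fun y => sqdist y z) @^-1` [set t | t <= s] by [].
  apply: closed_comp => [y _|]; [exact: sqdist_continuous|exact: closed_le].
move=> y /= ys; have := le_trans (norm_sqdist y z) ys => h.
have h1 : 0 <= `|s| + 1 by rewrite addr_ge0.
rewrite -ler_sqr ?nnegrE// (le_trans h)// (le_trans (ler_norm s))//.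
have : 0 <= `|s| by []. nra.
Qed.

(** * Extending functions from a chart to the manifold *)

Section Extension.
Variables (c : M) (r : R).
Hypotheses (r0 : 0 < r) (r_img : forall y, sqdist y (chart A c c) <= 3 * r -> img A c y).
Let y0 := chart A c c.

(** Intended for [F] equal to [k] beyond [2 * r]: on the ring up to [3 * r] both branches agree, so
    the cut creates no seam. *)
Definition extension (F : 'rV[R]_n -> R) (k : R) (x : M) : R :=
  if `[< dom A c x /\ sqdist (chart A c x) y0 < 3 * r >] then F (chart A c x) else k.

Lemma C1_extension F k : (forall y, C1_at (F : _ -> R^o) y) ->
  (forall y, 2 * r <= sqdist y y0 -> F y = k) -> C1_fun (extension F k).
Proof.
move=> cF Fk; have r23 : 2 * r <= 3 * r by rewrite ler_pM2r// ler_nat.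
apply: C1_fun_local => x.
have [[dx sx]|nx] := pselect (dom A c x /\ sqdist (chart A c x) y0 < 3 * r).
  exists c => //; apply: (@C1_eq _ _ F); last exact: cF.
  have n1 : \forall y \near chart A c x, sqdist y y0 < 3 * r.
    exact: (sqdist_continuous (lt_nbhsl sx)).
  apply: filterS2 n1 (near_img (img_chart dx)) => y h1 h2 /=.
  rewrite /extension; case: asboolP => [_|[]]; rewrite cinvK//.
  by split => //; exact: dom_cinv.
exists x; first exact: dom_center.
have cK : closed (cinv A c @` [set y | sqdist y y0 <= 2 * r]).
  apply: closed_cinv; first exact: compact_sqdist.
  by move=> y /= h; apply: r_img; exact: le_trans h r23.
have nK : \forall x' \near x, ~ (cinv A c @` [set y | sqdist y y0 <= 2 * r]) x'.
  apply: open_nbhs_nbhs; split; first by rewrite openC.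
  move=> [y /= hy yx]; apply: nx.
  have iy : img A c y by apply: r_img; exact: le_trans hy r23.
  rewrite -yx cinvK//; split; first exact: dom_cinv.
  by rewrite (le_lt_trans hy)// ltr_pM2r// ltr_nat.
apply: (@C1_eq _ _ (fun=> k)); last exact: C1_cst.
have ix := img_chart (dom_center A x).
have nx' : \forall x' \near cinv A x (chart A x x), ~ (cinv A c @` [set y | sqdist y y0 <= 2 * r]) x'.
  by rewrite chartK//; exact: dom_center.
have := near_cinv ix nx'; apply: filterS => z h /=; rewrite /extension.
case: asboolP => // -[h1 h2]; rewrite Fk// leNgt; apply/negP => h3; apply: h.
by exists (chart A c (cinv A x z)); [exact: ltW|rewrite chartK].
Qed.

Lemma extensionE F k x : dom A c x -> sqdist (chart A c x) y0 <= r -> extension F k x = F (chart A c x).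
Proof.
move=> dx sx; rewrite /extension; case: asboolP => // -[]; split => //.
by rewrite (le_lt_trans sx)// ltr_pMl// ltr1n.
Qed.

Definition cutoff := extension (fun y => plateau r (sqdist y y0)) 0.

Lemma C1_cutoff : C1_fun cutoff.
Proof.
apply: C1_extension => [y|y]; last exact: plateau0.
by apply: C1_plateau; exact: C1_sqdist.
Qed.

Lemma cutoff1 x : dom A c x -> sqdist (chart A c x) y0 <= r -> cutoff x = 1.
Proof. by move=> dx sx; rewrite /cutoff extensionE// plateau1. Qed.

Lemma cutoff_gt0 x : 0 < cutoff x -> dom A c x /\ sqdist (chart A c x) y0 < 2 * r.
Proof.
rewrite /cutoff /extension; case: asboolP => [[dx _]|_]; last by rewrite ltxx.
by move=> h; split => //; rewrite ltNge; apply/negP => h1; move: h; rewrite plateau0// ltxx.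
Qed.

Definition coordinate j := extension
  (fun y => y0 0 j + plateau r (sqdist y y0) * (y 0 j - y0 0 j)) (y0 0 j).

Lemma C1_coordinate j : C1_fun (coordinate j).
Proof.
apply: C1_extension => [y|y h]; last by rewrite plateau0// mul0r addr0.
apply: C1D; first exact: C1_cst.
apply: C1M; first by apply: C1_plateau; exact: C1_sqdist.
by apply: C1D; [exact: C1_coord|exact: C1_cst].
Qed.

(** A global C1 function that coincides with the squared chart distance to [z] near the center; it
    serves as penalty in test functions. *)
Definition square (z : 'rV[R]_n) (x : M) : R := \sum_j (coordinate j x - z 0 j) * (coordinate j x - z 0 j).

Lemma C1_square z : C1_fun (square z).
Proof.
apply: C1_fun_sum => j; have h : C1_fun (fun x => coordinate j x - z 0 j).
  by apply: C1_funD; [exact: C1_coordinate|exact: C1_fun_cst].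
exact: C1_funM.
Qed.

Lemma squareE z x : dom A c x -> sqdist (chart A c x) y0 <= r -> square z x = sqdist (chart A c x) z.
Proof.
move=> dx sx; apply: eq_bigr => j _; rewrite /coordinate extensionE// plateau1// mul1r.
by rewrite expr2 (addrC (y0 0 j)) subrK.
Qed.

End Extension.

Lemma sqdist_img c : exists2 r, 0 < r & forall y, sqdist y (chart A c c) <= 3 * r -> img A c y.
Proof.
have /nbhs_normP[e /= e0 he] := near_img (img_chart (dom_center A c)).
exists (e ^+ 2 / 4); first by rewrite divr_gt0// exprn_gt0.
move=> y hy; apply: he => /=; rewrite distrC -ltr_sqr ?nnegrE ?(ltW e0)//.
apply: le_lt_trans (norm_sqdist _ _) _; apply: le_lt_trans hy _.
have : 0 < e ^+ 2 by rewrite exprn_gt0.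
lra.
Qed.

(** [differential] uses a chart that changes with the point; by the chain rule the equation can be
    read in the fixed chart [c], where gradients vary continuously. *)
Lemma differential_chart f c y : C1_fun f -> img A c y ->
  cotangent_of_chart A c (y, gradient (f \o cinv A c) y) = (cinv A c y, differential A f (cinv A c y)).
Proof.
move=> cf cy; rewrite cotangent_of_chartE; congr pair; set x := cinv A c y.
pose T := chart A c \o cinv A x; pose z0 := chart A x x.
have dx := dom_cinv cy; have xx := dom_center A x.
have iz : img A x z0 := img_chart xx.
have dz : dom A c (cinv A x z0) by rewrite /z0 chartK.
have dT : differentiable T z0 by exact: transition_differentiable.
have Tz : T z0 = y by rewrite /T /= /z0 chartK// /x cinvK.
have dF : differentiable (f \o cinv A c : _ -> R^o) (T z0).
  by rewrite Tz; have [h _] := cf c y cy; exact: nbhs_singleton h.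
apply/rowP => j; rewrite /differential [RHS]mxE.
have e : \forall z \near z0, (f \o cinv A x) z = ((f \o cinv A c) \o T) z.
  by have := near_overlap iz dz; apply: filterS => z [_ cz]; rewrite /= chartK.
have e1 := near_eq_derive (V := 'rV[R]_n) (W := R^o) (delta_mx 0 j) e; rewrite e1.
have h0 : 'D_(delta_mx 0 j) ((f \o cinv A c : _ -> R^o) \o T) z0 =
    'd ((f \o cinv A c : _ -> R^o) \o T) z0 (delta_mx 0 j).
  by apply: deriveE; exact: differentiable_comp.
have h1 := congr1 (fun F : 'rV[R]_n -> R^o => F (delta_mx 0 j)) (diff_comp dT dF).
rewrite [RHS](etrans h0 h1) /= -deriveE// derive_gradient// Tz.
rewrite /chart_cotangent -/x -/T -/z0 -mul_jacobian pairingC.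
by rewrite [LHS]mxE pairingE; apply: eq_bigr => k _; rewrite -rowE !mxE.
Qed.

(** The form in which continuity of the equation enters Perron's method; for the perturbed
    Hamiltonian two such estimates are added. *)
Lemma near_differential (K : cotangent A * R -> R) f c y0 u0 (e : R) : Ck_cotangent 3 K -> C1_fun f ->
  img A c y0 -> 0 < e -> \forall z \near (y0, u0),
  `|in_chart K c y0 (gradient (f \o cinv A c) y0) u0 -
    in_chart K c z.1 (gradient (f \o cinv A c) z.1) z.2| < e.
Proof.
move=> cK cf iy e0; set q0 := gradient _ y0.
have [[S1 S2] [/= h1 h2] h] := near_chart_cont cK q0 u0 iy e0.
have cq : {for y0, continuous (gradient (f \o cinv A c))}.
  have [_ cd] := cf c y0 iy.
  move=> P /nbhs_normP[d /= d0 hd].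
  suff : \forall y \near y0, P (gradient (f \o cinv A c) y) by exact.
  have hj : \forall y \near y0, forall j, `|gradient (f \o cinv A c) y0 0 j - gradient (f \o cinv A c) y 0 j| < d / 2.
    have hj j : \forall y \near y0, `|gradient (f \o cinv A c) y0 0 j - gradient (f \o cinv A c) y 0 j| < d / 2.
      have /cvgrPdist_lt := cd (delta_mx 0 j).
      move=> /(_ (d / 2)); rewrite divr_gt0// => /(_ isT); apply: filterS => y.
      by rewrite !mxE.
    exact: (filter_forall (nbhs_filter y0) hj).
  apply: filterS hj => y hy; apply: hd; apply: (@le_lt_trans _ _ (d / 2)); last by rewrite ltr_pdivrMr// ltr_pMr// ltr1n.
  apply: row_norm_le; first by rewrite divr_ge0// ltW.
  by move=> j; rewrite !mxE; have := hy j; rewrite !mxE => /ltW.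
have n1 : \forall y \near y0, S1 (gradient (f \o cinv A c) y) by exact: cq h1.
have [[T1 T2] [/= t1 t2] ht] := h2.
exists ([set y | S1 (gradient (f \o cinv A c) y) /\ T1 y], T2) => /=.
  by split => //; apply: filterS2 n1 t1.
by move=> [y u] /= [[s1 s2] s3]; apply: (h (gradient (f \o cinv A c) y, (y, u))); split => //=; exact: ht.
Qed.

(** * Subsolutions and Perron's method *)

Lemma compact_argmax (K : set 'rV[R]_n) (f : 'rV[R]_n -> R) : K !=set0 -> compact K ->
  (forall y, K y -> {for y, continuous f}) -> exists2 y, K y & forall z, K z -> f z <= f y.
Proof.
move=> ne cK cf; have [|y] := @EVT_max_rV R n f K ne cK.
  by apply: continuous_in_subspaceT => y /set_mem; exact: cf.
by move=> /set_mem Ky h; exists y => // z Kz; apply: h; rewrite inE.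
Qed.

Lemma norm_sub_continuous (z : 'rV[R]_n) : continuous (fun y : 'rV[R]_n => `|y - z|).
Proof.
move=> x P /nbhs_normP[e /= e0 he].
suff : \forall y \near x, P `|y - z| by exact.
have := near_norm x e0; apply: filterS => y hy; apply: he => /=; apply: le_lt_trans hy.
have -> : x - y = (x - z) - (y - z) by rewrite opprB addrA subrK.
exact: ler_dist_dist.
Qed.

Lemma gradient_sqdist (k : R) y z : gradient (fun y => k * sqdist y z) y = (2 * k) *: (y - z).
Proof.
apply/rowP => j; rewrite !mxE.
have lE (h r t : R^o) : (h *: r + t) *: delta_mx 0 j + y = h *: (r *: delta_mx 0 j) + (t *: delta_mx 0 j + y) :> 'rV[R]_n.
  by rewrite scalerDl addrA scalerA.
have := @derive_slice _ _ R^o _ (fun y : 'rV[R]_n => k * sqdist y z : R^o)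
  (fun t : R => t *: delta_mx 0 j + y) (fun t => t *: delta_mx 0 j) 1 0 lE.
rewrite scale1r scale0r add0r => <-.
pose b := y 0 j - z 0 j.
have -> : (fun y0 => k * sqdist y0 z) \o (fun t : R => t *: delta_mx 0 j + y) =
    (fun t : R => k * (sqdist y z + (t * (2 * b) + t * t))).
  apply/funext => t /=; congr (_ * _); rewrite /sqdist (bigD1 j)//= [in RHS](bigD1 j)//= !mxE !eqxx mulr1.
  rewrite (eq_bigr (fun i => (y 0 i - z 0 i) ^+ 2)); last first.
    by move=> i ij; rewrite !mxE (negbTE ij) andbF mulr0 add0r.
  by rewrite /b; ring.
have d1 := is_derive_id (0 : R^o) (1 : R^o).
have d2 := is_deriveD (is_deriveZ (2 * b) d1) (is_deriveM d1 d1).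
have d3 := is_deriveZ k (is_deriveD (is_derive_cst (sqdist y z : R^o) (0 : R^o) 1) d2).
have [_] := d3; rewrite /GRing.scale/= => e.
have e2 : (fun t : R => k * (sqdist y z + (t * (2 * b) + t * t)) : R^o) =
    (k \*: (cst (sqdist y z : R^o) + (2 * b \*: id + id * id)) : R^o -> R^o).
  by apply/funext => t; rewrite (mulrC t (2 * b)).
rewrite e2 [LHS]e /b; ring.
Qed.

(* At a maximum point [y'] of [u - k * sqdist _ z], coercivity bounds the gradient
   [2 * k * (y' - z)]; with [k = K1 / |y - z|] this puts [y'] twice as close to
   [z] as [y], so that [u - K * `|_ - z|] is maximal at [z] for large [K]. *)
Lemma subsolution_lipschitz (U : R) c : 0 <= U -> exists2 K, 0 <= K & exists2 r, 0 < r &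
  forall (G : cotangent A * R -> R) u, (forall z, `|G z - H z| <= 1) -> continuous u ->
    (forall x, `|u x| <= U) -> viscosity_subsolution G u -> chart_lipschitz u c K r.
Proof.
move=> U0; set y0 := chart A c c; have iy0 : img A c y0 := img_chart (dom_center A c).
have [r1 r10 hr1] := sqdist_img c.
have [C hC] := coercive_chart H_C3 H_convex H_superlinear H_lipschitz iy0 ler01.
move: hC => /nbhs_normP[e /= e0 he].
pose s := Num.min r1 (e ^+ 2 / 2).
have s0 : 0 < s by rewrite lt_min r10 divr_gt0// exprn_gt0.
have se : s < e ^+ 2.
  by rewrite gt_min ltr_pdivrMr// ltr_pMr ?exprn_gt0// ltr1n orbT.
have ball y : sqdist y y0 <= s -> `|y0 - y| < e.
  move=> h; rewrite distrC -ltr_sqr ?nnegrE ?(ltW e0)//.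
  exact: le_lt_trans (norm_sqdist _ _) (le_lt_trans h se).
have s_img y : sqdist y y0 <= 3 * s -> img A c y.
  by move=> h; apply: hr1; rewrite (le_trans h)// ler_pM2l// ge_min lexx.
have img_s y : sqdist y y0 <= s -> img A c y.
  by move=> h; apply: s_img; rewrite (le_trans h)// ler_peMl ?(ltW s0)// ler1n.
pose K0 := `|C| + lambda * U + 1.
have K00 : 0 <= K0 by rewrite !addr_ge0// mulr_ge0// ltW.
have co (G : cotangent A * R -> R) y q u : (forall z, `|G z - H z| <= 1) -> sqdist y y0 <= s ->
    `|u| <= U -> in_chart G c y q u <= 0 -> `|q| <= K0.
  move=> hG hy hu h; have := he _ (ball _ hy) q u; have := hG (cotangent_of_chart A c (y, q), u).
  rewrite -/(in_chart G c y q u) -/(in_chart H c y q u) mul1r ler_norml => /andP[h1 h2] h3.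
  have h4 : lambda * `|u| <= lambda * U by rewrite ler_wpM2l// ltW.
  have := ler_norm C; rewrite /K0; lra.
have /nbhs_normP[e2 /= e20 he2] : \forall y \near y0, sqdist y y0 < s.
  have lt0 : sqdist y0 y0 < s by rewrite sqdistxx.
  exact: (sqdist_continuous (lt_nbhsl lt0)).
pose sg := e2 / 2; have sg0 : 0 < sg by rewrite divr_gt0.
pose D := 2 * (s + 1).
have D0 : 0 < D by rewrite mulr_gt0// addr_gt0.
(* [D] bounds the distances that occur. The term [K0] turns the gradient bound into halving of the
   distance; the term with [sg ^+ 2] keeps [y'] within [sg] of [z], hence in the interior of the
   ball. *)
pose K1 := K0 + 2 * U * D / sg ^+ 2 + 1.
have UD : 0 <= 2 * U * D := mulr_ge0 (mulr_ge0 (ler0n R 2) U0) (ltW D0).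
have q0 : 0 <= 2 * U * D / sg ^+ 2 := divr_ge0 UD (exprn_ge0 2 (ltW sg0)).
have K10 : 0 < K1 := ltr_wpDl (addr_ge0 K00 q0) ltr01.
have normK y : sqdist y y0 <= s -> `|y - y0| <= s + 1.
  move=> h; rewrite -ler_sqr ?nnegrE ?addr_ge0 ?(ltW s0)//.
  apply: le_trans (norm_sqdist _ _) (le_trans h _).
  by rewrite sqrrD1; have := sqr_ge0 s; lra.
exists (2 * n%:R * K1 + 1); first by rewrite addr_ge0 ?mulr_ge0 ?(ltW K10).
exists sg => // G u hG cu hu sub.
pose K := [set y | sqdist y y0 <= s].
have cK : compact K by exact: compact_sqdist.
have cuc y : K y -> {for y, continuous (u \o cinv A c)}.
  by move=> Ky; apply: continuous_comp; [exact: cinv_continuous (img_s _ Ky)|exact: cu].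
have smallK z : `|y0 - z| < sg -> K z.
  by move=> hz; apply/ltW/he2; rewrite /= (lt_trans hz)// /sg ltr_pdivrMr// ltr_pMr// ltr1n.
have step z y : `|y0 - z| < sg -> K y -> y != z -> exists2 y', K y' &
    `|y' - z| <= `|y - z| / 2 /\ u (cinv A c y) <= u (cinv A c y') + n%:R * K1 * `|y - z|.
  move=> hz Ky yz; have Kz := smallK z hz.
  have d0 : 0 < `|y - z| by rewrite normr_gt0 subr_eq0.
  pose k := K1 / `|y - z|; have k0 : 0 < k by rewrite divr_gt0.
  have [||y' Ky' hy'] := @compact_argmax K (fun y => u (cinv A c y) - k * sqdist y z) _ cK.
  - by exists z.
  - move=> x Kx; apply: continuousB; first exact: cuc.
    by apply: continuousM; [exact: cst_continuous|exact: sqdist_continuous].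
  have hz' := hy' z Kz; rewrite sqdistxx mulr0 subr0 in hz'.
  have kU : k * sqdist y' z <= 2 * U.
    have := hu (cinv A c z); have := hu (cinv A c y'); rewrite !ler_norml => /andP[_ a1] /andP[a2 _].
    lra.
  have dz : `|y' - z| <= sg.
    rewrite -ler_sqr ?nnegrE ?(ltW sg0)//; apply: le_trans (norm_sqdist _ _) _.
    rewrite -(ler_pM2l K10); apply: (@le_trans _ _ (2 * U * D)).
      have -> : K1 * sqdist y' z = k * sqdist y' z * `|y - z|.
        by rewrite /k; field; exact: lt0r_neq0.
      apply: ler_pM => //; first by rewrite mulr_ge0 ?sqdist_ge0// ltW.
      apply: le_trans (ler_distD y0 _ _) _; rewrite (distrC y0) /D mulr_natl mulr2n.
      by rewrite lerD// normK.
    have e3 : 2 * U * D / sg ^+ 2 * sg ^+ 2 = 2 * U * D by rewrite divfK// expf_neq0// lt0r_neq0.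
    rewrite -{1}e3 ler_pM2r ?exprn_gt0// /K1.
    by rewrite -addrA addrCA lerDl addr_ge0.
  have in' : sqdist y' y0 < s.
    apply: he2; rewrite /= distrC; apply: le_lt_trans (ler_distD z _ _) _.
    by rewrite (splitr e2) ler_ltD// distrC.
  have iy' := img_s _ Ky'.
  pose f := fun x => k * square c s z x.
  have cf : C1_fun f by apply: C1_funM; [exact: C1_fun_cst|exact: C1_square].
  have dy' := dom_cinv iy'.
  have fE y1 : K y1 -> f (cinv A c y1) = k * sqdist y1 z.
    move=> Ky1; have i1 := img_s _ Ky1.
    by rewrite /f squareE ?cinvK//; exact: dom_cinv.
  have nearK : \forall y1 \near y', K y1.
    have h : \forall y1 \near y', sqdist y1 y0 < s by exact: (sqdist_continuous (lt_nbhsl in')).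
    by apply: filterS h => y1; exact: ltW.
  have := sub f (cinv A c y') ((Ck1E f).2 cf).
  rewrite -differential_chart// => vs.
  have ineq : in_chart G c y' (gradient (f \o cinv A c) y') (u (cinv A c y')) <= 0.
    apply: vs; have nK : \forall x \near cinv A c y', K (chart A c x).
      by apply: near_chart => //; rewrite cinvK.
    apply: filterS2 nK (near_dom dy') => x Kx dx.
    by have := hy' _ Kx; rewrite -fE// -fE// chartK.
  have gE : gradient (f \o cinv A c) y' = (2 * k) *: (y' - z).
    rewrite -gradient_sqdist; apply/rowP => j; rewrite !mxE; apply: (near_eq_derive (W := R^o)).
    by apply: filterS nearK => y1; exact: fE.
  have := co G y' _ _ hG Ky' (hu _) ineq; rewrite gE normrZ => h.
  exists y' => //; split.
    have e3 : `|2 * k| = 2 * k by rewrite ger0_norm// mulr_ge0// ltW.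
    rewrite e3 in h; rewrite -(ler_pM2l (_ : 0 < 2 * K1)) ?mulr_gt0//.
    have -> : 2 * K1 * `|y' - z| = 2 * k * `|y' - z| * `|y - z|.
      by rewrite /k; field; exact: lt0r_neq0.
    have -> : 2 * K1 * (`|y - z| / 2) = K1 * `|y - z| by field.
    by rewrite ler_pM2r//; apply: le_trans h _; rewrite /K1 -addrA lerDl addr_ge0.
  have := hy' y Ky; have h1 : 0 <= k * sqdist y' z by rewrite mulr_ge0 ?sqdist_ge0// ltW.
  have h2 : k * sqdist y z <= n%:R * K1 * `|y - z|.
    apply: le_trans (ler_wpM2l (ltW k0) (sqdist_norm y z)) _.
    rewrite /k le_eqVlt; apply/orP; left; apply/eqP; field; exact: lt0r_neq0.
  lra.
have one y z : `|y0 - y| < sg -> `|y0 - z| < sg ->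
    u (cinv A c y) - u (cinv A c z) <= (2 * n%:R * K1 + 1) * `|y - z|.
  move=> hy hz.
  have [||y' Ky' hy'] := @compact_argmax K (fun y => u (cinv A c y) - (2 * n%:R * K1 + 1) * `|y - z|) _ cK.
  - by exists z; exact: smallK.
  - move=> x Kx; apply: continuousB; first exact: cuc.
    apply: continuousM; first exact: cst_continuous.
    exact: norm_sub_continuous.
  have [e'|ne] := eqVneq y' z.
    by have := hy' y (smallK _ hy); rewrite e' subrr normr0 mulr0; lra.
  (* Passing from [y'] to [y2] loses at most [n%:R * K1 * |y' - z|] of [u] but halves a penalty of
     slope larger than [2 * n%:R * K1], against the maximality of [y']. *)
  have [y2 Ky2 [h1 h2]] := step z y' hz Ky' ne.
  have := hy' y2 Ky2; have d0 : 0 < `|y' - z| by rewrite normr_gt0 subr_eq0.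
  have c0 : 0 <= 2 * n%:R * K1 + 1 by rewrite addr_ge0 ?mulr_ge0 ?(ltW K10).
  have h3 := ler_wpM2l c0 h1.
  have h4 : (2 * n%:R * K1 + 1) * (`|y' - z| / 2) = n%:R * K1 * `|y' - z| + `|y' - z| / 2 by field.
  have h5 : (2 * n%:R * K1 + 1) * `|y' - z| = 2 * (n%:R * K1 * `|y' - z|) + `|y' - z| by ring.
  rewrite h4 in h3; rewrite h5.
  move: h2 h3 d0; move: (n%:R * K1 * `|y' - z|) (_ * `|y2 - z|) `|y' - z| => X Y Z; lra.
move=> y z hy hz; rewrite ler_norml; have := one y z hy hz; have := one z y hz hy.
by rewrite (distrC z y) => h1 h2; apply/andP; split; lra.
Qed.

Lemma near_sqdist y0 r (P : 'rV[R]_n -> Prop) : 0 < r -> (\forall y \near y0, P y) ->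
  exists2 s, 0 < s <= r & forall y, sqdist y y0 <= s -> P y.
Proof.
move=> r0 /nbhs_normP[e /= e0 he]; exists (Num.min r (e ^+ 2 / 2)).
  by rewrite lt_min r0 divr_gt0 ?exprn_gt0//= ge_min lexx.
move=> y; rewrite le_min => /andP[_ h]; apply: he => /=.
rewrite distrC -ltr_sqr ?nnegrE ?(ltW e0)//; apply: le_lt_trans (norm_sqdist _ _) (le_lt_trans h _).
by rewrite ltr_pdivrMr// ltr_pMr ?exprn_gt0// ltr1n.
Qed.

Lemma lipschitz_continuous u :
  (forall c, exists2 K, 0 <= K & exists2 r, 0 < r & chart_lipschitz u c K r) -> continuous u.
Proof.
move=> lip x; have [K K0 [r r0 hK]] := lip x; have dx := dom_center A x.
apply/cvgrPdist_lt => e e0.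
have d0 : 0 < Num.min r (e / (K + 1)) by rewrite lt_min r0 divr_gt0// ltr_wpDl.
apply: filterS2 (near_dom dx) (near_chart dx (near_norm _ d0)) => x' dx'.
rewrite lt_min => /andP[h1 h2].
have := hK (chart A x x) (chart A x x'); rewrite subrr normr0 !chartK// => /(_ r0 h1) h3.
apply: le_lt_trans h3 _; rewrite ltr_pdivlMr ?ltr_wpDl// in h2.
by apply: le_lt_trans h2; rewrite mulrC ler_wpM2l// lerDl.
Qed.

Lemma gradient_add_cst (F : 'rV[R]_n -> R) k y : gradient (fun y => F y + k) y = gradient F y.
Proof.
apply/rowP => j; rewrite !mxE /derive; set f := fun h : R => _; set h := fun h : R => _.
have -> // : f = h by apply/funext => t; rewrite /f /h /= opprD addrACA subrr addr0.
Qed.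

(** The square has a critical point at its center, so it makes an extremum strict without changing
    the covector there. *)
Lemma gradient_square c r f k : 0 < r -> (forall y, sqdist y (chart A c c) <= 3 * r -> img A c y) ->
  C1_fun f -> gradient ((fun x => f x + k * square c r (chart A c c) x) \o cinv A c) (chart A c c) =
  gradient (f \o cinv A c) (chart A c c).
Proof.
move=> r0 r_img cf; set y0 := chart A c c.
have iy0 : img A c y0 := img_chart (dom_center A c).
have cs := @C1_square c r r0 r_img y0.
have e : \forall y \near y0, ((fun x => k * square c r y0 x) \o cinv A c) y = k * sqdist y y0.
  have lt0 : sqdist y0 y0 < r by rewrite sqdistxx.
  have h : \forall y \near y0, sqdist y y0 < r by exact: (sqdist_continuous (lt_nbhsl lt0)).
  apply: filterS2 h (near_img iy0) => y hy iy /=.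
  by rewrite squareE ?cinvK//; [exact: dom_cinv|exact: ltW].
have g0 : gradient ((fun x => k * square c r y0 x) \o cinv A c) y0 = 0.
  have h := gradient_sqdist k y0 y0; rewrite subrr scaler0 in h; rewrite -h.
  by apply/rowP => j; rewrite !mxE; apply: (near_eq_derive (W := R^o)).
apply/rowP => j; rewrite !mxE.
have [df _] := cf c y0 iy0.
have [ds _] := C1_funM (C1_fun_cst k) cs iy0.
have d1 := diff_derivable (v := delta_mx 0 j) (nbhs_singleton df).
have d2 := diff_derivable (v := delta_mx 0 j) (nbhs_singleton ds).
have := deriveD d1 d2.
have -> : 'D_(delta_mx 0 j) ((fun x => k * square c r y0 x) \o cinv A c) y0 = 0.
  by have := congr1 (fun w : 'rV[R]_n => w 0 j) g0; rewrite !mxE.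
by rewrite addr0.
Qed.

(** Restriction to coordinate lines reduces this to one variable. It handles points where the raised
    function in [top_super] is itself C1: a function touching it there has the same differential. *)
Lemma differential_at_max f h x : C1_fun f -> C1_fun h ->
  (\forall y \near x, f y - h y <= f x - h x) -> differential A f x = differential A h x.
Proof.
move=> cf ch mx; have dx := dom_center A x; have ix := img_chart dx; set y0 := chart A x x in ix *.
apply/rowP => j; rewrite !mxE.
have [df _] := cf x y0 ix; have [dh _] := ch x y0 ix.
pose D (y : 'rV[R]_n) : R^o := (f \o cinv A x) y - (h \o cinv A x) y.
pose l (t : R) : 'rV[R]_n := t *: delta_mx 0 j + y0.
have dD : \forall y \near y0, differentiable D y.
  by apply: filterS2 df dh => y d1 d2; exact: differentiableB.
have mD : \forall y \near y0, D y <= D y0.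
  have mx' : \forall y \near cinv A x y0, f y - h y <= f x - h x by rewrite /y0 chartK.
  by have := near_cinv ix mx'; apply: filterS => y; rewrite /D /= /y0 chartK.
have lc : continuous l.
  by move=> s; apply: cvgD; [apply: cvgZr_tmp; exact: cvg_id|exact: cvg_cst].
have l0 : l 0 = y0 by rewrite /l scale0r add0r.
have n1 : \forall t \near (0 : R), differentiable D (l t) /\ D (l t) <= D y0.
  have h1 : \forall y \near l 0, differentiable D y /\ D y <= D y0.
    by rewrite l0; apply: filterS2 dD mD => y.
  exact: (lc 0 _ h1).
move: n1 => /nbhs_normP[e /= e0 he].
have he' t : t \in `](- e), e[ -> differentiable D (l t) /\ D (l t) <= D y0.
  by rewrite in_itv/= => /andP[t1 t2]; apply: he; rewrite /= sub0r normrN ltr_norml t1.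
have dl t : differentiable D (l t) -> is_derive t 1 (fun t => D (l t) : R) ('D_(delta_mx 0 j) D (l t)).
  by move=> dt; exact: is_derive_line.
have := @derive1_at_max R (D \o l) (- e) e 0.
case.
- by rewrite ge0_cp// ltW.
- by move=> t /he'[/dl []].
- by rewrite in_itv/= e0 andbT oppr_lt0.
- by move=> t /he'[_]; rewrite /= l0.
move=> _ z0; have [|_ e1] := dl 0; first by rewrite l0; exact: nbhs_singleton dD.
have : 'D_(delta_mx 0 j) D y0 = 0 by rewrite -[y0 in LHS]l0 -e1; exact: z0.
rewrite /D deriveB; [|exact: diff_derivable (nbhs_singleton df)|exact: diff_derivable (nbhs_singleton dh)].
by move/eqP; rewrite subr_eq0 => /eqP.
Qed.

Section Perron.
Variables (G : cotangent A * R -> R) (psi1 psi2 : M -> R) (U : R).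
Hypotheses (G_close : forall z, `|G z - H z| <= 1)
  (G_continuous : forall f c y0 u0 (e : R), C1_fun f -> img A c y0 -> 0 < e ->
    \forall z \near (y0, u0),
    `|in_chart G c y0 (gradient (f \o cinv A c) y0) u0 -
      in_chart G c z.1 (gradient (f \o cinv A c) z.1) z.2| < e)
  (U0 : 0 <= U) (psi1_bound : forall x, `|psi1 x| <= U) (psi2_bound : forall x, `|psi2 x| <= U)
  (psi1_continuous : continuous psi1) (psi2_continuous : continuous psi2)
  (psi12 : forall x, psi1 x <= psi2 x)
  (psi1_sub : viscosity_subsolution G psi1) (psi2_super : viscosity_supersolution G psi2).

(** Continuous subsolutions suffice: coercivity makes them Lipschitz with common local constants, so
    [top] is continuous and semicontinuous envelopes do not arise. *)
Let family u := [/\ continuous u, viscosity_subsolution G u & forall x, psi1 x <= u x <= psi2 x].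

Let family_bound u x : family u -> `|u x| <= U.
Proof.
move=> [_ _ /(_ x)/andP[h1 h2]]; move: (psi1_bound x) (psi2_bound x).
by rewrite !ler_norml => /andP[a1 _] /andP[_ a2]; rewrite (le_trans a1 h1) (le_trans h2 a2).
Qed.

Let family_psi1 : family psi1.
Proof. by split => // x; rewrite lexx psi12. Qed.

Let top x := sup [set u x | u in [set u | family u]].

Let has_sup_top x : has_sup [set u x | u in [set u | family u]].
Proof.
split; first by exists (psi1 x), psi1.
by exists (psi2 x) => _ [u [_ _ /(_ x)/andP[_ h]] <-].
Qed.

Let top_ge u x : family u -> u x <= top x.
Proof. by move=> fu; apply: ub_le_sup; [case: (has_sup_top x)|exists u]. Qed.

Let top_near x e : 0 < e -> exists2 u, family u & top x - e < u x.
Proof. by move=> e0; have [_ [u fu <-] h] := sup_adherent e0 (has_sup_top x); exists u. Qed.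

Let top_itv x : psi1 x <= top x <= psi2 x.
Proof.
rewrite top_ge//=; apply: ge_sup; first by case: (has_sup_top x).
by move=> _ [u [_ _ /(_ x)/andP[_ h]] <-].
Qed.

Let top_continuous : continuous top.
Proof.
apply: lipschitz_continuous => c; have [K K0 [r r0 hK]] := subsolution_lipschitz c U0.
exists K => //; exists r => // y z hy hz.
have half y1 z1 : `|chart A c c - y1| < r -> `|chart A c c - z1| < r ->
    top (cinv A c y1) - top (cinv A c z1) <= K * `|y1 - z1|.
  move=> h1 h2; apply/ler_addgt0Pr => e e0; have [u fu h] := top_near (cinv A c y1) e0.
  have [cu su _] := fu.
  have := hK G u G_close cu (fun x => family_bound x fu) su y1 z1 h1 h2.
  have := top_ge (cinv A c z1) fu; rewrite ler_norml => h3 /andP[_ h4]; lra.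
rewrite ler_norml; have h1 := half _ _ hy hz; have := half _ _ hz hy; rewrite distrC => h2.
by apply/andP; split; lra.
Qed.

(* Adding [square] makes the maximum of [top - f] strict, so that members of the
   family close to [top] at [x0] attain theirs nearby. *)
Let top_sub : viscosity_subsolution G top.
Proof.
move=> f x0 /Ck1E cf mx; set c := x0; set y0 := chart A c c.
have dc : dom A c c := dom_center A c; have iy0 : img A c y0 := img_chart dc.
have [r r0 r_img] := sqdist_img c.
pose F x := f x + 1 * square c r y0 x.
have cF : C1_fun F by apply: (C1_funD cf); apply: C1_funM; [exact: C1_fun_cst|exact: C1_square].
rewrite leNgt; apply/negP => g0.
have E0 : in_chart G c y0 (gradient (F \o cinv A c) y0) (top x0) = G (x0, differential A f x0, top x0).
  by rewrite gradient_square// /in_chart differential_chart// chartK.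
have [[S1 S2] [/= n1 n2] hS] := G_continuous (top x0) cF iy0 g0.
have /nbhs_normP[e /= e0 he] := n2.
have e40 : 0 < e / 4 by rewrite divr_gt0.
have near_y (P : M -> Prop) : (\forall x \near x0, P x) -> \forall y \near y0, P (cinv A c y).
  by move=> h; apply: near_cinv => //; rewrite chartK.
have n3 : \forall y \near y0, [/\ S1 y, top (cinv A c y) - f (cinv A c y) <= top x0 - f x0,
    top (cinv A c y) < top x0 + e / 4 & f x0 - e / 4 < f (cinv A c y)].
  have h1 := near_y _ mx.
  have h2 : \forall x \near x0, top x < top x0 + e / 4.
    by have lt0 : top x0 < top x0 + e / 4 by [rewrite ltrDl]; exact: (top_continuous (lt_nbhsl lt0)).
  have h3 : \forall x \near x0, f x0 - e / 4 < f x.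
    by have lt0 : f x0 - e / 4 < f x0 by [rewrite gtrBl]; exact: (C1_fun_continuous cf (lt_nbhsr lt0)).
  have h23 : \forall x \near x0, top x < top x0 + e / 4 /\ f x0 - e / 4 < f x.
    by apply: filterS2 h2 h3 => x.
  have h4 := near_y _ h23.
  by apply: filterS3 n1 h1 h4 => y s1 s2 [s3 s4]; split.
have [s /andP[s0 sr] hs] := near_sqdist r0 n3.
have img_s y : sqdist y y0 <= s -> img A c y.
  by move=> h; apply: r_img; rewrite (le_trans h)// (le_trans sr)// ler_peMl ?(ltW r0)// ler1n.
have FE y : sqdist y y0 <= s -> F (cinv A c y) = f (cinv A c y) + sqdist y y0.
  move=> h; have iy := img_s y h; rewrite /F mul1r squareE ?cinvK//; first exact: dom_cinv.
  exact: le_trans h sr.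
(* The penalty at the maximizer [yb] is at most [top x0 - u x0 < e1]: then [e1 < s] keeps [yb]
   interior, and [e1 < e / 4] keeps the value of [u] there within [e] of [top x0]. *)
pose e1 := Num.min s (e / 4) / 2.
have e10 : 0 < e1 by rewrite divr_gt0// lt_min s0.
have e1s : e1 < s by rewrite /e1 ltr_pdivrMr// gt_min ltr_pMr// ltr1n.
have e1e : e1 < e / 4 by rewrite /e1 ltr_pdivrMr// gt_min ltr_pMr// ltr1n orbT.
have [u fu hu] := top_near x0 e10; have [cu su _] := fu.
pose K := [set y | sqdist y y0 <= s].
have [||yb Kyb hyb] := @compact_argmax K (fun y => u (cinv A c y) - F (cinv A c y)) _ (@compact_sqdist y0 s).
- by exists y0; rewrite /K /= sqdistxx ltW.
- move=> y /img_s iy; apply: (@continuous_comp _ _ _ (cinv A c) (fun x => u x - F x)).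
    exact: cinv_continuous.
  by apply: continuousB; [exact: cu|exact: C1_fun_continuous].
have K0 : K y0 by rewrite /K /= sqdistxx ltW.
have := hyb y0 K0; rewrite !FE// sqdistxx addr0 chartK// => h1.
have [s1 s2 s3 s4] := hs yb Kyb.
have h2 := top_ge (cinv A c yb) fu.
have Qs : sqdist yb y0 < s by lra.
have iyb := img_s _ Kyb; have dyb := dom_cinv iyb.
have Q0 := sqdist_ge0 yb y0.
have := su F (cinv A c yb) ((Ck1E F).2 cF).
rewrite -differential_chart// -/(in_chart G c yb _ _) => vs.
have ineq : in_chart G c yb (gradient (F \o cinv A c) yb) (u (cinv A c yb)) <= 0.
  apply: vs; have nK : \forall x \near cinv A c yb, K (chart A c x).
    apply: near_chart => //; rewrite cinvK//.
    have h : \forall y1 \near yb, sqdist y1 y0 < s by exact: (sqdist_continuous (lt_nbhsl Qs)).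
    by apply: filterS h => y1; exact: ltW.
  apply: filterS2 nK (near_dom dyb) => x Kx dx.
  by have := hyb _ Kx; rewrite chartK.
have := hS (yb, u (cinv A c yb)); rewrite /= E0 => hS'.
have : `|G (x0, differential A f x0, top x0) - in_chart G c yb (gradient (F \o cinv A c) yb) (u (cinv A c yb))|
    < G (x0, differential A f x0, top x0).
  apply: hS'; split => //=; apply: he => /=; rewrite ltr_norml; apply/andP; split; lra.
move=> h; have := le_lt_trans (ler_norm _) h; rewrite gtrBl => h5.
by have := lt_le_trans h5 ineq; rewrite ltxx.
Qed.

(* Otherwise [top] could be raised to [f - square + d] near [x0]. *)
Let top_super : viscosity_supersolution G top.
Proof.
move=> f x0 /Ck1E cf mn; set c := x0; set y0 := chart A c c.
have dc : dom A c c := dom_center A c; have iy0 : img A c y0 := img_chart dc.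
have [topE|ne] := eqVneq (top x0) (psi2 x0).
  rewrite topE; apply: psi2_super; first exact/Ck1E.
  apply: filterS mn => x h; rewrite -topE; apply: le_trans h _.
  by rewrite lerD2r; have /andP[] := top_itv x.
have tlt : top x0 < psi2 x0.
  by rewrite lt_neqAle ne; have /andP[] := top_itv x0.
rewrite leNgt; apply/negP => g0.
have [r r0 r_img] := sqdist_img c.
pose v0 x := (f x + -1 * square c r y0 x) + (top x0 - f x0).
have cv0 : C1_fun v0.
  apply: C1_funD; last exact: C1_fun_cst.
  by apply: (C1_funD cf); apply: C1_funM; [exact: C1_fun_cst|exact: C1_square].
have gv0 : gradient (v0 \o cinv A c) y0 = gradient (f \o cinv A c) y0.
  by rewrite -[LHS]/(gradient (fun y => ((fun x => f x + -1 * square c r y0 x) \o cinv A c) y + _) y0) gradient_add_cst gradient_square.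
have E0 : in_chart G c y0 (gradient (v0 \o cinv A c) y0) (top x0) = G (x0, differential A f x0, top x0).
  by rewrite gv0 /in_chart differential_chart// chartK.
have g1 : 0 < - G (x0, differential A f x0, top x0) by rewrite oppr_gt0.
have [[S1 S2] [/= n1 n2] hS] := G_continuous (top x0) cv0 iy0 g1.
have /nbhs_normP[e /= e0 he] := n2.
have e20 : 0 < e / 2 by rewrite divr_gt0.
pose b := (psi2 x0 - top x0) / 4.
have b0 : 0 < b by rewrite divr_gt0// subr_gt0.
have v0x0 : v0 x0 = top x0.
  by rewrite /v0 squareE ?sqdistxx//; [ring|exact: ltW].
have near_y (P : M -> Prop) : (\forall x \near x0, P x) -> \forall y \near y0, P (cinv A c y).
  by move=> h; apply: near_cinv => //; rewrite chartK.
have n3 : \forall y \near y0, [/\ S1 y, top x0 - f x0 <= top (cinv A c y) - f (cinv A c y),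
    v0 (cinv A c y) < top x0 + b /\ psi2 x0 - b < psi2 (cinv A c y) & `|v0 x0 - v0 (cinv A c y)| < e / 2].
  have h1 := near_y _ mn.
  have h2 : \forall x \near x0, v0 x < top x0 + b.
    have lt0 : v0 x0 < top x0 + b by rewrite v0x0 ltrDl.
    exact: (C1_fun_continuous cv0 (lt_nbhsl lt0)).
  have h3 : \forall x \near x0, psi2 x0 - b < psi2 x.
    by have lt0 : psi2 x0 - b < psi2 x0 by [rewrite gtrBl]; exact: (psi2_continuous (lt_nbhsr lt0)).
  have h4 : \forall x \near x0, `|v0 x0 - v0 x| < e / 2.
    by have /cvgrPdist_lt := C1_fun_continuous cv0 (x := x0); apply.
  have h23 : \forall x \near x0, v0 x < top x0 + b /\ psi2 x0 - b < psi2 x.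
    by apply: filterS2 h2 h3 => x.
  have h5 := near_y _ h23.
  have h6 : \forall y \near y0, `|v0 x0 - v0 (cinv A c y)| < e / 2 /\ S1 y.
    by apply: filterS2 (near_y _ h4) n1 => y.
  by apply: filterS3 h6 h1 h5 => y [s1 s2] s3 s4; split.
have [s /andP[s0 sr] hs] := near_sqdist r0 n3.
have img_s y : sqdist y y0 <= s -> img A c y.
  by move=> h; apply: r_img; rewrite (le_trans h)// (le_trans sr)// ler_peMl ?(ltW r0)// ler1n.
(* [d < s] puts the raised set inside [N], [d < b] keeps the raised function below [psi2], and
   [d < e / 2] keeps [v] where [G] is negative. *)
pose d := Num.min s (Num.min b (e / 2)) / 2.
have m0 : 0 < Num.min s (Num.min b (e / 2)) by rewrite !lt_min s0 b0.
have d0 : 0 < d by rewrite divr_gt0.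
have dm : d < Num.min s (Num.min b (e / 2)) by rewrite /d ltr_pdivrMr// ltr_pMr// ltr1n.
move: dm; rewrite !lt_min => /and3P[ds db de].
pose v x := v0 x + d.
have cv : C1_fun v by apply: (C1_funD cv0); exact: C1_fun_cst.
have gv y : gradient (v \o cinv A c) y = gradient (v0 \o cinv A c) y.
  by rewrite -[LHS]/(gradient (fun y => (v0 \o cinv A c) y + d) y) gradient_add_cst.
pose N x := dom A c x /\ sqdist (chart A c x) y0 < s.
pose w x := if `[< N x >] then Num.max (top x) (v x) else top x.
have near_N x : N x -> \forall x' \near x, N x'.
  move=> [dx sx]; have h : \forall y \near chart A c x, sqdist y y0 < s.
    exact: (sqdist_continuous (lt_nbhsl sx)).
  by apply: filterS2 (near_dom dx) (near_chart dx h) => x' h1 h2; split.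
have vN x : N x -> [/\ S1 (chart A c x), v x <= psi2 x, `|top x0 - v x| < e &
    v x <= top x + d - sqdist (chart A c x) y0].
  move=> [dx sx]; have := hs _ (ltW sx); rewrite chartK// => -[h1 h2 [h3 h4] h5].
  have hv : v0 x = f x - sqdist (chart A c x) y0 + (top x0 - f x0).
    by rewrite /v0 squareE// ?mulN1r//; rewrite (le_trans (ltW sx)).
  split => //.
  - rewrite /v; have : top x0 + 4 * b = psi2 x0 by rewrite /b; field.
    lra.
  - rewrite /v; rewrite v0x0 in h5; move: h5; rewrite !ltr_norml => /andP[h5 h6].
    by apply/andP; split; lra.
  - rewrite /v hv; lra.
pose K := cinv A c @` [set y | sqdist y y0 <= d].
have cK : closed K.
  apply: closed_cinv; first exact: compact_sqdist.
  by move=> y /= h; apply: img_s; rewrite (le_trans h)// ltW.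
have KN x : K x -> N x.
  move=> [y /= h <-]; have iy : img A c y by apply: img_s; rewrite (le_trans h)// ltW.
  by split; [exact: dom_cinv|rewrite cinvK// (le_lt_trans h)].
have wtop x : ~ K x -> w x = top x.
  move=> nK; rewrite /w; case: asboolP => // Nx; have [_ _ _ h] := vN x Nx.
  rewrite max_l//; apply: le_trans h _; rewrite -addrA gerDl subr_le0 leNgt; apply/negP => h1.
  by apply: nK; exists (chart A c x); [exact: ltW|have [dx _] := Nx; rewrite chartK].
have near_nK x : ~ K x -> \forall x' \near x, w x' = top x'.
  move=> nK; have h : \forall x' \near x, ~ K x' by apply: open_nbhs_nbhs; split => //; rewrite openC.
  by apply: filterS h => x'; exact: wtop.
have wN x : N x -> w x = Num.max (top x) (v x) by move=> Nx; rewrite /w; case: asboolP.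
have wtop_le x : top x <= w x by rewrite /w; case: ifP => _ //; rewrite le_max lexx.
have fw : family w.
  split.
  - move=> x; have [Kx|nK] := pselect (K x).
      apply: (@near_eq_continuous _ _ (fun x => Num.max (top x) (v x))).
        by apply: filterS (near_N _ (KN _ Kx)) => x' /wN ->.
      by apply: continuous_max; [exact: top_continuous|exact: C1_fun_continuous].
    apply: (@near_eq_continuous _ _ top); last exact: top_continuous.
    by apply: filterS (near_nK _ nK) => x' ->.
  - move=> phi x cphi mx; have [Kx|nK] := pselect (K x); last first.
      rewrite wtop//; apply: top_sub => //; rewrite -(wtop _ nK).
      by apply: filterS2 mx (near_nK _ nK) => x' h e'; rewrite -e'.
    have Nx := KN x Kx; have wx := wN x Nx.
    have [vt|tv] := leP (v x) (top x).
      have wx' : w x = top x by rewrite wx max_l.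
      rewrite wx'; apply: top_sub => //; rewrite -wx'.
      by apply: filterS mx => x' h; apply: le_trans h; rewrite lerD2r.
    have wx' : w x = v x by rewrite wx max_r// ltW.
    have diff : differential A phi x = differential A v x.
      apply/esym; apply: (differential_at_max cv ((Ck1E phi).1 cphi)).
      rewrite -wx'; apply: filterS2 mx (near_N _ Nx) => x' h Nx'; apply: le_trans h.
      by rewrite lerD2r (wN _ Nx') le_max lexx orbT.
    have [dx sx] := Nx; have [h1 h2 h3 h4] := vN x Nx.
    have ix := img_chart dx; have := differential_chart cv ix; rewrite chartK// => ex.
    rewrite wx' diff -ex gv -/(in_chart G c _ _ _).
    have := hS (chart A c x, v x); rewrite /= E0 => hS'.
    have : `|G (x0, differential A f x0, top x0) -
        in_chart G c (chart A c x) (gradient (v0 \o cinv A c) (chart A c x)) (v x)|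
        < - G (x0, differential A f x0, top x0).
      by apply: hS'; split => //=; apply: he.
    rewrite distrC => h; have := le_lt_trans (ler_norm _) h; rewrite ltrBlDr addNr.
    exact: ltW.
  - move=> x; have /andP[h1 h2] := top_itv x; rewrite (le_trans h1 (wtop_le x))/=.
    rewrite /w; case: asboolP => // Nx; rewrite ge_max h2; by have [] := vN x Nx.
have Nx0 : N x0 by split => //; rewrite sqdistxx.
have := top_ge x0 fw; rewrite wN// ge_max => /andP[_]; rewrite /v v0x0 leNgt ltrDl d0.
by [].
Qed.

Lemma perron : exists u, viscosity_solution G u /\ forall x, psi1 x <= u x <= psi2 x.
Proof. by exists top; split. Qed.

End Perron.

(** * Strict sub- and supersolutions *)

(** Continuity comes from closeness of [w] near [x0] that is uniform over the compact time interval.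
    The minimum required for the supersolution is obtained from the negated flow. *)
Lemma time_envelope w T k : 0 <= T -> time_continuous w -> exists psi : M -> R,
  [/\ continuous psi, forall x s, 0 <= s <= T -> w s x + k * weight s <= psi x &
    forall x, exists2 t, 0 <= t <= T & psi x = w t x + k * weight t].
Proof.
move=> T0 cw.
have /choice[tm htm] : forall x, exists t, 0 <= t <= T /\
    forall s, 0 <= s <= T -> w s x + k * weight s <= w t x + k * weight t.
  move=> x; have [|t] := @EVT_max R (fun s => w (Num.max 0 s) x + k * weight s) 0 T T0.
    apply: continuous_subspaceT => s.
    apply: (@continuousD _ _ _ (fun s => w (Num.max 0 s) x)).
      apply: (@continuous_comp _ _ _ (fun s : R => (x, s)) (fun z : M * R => w (Num.max 0 z.2) z.1)); last exact: cw.
      by apply: (@cvg_pair _ _ _ _ (nbhs x) (nbhs s)); [exact: cvg_cst|exact: cvg_id].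
    by apply: continuousM; [exact: cst_continuous|exact: weight_continuous].
  rewrite in_itv/= => tT h; exists t; split => // s sT.
  have := h s; rewrite in_itv/= sT => /(_ isT).
  by move: sT tT => /andP[s0 _] /andP[t0 _]; rewrite !max_r.
pose psi x := w (tm x) x + k * weight (tm x).
exists psi; split; last 2 first.
- by move=> x s sT; have [_ h] := htm x; exact: h.
- by move=> x; have [h _] := htm x; exists (tm x).
move=> x0; apply/cvgrPdist_le => e e0.
have e20 : 0 < e / 2 by rewrite divr_gt0.
have FF : Filter (nbhs x0) by exact: nbhs_filter.
have near_all : (nbhs x0) [set x | forall t, `[0, T]%classic t -> `|w (Num.max 0 t) x0 - w (Num.max 0 t) x| < e].
  refine (@compact_near_forall R M (nbhs x0) FF `[0, T]%classic
    (fun x t => `|w (Num.max 0 t) x0 - w (Num.max 0 t) x| < e) (@segment_compact R 0 T) _) => t _.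
  have /cvgrPdist_lt/(_ _ e20)[[S1 S2] [/= h1 h2] h] := cw (x0, t).
  exists (S2, S1) => //= -[t' x] /= [s2 s1].
  have a1 := h (x0, t') (conj (nbhs_singleton h1) s2); have a2 := h (x, t') (conj s1 s2).
  rewrite /= in a1 a2; apply: le_lt_trans (ler_distD (w (Num.max 0 t) x0) _ _) _.
  by rewrite (splitr e) distrC ltrD.
apply: filterS near_all => x hx.
have [t0T m0] := htm x0; have [t1T m1] := htm x.
have bd t : 0 <= t <= T -> `|w t x0 - w t x| < e.
  move=> tT; have /andP[t00 _] := tT; have := hx t.
  by rewrite /= in_itv/= tT max_r// => /(_ isT).
have b0 := bd _ t0T; have b1 := bd _ t1T; have := m0 _ t1T; have := m1 _ t0T.
move: b0 b1; rewrite -/(psi x0) -/(psi x) !ltr_norml => /andP[_ b0] /andP[b1 _] h1 h2.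
rewrite ler_norml /psi in h1 h2 *.
by apply/andP; split; lra.
Qed.

(** Only earlier times are tested: the curves at hand end at the extremal time, which may be [T]. *)
Lemma le_derive_left (f : R -> R) t df m : is_derive t 1 f df ->
  (\forall s \near t, s < t -> f t - f s <= m * (t - s)) -> df <= m.
Proof.
move=> [dfx <-] h; apply/ler_addgt0Pr => e e0.
have /cvgrPdist_lt/(_ _ e0) : (fun h : R => h^-1 *: (f (h *: 1 + t) - f t)) @ 0^' --> 'D_1 f t by exact: dfx.
move=> /nbhs_normP[d1 /= d10 hd1]; move: h => /nbhs_normP[d2 /= d20 hd2].
pose r := Num.min d1 d2 / 2.
have m0 : 0 < Num.min d1 d2 by rewrite lt_min d10.
have r0 : 0 < r by rewrite divr_gt0.
have : r < Num.min d1 d2 by rewrite /r ltr_pdivrMr// ltr_pMr// ltr1n.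
rewrite lt_min => /andP[r1 r2].
have := hd1 (- r); rewrite /= sub0r opprK ger0_norm ?(ltW r0)// oppr_eq0 gt_eqF// => /(_ r1 isT).
have := hd2 (t - r); rewrite /= opprB addrC subrK ger0_norm ?(ltW r0)// => /(_ r2).
rewrite gtrBl => /(_ r0).
rewrite [- r *: 1]/GRing.scale/= mulr1 (addrC (- r)) /GRing.scale/= invrN mulNr -mulrN opprB.
set X := f t - f (t - r) => h1; rewrite ltr_norml => /andP[_ h2].
have h3 : r^-1 * X <= m by rewrite mulrC ler_pdivrMr.
lra.
Qed.

Lemma weight_increment_ge s t : 2 * lambda * (t - s) * weight s <= weight t - weight s.
Proof.
have h : 1 + 2 * lambda * (t - s) <= expR (2 * lambda * (t - s)) by exact: expR_ge1Dx.
have := ler_wpM2r (ltW (weight_gt0 s)) h.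
have -> : expR (2 * lambda * (t - s)) * weight s = weight t.
  by rewrite /weight -expRD; congr expR; ring.
by rewrite mulrDl mul1r; lra.
Qed.

Lemma strict_subsolution w T k psi f x0 : sol w -> 0 < T -> 0 < k ->
  (forall x s, 0 <= s <= T -> w s x + - k * weight s <= psi x) ->
  (forall x, exists2 t, 0 <= t <= T & psi x = w t x + - k * weight t) ->
  (forall x, w 0 x - k * weight 0 < w T x - k * weight T) ->
  C1_fun f -> (\forall y \near x0, psi y - f y <= psi x0 - f x0) ->
  H (x0, differential A f x0, psi x0) <= - (lambda * k).
Proof.
move=> sw T0 k0 psi_ge psi_eq wT cf mx; have [cw D1 _] := sw.
have [t0 /andP[t00 t0T] e0] := psi_eq x0.
have t0_gt : 0 < t0.
  rewrite lt_neqAle t00 andbT; apply/eqP => t0E; have := psi_ge x0 T; rewrite e0 -t0E lexx (ltW T0) => /(_ isT).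
  by rewrite !mulNr leNgt wT.
set c := x0; set y0 := chart A c c; have dc : dom A c c := dom_center A c.
have iy0 : img A c y0 := img_chart dc.
set p := differential A f x0; set u0 := w t0 x0.
(* [v] is the velocity dual to [p]: the Lagrangian at [(x0, v, u0)] is [pairing v p] minus the
   Hamiltonian at [p], and nearby it exceeds this by at most [eta]. *)
have [v hv] := near_tangent H_C3 H_convex p u0 iy0.
pose yb := y0 - t0 *: v; pose gamma s := cinv A c (yb + s *: v).
have ybt : yb + t0 *: v = y0 by rewrite /yb subrK.
have gt0 : gamma t0 = x0 by rewrite /gamma ybt chartK.
have yc : continuous (fun s : R => yb + s *: v).
  by move=> s; apply: cvgD; [exact: cvg_cst|apply: cvgZr_tmp; exact: cvg_id].
have gc : {for t0, continuous gamma}.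
  by apply: continuous_comp; [exact: yc|rewrite ybt; exact: cinv_continuous].
have wc : {for t0, continuous (fun s => w (Num.max 0 s) (gamma s))}.
  apply: (@continuous_comp _ _ _ (fun s : R => (gamma s, s)) (fun z : M * R => w (Num.max 0 z.2) z.1)); last exact: cw.
  by apply: (@cvg_pair _ _ _ _ (nbhs (gamma t0)) (nbhs t0)); [exact: gc|exact: cvg_id].
(* Maximality of [psi - f] at [x0] and of the penalized [w] at [t0] bounds the increase of [Th] up
   to [t0] by that of [w], hence by the action of the segment. *)
pose Th s := k * weight s + f (gamma s).
have dTh : is_derive t0 1 Th (k * (2 * lambda) * weight t0 + pairing v p).
  have h1 := is_derive_weight k t0.
  have df : differentiable (f \o cinv A c : _ -> R^o) (t0 *: v + yb).
    by rewrite addrC ybt; have [h _] := cf c y0 iy0; exact: nbhs_singleton h.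
  have h2 := is_derive_line df.
  rewrite (derive_gradient v df) addrC ybt in h2.
  have e1 : gradient (f \o cinv A c) y0 = p by rewrite /p /differential.
  rewrite e1 in h2; have h3 := is_deriveD h1 h2.
  have e2 : Th = (fun s => k * weight s) + (fun t => (f \o cinv A c) (t *: v + yb)).
    by apply/funext => s; rewrite /Th /gamma /= (addrC yb).
  by rewrite e2.
have key eta : 0 < eta -> k * (2 * lambda) * weight t0 + pairing v p <= pairing v p - in_chart H c y0 p u0 + eta.
  move=> eta0; apply: (le_derive_left dTh).
  have [[S1 S2] [/= n1 n2] hS] := hv eta eta0.
  have n1' : \forall y \near y0, S1 y /\ img A c y by apply: filterS2 n1 (near_img iy0) => y.
  have m1 : \forall s \near t0, S1 (yb + s *: v) /\ img A c (yb + s *: v).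
    have hy : \forall y \near yb + t0 *: v, S1 y /\ img A c y by rewrite ybt.
    exact: (yc t0 _ hy).
  have m2 : \forall s \near t0, S2 (w (Num.max 0 s) (gamma s)).
    have hu : \forall u \near w (Num.max 0 t0) (gamma t0), S2 u by rewrite max_r// gt0.
    exact: (wc _ hu).
  have m3 : \forall s \near t0, psi (gamma s) - f (gamma s) <= psi x0 - f x0.
    have h : \forall x \near gamma t0, psi x - f x <= psi x0 - f x0 by rewrite gt0.
    exact: gc h.
  have m4 : \forall s \near t0, 0 < s by exact: lt_nbhsr.
  have m : \forall s \near t0, [/\ S1 (yb + s *: v) /\ img A c (yb + s *: v), S2 (w (Num.max 0 s) (gamma s)),
      psi (gamma s) - f (gamma s) <= psi x0 - f x0 & 0 < s].
    have m34 : \forall s \near t0, psi (gamma s) - f (gamma s) <= psi x0 - f x0 /\ 0 < s.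
      by apply: filterS2 m3 m4 => s.
    by apply: filterS3 m1 m2 m34 => s s1 s2 [s3 s4]; split.
  move/nbhs_normP : m => [d /= d0 hd]; apply/nbhs_normP; exists d => // s /= sd st.
  have hs r : s <= r <= t0 -> [/\ S1 (yb + r *: v) /\ img A c (yb + r *: v), S2 (w (Num.max 0 r) (gamma r)),
      psi (gamma r) - f (gamma r) <= psi x0 - f x0 & 0 < r].
    move=> /andP[sr rt]; apply: hd => /=; apply: le_lt_trans sd.
    by rewrite !ger0_norm ?subr_ge0 ?(ltW st)// lerD2l lerN2.
  have [_ _ s3 s4] : [/\ S1 (yb + s *: v) /\ img A c (yb + s *: v), S2 (w (Num.max 0 s) (gamma s)),
      psi (gamma s) - f (gamma s) <= psi x0 - f x0 & 0 < s] by apply: hs; rewrite lexx ltW.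
  have hz r : s <= r <= t0 -> img A c (yb + r *: v) /\ forall q,
      pairing v q - in_chart H c (yb + r *: v) q (w r (gamma r)) <= pairing v p - in_chart H c y0 p u0 + eta.
    move=> sr; have [[r1 ri] r2 _ r4] := hs r sr; rewrite max_r ?(ltW r4)// in r2.
    by split => //; exact: (hS (yb + r *: v, w r (gamma r)) (conj r1 r2) ri).
  have [||L hL Lm] := @has_action_segment c w yb v s t0 (pairing v p - in_chart H c y0 p u0 + eta) (ltW s4) (ltW st) cw.
  - by move=> r /hz[].
  - by move=> r q /hz[_]; exact.
  have := D1 _ _ _ _ (ltW s4) hL; rewrite -/(gamma t0) -/(gamma s) gt0 -/u0 => h1.
  have := psi_ge (gamma s) s; rewrite (ltW s4) (le_trans (ltW st) t0T) => /(_ isT) h2.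
  rewrite /Th gt0; rewrite e0 -/u0 in s3; lra.
(* The pairings cancel. What remains is a bound at [u0], and replacing [u0] by [psi x0] costs half
   of it. *)
have key' : k * (2 * lambda) * weight t0 <= - in_chart H c y0 p u0.
  by apply/ler_addgt0Pr => eta eta0; have := key eta eta0; lra.
rewrite in_chart_center in key'.
have := hamiltonian_lipschitz H_C3 H_lipschitz x0 p (psi x0) u0.
have W1 := weight_ge1 t00.
have kW : 0 <= k * weight t0 by rewrite mulr_ge0// ltW// weight_gt0.
have -> : `|psi x0 - u0| = k * weight t0.
  by rewrite e0 -/u0 addrAC subrr add0r mulNr normrN ger0_norm.
rewrite ler_norml => /andP[_ h2].
have h3 : lambda * k <= lambda * (k * weight t0) by rewrite ler_wpM2l ?(ltW lambda0)// ler_peMr// ltW.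
have e3 : k * (2 * lambda) * weight t0 = 2 * (lambda * (k * weight t0)) by ring.
rewrite e3 in key'; lra.
Qed.

Lemma differentiable_expansion (F : 'rV[R]_n -> R) y0 (e : R) : differentiable (F : _ -> R^o) y0 -> 0 < e ->
  \forall y \near y0, `|F y - F y0 - pairing (y - y0) (gradient F y0)| <= e * `|y - y0|.
Proof.
move=> dF e0; have [_ /eqaddoP/(_ _ e0) E] := (@diff_locallyP R _ R^o y0 F).1 dF.
have /nbhs_normP[d /= d0 hd] : \forall h \near (0 : 'rV[R]_n),
    `|F (h + y0) - F y0 - 'd (F : 'rV[R]_n -> R^o) y0 h| <= e * `|h|.
  apply: filterS E => h; apply: le_trans.
  by rewrite le_eqVlt; apply/orP; left; apply/eqP; congr `|_|; rewrite -addrA -opprD.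
apply/nbhs_normP; exists d => // y /= hy.
have := hd (y - y0); rewrite /= sub0r normrN distrC subrK => /(_ hy).
by rewrite -deriveE// derive_gradient.
Qed.

(* Tilting the covector [p] by [e1] in the direction of the displacement makes
   leaving a small ball around [x0] cost a fixed amount, which a near-optimal
   curve cannot afford. *)
Lemma strict_supersolution w T k psi f x0 : sol w -> 0 < T -> 0 < k ->
  (forall x s, 0 <= s <= T -> psi x <= w s x + k * weight s) ->
  (forall x, exists2 t, 0 <= t <= T & psi x = w t x + k * weight t) ->
  (forall x, w T x + k * weight T < w 0 x + k * weight 0) ->
  C1_fun f -> (\forall y \near x0, psi x0 - f x0 <= psi y - f y) ->
  lambda * k <= H (x0, differential A f x0, psi x0).
Proof.
move=> sw T0 k0 psi_le psi_eq wT cf mn; have [cw D1 D2] := sw.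
have [t0 /andP[t00 t0T] e0] := psi_eq x0.
have t0_gt : 0 < t0.
  rewrite lt_neqAle t00 andbT; apply/eqP => t0E; have := psi_le x0 T; rewrite e0 -t0E lexx (ltW T0) => /(_ isT).
  by rewrite leNgt wT.
set c := x0; set y0 := chart A c c; have dc : dom A c c := dom_center A c.
have iy0 : img A c y0 := img_chart dc.
set p := differential A f x0; set u0 := w t0 x0.
have W1 := weight_ge1 t00.
have kW : 0 <= k * weight t0 by rewrite mulr_ge0// ltW// weight_gt0.
rewrite leNgt; apply/negP => Hlt.
have H0 : in_chart H c y0 p u0 < 2 * (lambda * (k * weight t0)).
  rewrite in_chart_center.
  have := hamiltonian_lipschitz H_C3 H_lipschitz x0 p (psi x0) u0.
  have -> : `|psi x0 - u0| = k * weight t0 by rewrite e0 -/u0 addrAC subrr add0r ger0_norm.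
  rewrite ler_norml => /andP[h1 _].
  have h3 : lambda * k <= lambda * (k * weight t0) by rewrite ler_wpM2l ?(ltW lambda0)// ler_peMr// ltW.
  lra.
(* A quarter of the gap, so that even [m + eta] stays below [2 * (lambda * k) * weight s] for [s]
   near [t0]. *)
pose eta := (2 * (lambda * (k * weight t0)) - in_chart H c y0 p u0) / 4.
have eta0 : 0 < eta by rewrite divr_gt0// subr_gt0.
pose m := in_chart H c y0 p u0 + eta.
have [[Sp S12] [/= np n12] hS] := near_chart_cont H_C3 p u0 iy0 eta0.
have [[S1 S2] [/= n1 n2] hS12] := n12.
have /nbhs_normP[b /= b0 hb] := np.
pose e1 := b / 2; have e10 : 0 < e1 by rewrite divr_gt0.
have /nbhs_normP[d /= d0 hd] := n2.
have [[N1 N2] [/= nN1 nN2] hN] : \forall z \near (x0, t0), `|w (Num.max 0 t0) x0 - w (Num.max 0 z.2) z.1| < d.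
  by have /cvgrPdist_lt := cw (x0, t0); apply.
have near_y (P : M -> Prop) : (\forall x \near x0, P x) -> \forall y \near y0, P (cinv A c y).
  by move=> h; apply: near_cinv => //; rewrite chartK.
have df : differentiable (f \o cinv A c : _ -> R^o) y0.
  by have [h _] := cf c y0 iy0; exact: nbhs_singleton h.
have e120 : 0 < e1 / 2 by rewrite divr_gt0.
have n3 : \forall y \near y0, [/\ S1 y, N1 (cinv A c y),
    psi x0 - f x0 <= psi (cinv A c y) - f (cinv A c y) &
    `|f (cinv A c y) - f x0 - pairing (y - y0) p| <= e1 / 2 * `|y - y0|].
  have h1 := near_y _ nN1; have h2 := near_y _ mn.
  have h3 := differentiable_expansion df e120.
  have h4 : \forall y \near y0, S1 y /\ N1 (cinv A c y) by apply: filterS2 n1 h1 => y.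
  apply: filterS3 h4 h2 h3 => y [s1 s2] s3; rewrite /= chartK// => s4; split => //.
have [r r0 r_img] := sqdist_img c.
have [rho' /andP[rho'0 rho'r] hrho] := near_sqdist r0 n3.
pose rho := rho' / 2; have rho0 : 0 < rho by rewrite divr_gt0.
have rho_img y : sqdist y y0 <= 3 * rho -> img A c y.
  by move=> h; apply: r_img; apply: le_trans h _; rewrite /rho; lra.
have lt0 : sqdist y0 y0 < rho by rewrite sqdistxx.
have /nbhs_normP[sg /= sg0 hsg] : \forall y \near y0, sqdist y y0 < rho.
  exact: (sqdist_continuous (lt_nbhsl lt0)).
have cW : \forall s \near t0, (m + eta) / (2 * (lambda * k)) < weight s.
  have lk : 0 < 2 * (lambda * k) by rewrite !mulr_gt0.
  have h : (m + eta) / (2 * (lambda * k)) < weight t0.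
    rewrite ltr_pdivrMr// /m; have : 4 * eta = 2 * (lambda * (k * weight t0)) - in_chart H c y0 p u0.
      by rewrite /eta; field.
    have -> : weight t0 * (2 * (lambda * k)) = 2 * (lambda * (k * weight t0)) by ring.
    lra.
  exact: (weight_continuous (lt_nbhsr h)).
have near_s : \forall s \near t0, N2 s /\ (m + eta) / (2 * (lambda * k)) < weight s.
  by apply: filterS2 nN2 cW => s.
move/nbhs_normP : near_s => [h' /= h'0 hh'].
pose h := Num.min h' t0 / 2.
have mh0 : 0 < Num.min h' t0 by rewrite lt_min h'0.
have h0 : 0 < h by rewrite divr_gt0.
have : h < Num.min h' t0 by rewrite /h ltr_pdivrMr// ltr_pMr// ltr1n.
rewrite lt_min => /andP[hh ht].
(* The accuracy is at most either loss: [eta * h] for a curve that stays close during time [h],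
   [e1 / 2 * sg] for one that comes in from outside the ball later. *)
pose ee := Num.min (eta * h) (e1 / 2 * sg).
have ee0 : 0 < ee by rewrite /ee lt_min (mulr_gt0 eta0 h0) (mulr_gt0 e120 sg0).
have [gamma [L [gx hL lt]]] := D2 t0 x0 ee t00 ee0.
have [_ [cg _] _] := hL.
have ab : t0 - h <= t0 by rewrite gerBl ltW.
have th0 : 0 <= t0 - h by rewrite subr_ge0 ltW.
(* While [F] is nonnegative the curve stays in the chart domain; a zero of [F] lies off the plateau
   of the cutoff, at distance at least [sg] from [y0]. *)
pose F s := cutoff c rho (gamma (clamp 0 t0 s)) - 1 / 2.
have cF : continuous F.
  move=> s; apply: (@continuousB _ _ _ (fun s => cutoff c rho (gamma (clamp 0 t0 s)))); last exact: cst_continuous.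
  apply: (@continuous_comp _ _ _ (gamma \o clamp 0 t0) (cutoff c rho)); first exact: (within_continuous_clamp t00 cg).
  exact: (C1_fun_continuous (C1_cutoff rho0 rho_img)).
have Ft0 : F t0 = 1 / 2.
  rewrite /F clamp_id ?t00 ?lexx// gx cutoff1// ?sqdistxx ?(ltW rho0)//; lra.
have [|s1 [/andP[s1a s1b] Fs hs]] := last_nonneg cF ab; first by rewrite Ft0 divr_ge0.
have s1_0 : 0 <= s1 := le_trans th0 s1a.
have s1t : s1 < t0.
  rewrite lt_neqAle s1b andbT; apply/eqP => e2; case: Fs => [e3|].
    by move: h0; rewrite -(ltrD2l (t0 - h)) subrK addr0 -e3 e2 ltxx.
  rewrite e2 Ft0 => /eqP; rewrite mul1r invr_eq0 (_ : 2 == 0 :> R = false)//; exact/negbTE/lt0r_neq0.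
have inN s : s1 <= s <= t0 -> dom A c (gamma s) /\ sqdist (chart A c (gamma s)) y0 < 2 * rho.
  move=> ss; have := hs s ss; rewrite /F clamp_id; last first.
    by case/andP: ss => a1 ->; rewrite (le_trans s1_0 a1).
  by rewrite subr_ge0 => a1; apply: (cutoff_gt0 rho0); apply: lt_le_trans a1; rewrite divr_gt0.
have near_P s : s1 <= s <= t0 -> [/\ S1 (chart A c (gamma s)), N1 (gamma s),
    psi x0 - f x0 <= psi (gamma s) - f (gamma s) &
    `|f (gamma s) - f x0 - pairing (chart A c (gamma s) - y0) p| <= e1 / 2 * `|chart A c (gamma s) - y0|].
  move=> ss; have [a1 a2] := inN s ss; have := hrho (chart A c (gamma s)); rewrite chartK//; apply.
  by apply: ltW; apply: lt_le_trans a2 _; rewrite /rho mulrC divfK.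
have near_t s : s1 <= s <= t0 -> N2 s /\ (m + eta) / (2 * (lambda * k)) < weight s.
  move=> /andP[a1 a2]; apply: hh' => /=; rewrite ger0_norm ?subr_ge0//.
  by apply: le_lt_trans hh; rewrite lerBlDr addrC -lerBlDr (le_trans s1a).
have [L1 [L2 [hL1 hL2 LE]]] := has_action_split s1_0 s1b hL.
pose y1 := chart A c (gamma s1).
have [q1 [q1n q1e]] := norm_pairing (y0 - y1).
pose q := p + e1 *: q1.
have hqb : `|p - q| < b.
  rewrite /q opprD addrA subrr sub0r normrN normrZ ger0_norm ?(ltW e10)//.
  apply: (@le_lt_trans _ _ e1); first by rewrite ler_piMr// ltW.
  by rewrite /e1 ltr_pdivrMr// ltr_pMr// ltr1n.
have hm s : s1 < s < t0 -> in_chart H c (chart A c (gamma s)) q (w s (gamma s)) <= m.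
  move=> /andP[a1 a2]; have ss : s1 <= s <= t0 by rewrite !ltW.
  have [b1 b2 _ _] := near_P s ss; have [b3 _] := near_t s ss.
  have s00 : 0 <= s := le_trans s1_0 (ltW a1).
  have b4 := hN (gamma s, s) (conj b2 b3); rewrite /= !max_r// in b4.
  have b5 := hS (q, (chart A c (gamma s), w s (gamma s))) (conj (hb _ hqb) (hS12 (_, _) (conj b1 (hd _ b4)))).
  by move: b5; rewrite /= ltr_norml /m => /andP[b5 _]; lra.
have a1 := has_action_ge_pairing s1t hL2 (fun s ss => proj1 (inN s ss)) hm.
rewrite gx -/y0 -/y1 /q pairingDr pairingZr q1e in a1.
have [|_ _ a2] := near_P s1; first by rewrite lexx.
rewrite -/y1 ler_norml => /andP[a3 _].
have a4 := psi_le (gamma s1) s1; rewrite s1_0 (le_trans s1b t0T) in a4; have {}a4 := a4 isT.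
have a5 := D1 _ _ _ _ (lexx 0) hL1.
have a6 : pairing (y1 - y0) p = - pairing (y0 - y1) p by rewrite -pairingNl opprB.
have a7 := weight_increment_ge s1 t0.
have [|_ a8] := near_t s1; first by rewrite lexx.
have lk : 0 < 2 * (lambda * k) by rewrite !mulr_gt0.
rewrite ltr_pdivrMr// in a8.
have ts0 : 0 < t0 - s1 by rewrite subr_gt0.
have a9 : (m + eta) * (t0 - s1) <= k * (weight t0 - weight s1).
  apply: le_trans (ler_wpM2l (ltW k0) a7).
  have -> : k * (2 * lambda * (t0 - s1) * weight s1) = weight s1 * (2 * (lambda * k)) * (t0 - s1) by ring.
  by rewrite ler_wpM2r ?(ltW ts0)// ltW.
(* Balance of the near-optimal curve against minimality of [psi - f] and of the penalized [w]. Half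
   of the tilt [e1] pays for the first-order error of [f]; the other half survives as a loss
   proportional to the displacement. *)
have a10 : eta * (t0 - s1) + e1 / 2 * `|y1 - y0| < ee.
  rewrite (distrC y0) in a1; rewrite a6 in a3; rewrite e0 -/u0 in a2.
  have c1 : (m + eta) * (t0 - s1) = m * (t0 - s1) + eta * (t0 - s1) by ring.
  have c2 : e1 * `|y1 - y0| = e1 / 2 * `|y1 - y0| + e1 / 2 * `|y1 - y0| by field.
  have c3 : k * (weight t0 - weight s1) = k * weight t0 - k * weight s1 by ring.
  rewrite c1 c3 in a9; rewrite c2 in a1; rewrite -/u0 LE in lt.
  move: a1 a2 a3 a4 a5 a9 lt.
  move: (m * (t0 - s1)) (eta * (t0 - s1)) (e1 / 2 * `|y1 - y0|) (k * weight t0) (k * weight s1) => Z1 Z2 Z3 Z4 Z5.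
  move: (pairing (y0 - y1) p) (psi (gamma s1)) (f (gamma s1)) (w s1 (gamma s1)) (w 0 (gamma 0)) => Z6 Z7 Z8 Z9 Z10.
  by rewrite opprK; clear; move=> *; lra.
have p1 : 0 <= eta * (t0 - s1) by rewrite mulr_ge0// ltW.
have p2 : 0 <= e1 / 2 * `|y1 - y0| by rewrite mulr_ge0// ltW.
have : ee <= eta * (t0 - s1) + e1 / 2 * `|y1 - y0|; last by rewrite leNgt a10.
case: Fs => [s1E|Fs0].
  apply: (@le_trans _ _ (eta * h)); first by rewrite ge_min lexx.
  have -> : t0 - s1 = h by rewrite s1E opprB addrC subrK.
  by rewrite lerDl.
apply: (@le_trans _ _ (e1 / 2 * sg)); first by rewrite ge_min lexx orbT.
apply: (@le_trans _ _ (e1 / 2 * `|y1 - y0|)); last by rewrite lerDr.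
rewrite ler_wpM2l ?(ltW e120)// leNgt; apply/negP => c1.
have c2 : sqdist y1 y0 < rho by apply: hsg; rewrite /= distrC.
have [|c3 _] := inN s1; first by rewrite lexx.
move: Fs0; rewrite /F clamp_id ?s1_0// cutoff1//; last exact: ltW.
lra.
Qed.

Lemma perturbation_dist (a b a' b' eps : R) : 0 <= eps -> eps <= 1 ->
  `|a + eps * b - (a' + eps * b')| <= `|a - a'| + `|b - b'|.
Proof.
move=> eps0 eps1; rewrite opprD addrACA -mulrBr; apply: le_trans (ler_normD _ _) _.
by rewrite lerD2l normrM (ger0_norm eps0) ler_piMl.
Qed.

Section Stability.
Variables (P : cotangent A * R -> R) (um : M -> R).
Hypotheses (P_C3 : Ck_cotangent 3 P) (P_bound : forall z, `|P z| <= 1)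
  (um_solution : viscosity_solution H um)
  (um_attractive : exists2 rho : R, 0 < rho & forall phi : M -> R, continuous phi ->
    supnorm (phi \- um) < rho -> supnorm (Tminus H phi t \- um) @[t --> +oo] --> 0).

Let um_continuous : continuous um. Proof. by case: um_solution. Qed.

Let um_bound : exists2 U, 0 <= U & forall x, `|um x| <= U.
Proof.
have [|U hU] := @continuous_bounded M setT um M_compact; first by move=> x _; exact: um_continuous.
by exists `|U| => // x; apply: le_trans (hU x _) (ler_norm _).
Qed.

(** Excludes the default value of [Tminus] for these data. Adding a constant does not affect
    domination, so the Lipschitz regularity of [um] serves for every [a]. *)
Let Tminus_sol a : sol (Tminus H (fun x => um x + a)) /\ Tminus H (fun x => um x + a) 0 = (fun x => um x + a).
Proof.
apply: backward_solution_sol; apply: xgetPex.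
have [U U0 hU] := um_bound; have [_ um_sub _] := um_solution.
have [|C1 C10 h1] := @lipschitz_dominated um.
  move=> c; have [K K0 [r r0 hK]] := subsolution_lipschitz c U0.
  exists K => //; exists r => //; apply: (hK H) => // z.
  by rewrite subrr normr0.
have [C2 C20 h2] := action_lower; have [C3 C30 h3] := stay.
have mono (C b : R) : 0 <= b -> C <= C1 + C2 + C3 -> C * b <= (C1 + C2 + C3) * b.
  by move=> b0 hC; rewrite ler_wpM2r.
have [||||||//|w hw] := @backward_solution_exists (fun x => um x + a) (U + `|a|) (C1 + C2 + C3).
- by rewrite addr_ge0.
- by move=> x; apply: le_trans (ler_normD _ _) _; rewrite lerD2r.
- by rewrite !addr_ge0.
- move=> gamma s t L hL; apply: le_trans (h2 _ _ _ _ hL); rewrite !mulNr lerN2.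
  by apply: mono; [rewrite subr_ge0 (has_action_le hL)|lra].
- move=> x s t s0 st; have [L hL Lm] := h3 x s t s0 st; exists L => //.
  by apply: le_trans Lm _; apply: mono; [rewrite subr_ge0|lra].
- move=> gamma s t L s0 hL; have := h1 gamma s t L s0 hL.
  have : C1 * (t - s) <= (C1 + C2 + C3) * (t - s) by apply: mono; [rewrite subr_ge0 (has_action_le hL)|lra].
  lra.
- by move=> x; apply: continuousD; [exact: um_continuous|exact: cst_continuous].
by exists w.
Qed.

(** The supremum of an unbounded set is a default value, so [supnorm] controls points only once
    continuity on the compact [M] has bounded the difference. *)
Let attracted a : exists2 rho : R, 0 < rho & forall a, `|a| < rho -> forall e, 0 < e ->
  \forall t \near +oo, forall x, `|Tminus H (fun x => um x + a) t x - um x| < e.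
Proof.
have [rho rho0 h] := um_attractive; exists rho => // b hb e e0.
have [sb wb0] := Tminus_sol b; have [cb _ _] := sb.
have /cvgrPdist_lt/(_ _ e0) : supnorm (Tminus H (fun x => um x + b) t \- um) @[t --> +oo] --> 0.
  apply: h; first by move=> x; apply: continuousD; [exact: um_continuous|exact: cst_continuous].
  apply: le_lt_trans hb; apply: supnorm_le => // x /=.
  by rewrite addrAC subrr add0r.
have n0 : \forall t \near +oo, (0 : R) <= t by exact: nbhs_pinfty_ge.
apply: filterS2 n0 => t t0; rewrite sub0r normrN => ht x.
have [|C hC] := @continuous_bounded M setT (Tminus H (fun x => um x + b) t \- um) M_compact.
  by move=> y _; apply: continuousB; [exact: (time_continuous_slice t0 cb)|exact: um_continuous].
have := @le_supnorm _ C x (fun y => hC y I) => h1.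
exact: le_lt_trans h1 (le_lt_trans (ler_norm _) ht).
Qed.

Let Tminus_um t x : 0 <= t -> Tminus H um t x = um x.
Proof.
have [su su0] := Tminus_sol 0.
have e : (fun x => um x + 0) = um by apply/funext => y; rewrite addr0.
rewrite e in su su0; apply: stationary => //.
have [rho rho0 h] := um_attractive; apply: h => //; apply: le_lt_trans rho0.
by apply: supnorm_le => // y /=; rewrite subrr normr0.
Qed.

Lemma perturbation_stable (delta : R) : 0 < delta -> exists2 eps_delta : R, 0 < eps_delta &
  forall eps : R, 0 <= eps <= eps_delta -> exists um_eps : M -> R,
    viscosity_solution (fun z => H z + eps * P z) um_eps /\ supnorm (um_eps \- um) <= delta.
Proof.
move=> delta0; have [rho1 rho10 att] := attracted 0.
have [U U0 hU] := um_bound.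
(* Below [rho1] for attraction, below [delta] for the final estimate. *)
pose rho := Num.min rho1 delta / 2.
have mr : 0 < Num.min rho1 delta by rewrite lt_min rho10.
have rho0 : 0 < rho by rewrite divr_gt0.
have : rho < Num.min rho1 delta by rewrite /rho ltr_pdivrMr// ltr_pMr// ltr1n.
rewrite lt_min => /andP[rr rd].
have r20 : 0 < rho / 2 by rewrite divr_gt0.
pose wm := Tminus H (fun x => um x + - rho); pose wp := Tminus H (fun x => um x + rho).
have am : \forall t \near +oo, forall x, `|wm t x - um x| < rho / 2.
  by apply: att => //; rewrite normrN ger0_norm// ltW.
have ap : \forall t \near +oo, forall x, `|wp t x - um x| < rho / 2.
  by apply: att => //; rewrite ger0_norm// ltW.
have n0 : \forall t \near +oo, (0 : R) < t by exact: nbhs_pinfty_gt.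
have [T [T0 hm hp]] : exists T : R, [/\ 0 < T, forall x, `|wm T x - um x| < rho / 2 &
    forall x, `|wp T x - um x| < rho / 2].
  have : \forall t \near +oo, [/\ (0 : R) < t, forall x, `|wm t x - um x| < rho / 2 &
    forall x, `|wp t x - um x| < rho / 2] by apply: filterS3 n0 am ap => t.
  by move=> /filter_ex[t ht]; exists t.
have WT := weight_gt0 T.
(* At time [T] the penalty is [rho / 4]; added to a distance below [rho / 2] it stays below the
   initial distance [rho], so time [0] is never extremal. *)
pose k := rho / 4 / weight T.
have k0 : 0 < k by rewrite !divr_gt0.
have kT : k * weight T = rho / 4 by rewrite /k divfK// gt_eqF.
have k00 : 0 < k * weight 0 by rewrite weight0 mulr1.
have [sm wm0] := Tminus_sol (- rho); have [sp wp0] := Tminus_sol rho.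
rewrite -/wm in sm wm0; rewrite -/wp in sp wp0.
have [cm _ _] := sm; have [cp _ _] := sp.
have cp' : time_continuous (fun t x => - wp t x).
  by move=> z; apply: (@continuousN _ _ _ (fun z : M * R => wp (Num.max 0 z.2) z.1)); exact: cp.
have [psi1 [cpsi1 psi1_ge psi1_eq]] := time_envelope (- k) (ltW T0) cm.
(* [time_envelope] maximizes, so the minimum of [wp + k * weight] is the negative of a maximum for
   [- wp], again with [- k]. *)
have [psi2' [cpsi2' psi2_ge psi2_eq]] := time_envelope (- k) (ltW T0) cp'.
pose psi2 x := - psi2' x.
have cpsi2 : continuous psi2 by move=> x; apply: continuousN; exact: cpsi2'.
have psi2_le x s : 0 <= s <= T -> psi2 x <= wp s x + k * weight s.
  by move=> sT; have := psi2_ge x s sT; rewrite /psi2 mulNr; lra.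
have psi2_eq' x : exists2 t, 0 <= t <= T & psi2 x = wp t x + k * weight t.
  by have [t tT e] := psi2_eq x; exists t => //; rewrite /psi2 e mulNr opprD !opprK.
have su : sol (Tminus H um) /\ Tminus H um 0 = um.
  have := Tminus_sol 0; have -> : (fun x => um x + 0) = um by apply/funext => y; rewrite addr0.
  by [].
have [su1 su0] := su.
have psi1um x : um x - rho <= psi1 x <= um x.
  apply/andP; split.
    have := psi1_ge x T; rewrite lexx (ltW T0) => /(_ isT); rewrite mulNr kT => h1.
    have := hm x; rewrite ltr_norml => /andP[h2 _]; lra.
  have [t /andP[t0 _] ->] := psi1_eq x; rewrite mulNr.
  have i1 y : wm 0 y - Tminus H um 0 y <= 0 by rewrite wm0 su0; lra.
  have := comparison sm su1 (lexx 0) i1 x t0; rewrite mulr0 mul0r Tminus_um// => h.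
  have : 0 <= k * weight t by rewrite mulr_ge0// ltW// weight_gt0.
  lra.
have psi2um x : um x <= psi2 x <= um x + rho.
  apply/andP; split.
    have [t /andP[t0 _] ->] := psi2_eq' x.
    have i1 y : Tminus H um 0 y - wp 0 y <= 0 by rewrite wp0 su0; lra.
    have := comparison su1 sp (lexx 0) i1 x t0; rewrite mulr0 mul0r Tminus_um// => h.
    have : 0 <= k * weight t by rewrite mulr_ge0// ltW// weight_gt0.
    lra.
  have := psi2_le x T; rewrite lexx (ltW T0) => /(_ isT); rewrite kT => h1.
  have := hp x; rewrite ltr_norml => /andP[_ h2]; lra.
have lk0 : 0 < lambda * k by rewrite mulr_gt0.
(* [eps <= 1] gives the closeness to [H] assumed in Perron's method; [eps <= lambda * k] is the
   margin of both barriers. *)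
exists (Num.min 1 (lambda * k)); first by rewrite lt_min ltr01.
move=> eps /andP[eps0]; rewrite le_min => /andP[eps1 epsk].
have epsP z : `|eps * P z| <= eps by rewrite normrM ger0_norm// ler_piMr.
have [|||||||||//|u [hu1 hu2]] := @perron (fun z => H z + eps * P z) psi1 psi2 (U + rho).
- by move=> z; rewrite addrAC subrr add0r (le_trans (epsP z)).
- move=> f c y0 u0 e cf iy0 e0; have e20 : 0 < e / 2 by rewrite divr_gt0.
  have h1 := near_differential u0 H_C3 cf iy0 e20.
  have h2 := near_differential u0 P_C3 cf iy0 e20.
  apply: filterS2 h1 h2 => z a1 a2; rewrite (splitr e); apply: le_lt_trans (ltrD a1 a2).
  by rewrite /in_chart; exact: perturbation_dist.
- by rewrite addr_ge0// ltW.
- move=> x; have := hU x; have := psi1um x; rewrite !ler_norml => /andP[a1 a2] /andP[a3 a4].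
  by apply/andP; split; lra.
- move=> x; have := hU x; have := psi2um x; rewrite !ler_norml => /andP[a1 a2] /andP[a3 a4].
  by apply/andP; split; lra.
- exact: cpsi1.
- exact: cpsi2.
- by move=> x; have /andP[_ a1] := psi1um x; have /andP[a2 _] := psi2um x; exact: le_trans a2.
- move=> f x /Ck1E cf mx; have wT y : wm 0 y - k * weight 0 < wm T y - k * weight T.
    by rewrite wm0 kT; have := hm y; rewrite ltr_norml => /andP[a1 _]; lra.
  have := strict_subsolution sm T0 k0 psi1_ge psi1_eq wT cf mx.
  have := le_trans (ler_norm _) (epsP (x, differential A f x, psi1 x)); lra.
- move=> f x /Ck1E cf mx; have wT y : wp T y + k * weight T < wp 0 y + k * weight 0.
    by rewrite wp0 kT; have := hp y; rewrite ltr_norml => /andP[_ a1]; lra.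
  have := strict_supersolution sp T0 k0 psi2_le psi2_eq' wT cf mx.
  have := epsP (x, differential A f x, psi2 x); rewrite ler_norml => /andP[a1 _]; lra.
exists u; split => //; apply: supnorm_le; first exact: ltW.
move=> x /=; have /andP[a1 a2] := hu2 x; have /andP[a3 _] := psi1um x; have /andP[_ a4] := psi2um x.
by rewrite ler_norml; apply/andP; split; lra.
Qed.

End Stability.
End TestFunctions.
End Action.

Theorem theorem1p1 (R : realType) (n : nat) (M : topologicalType)
    (A : atlas R n M) (g : riemannian_metric A)
    (M_hausdorff : hausdorff_space M)
    (M_compact : compact [set: M])
    (M_connected : connected [set: M])
    (H : cotangent A * R -> R)
    (H_C3 : Ck_cotangent 3 H)
    (H_convex : forall (x : M) (p : 'rV[R]_n) (u : R),
      posdef (hessian (fun q => H (x, q, u)) p))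
    (H_superlinear : forall (x : M) (u a : R), exists C : R,
      forall p : 'rV[R]_n, a * conorm g x p - C <= H (x, p, u))
    (H_lipschitz : exists2 lambda : R, 0 < lambda &
      forall (x : M) (p : 'rV[R]_n) (u : R),
        `| derive1 (fun s : R => H (x, p, s)) u | <= lambda)
    (P : cotangent A * R -> R)
    (P_C3 : Ck_cotangent 3 P)
    (P_support : compactly_supported P)
    (P_bound : forall z, `|P z| <= 1)
    (um : M -> R)
    (um_continuous : continuous um)
    (um_solution : viscosity_solution H um)
    (um_stable : lyapunov_asymptotically_stable H um) :
  forall delta : R, 0 < delta -> exists2 eps_delta : R, 0 < eps_delta &
    forall eps : R, 0 <= eps <= eps_delta ->
      exists um_eps : M -> R,
        viscosity_solution (fun z => H z + eps * P z) um_eps /\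
        supnorm (um_eps \- um) <= delta.
Proof.
have [lambda lambda0 H_lip] := H_lipschitz.
have [_ um_attractive] := um_stable.
exact: (perturbation_stable M_compact H_C3 H_convex H_superlinear H_lip lambda0 M_hausdorff
  P_C3 P_bound um_solution um_attractive).
Qed.
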